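(* Let $f(z)=z+\sum_{n\ge 2}a_nz^n$ belong to the class $S^*$ of normalized starlike univalent functions. Then $f'\in H^p$ for all $0<p<\frac{2}{4+|a_2|}$ and $f\in H^q$ for all $0<q<\frac{2}{2+|a_2|}$. Both estimates are sharp: for every $\alpha\in[0,2]$ there exists $f\in S^*$ with $|a_2|=\alpha$ such that $f'\notin H^{2/(4+\alpha)}$, and there exists $f\in S^*$ with $|a_2|=\alpha$ such that $f\notin H^{2/(2+\alpha)}$.
   Context: $\mathbb{D}$ is the open unit disk. $S$ is the class of univalent (injective holomorphic) functions $f(z)=z+\sum_{n=2}^\infty a_nz^n$ in $\mathbb{D}$; for $f\in S$ one has $|a_2|\le2$. $S^*\subset S$ consists of those $f\in S$ whose range $f(\mathbb{D})$ is starlike with respect to the origin. For $0<p<\infty$ the Hardy space $H^p$ is the set of holomorphic $f$ in $\mathbb{D}$ with $\sup_{r<1}\int_0^{2\pi}|f(re^{i\theta})|^p\,d\theta<\infty$. *)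

(* Defs.v *)
From Stdlib Require Import Reals.
From Coquelicot Require Import Coquelicot.

Local Open Scope R_scope.

Definition disk (z : C) : Prop := Cmod z < 1.

(* Functions on the disk are total functions [C -> C]; their values outside the
   disk are irrelevant.  Since the disk is open, [ex_derive] at each of its
   points (a limit in [C], with scalars in [C]) is complex differentiability. *)
Definition holomorphic_disk (f : C -> C) : Prop :=
  forall z : C, disk z ->
    @ex_derive C_AbsRing C_NormedModule f z.

(* The class S, together with the Taylor coefficients [a] of [f] at 0:
   f(z) = z + a_2 z^2 + a_3 z^3 + ... on the disk. *)
Definition class_S (f : C -> C) (a : nat -> C) : Prop :=
  holomorphic_disk f /\
  (forall z w : C, disk z -> disk w -> f z = f w -> z = w) /\
  a 0%nat = RtoC 0 /\ a 1%nat = RtoC 1 /\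
  (forall z : C, disk z ->
     @is_pseries C_AbsRing C_NormedModule a z (f z)).

Definition disk_image (f : C -> C) (w : C) : Prop :=
  exists z : C, disk z /\ f z = w.

Definition starlike_at_0 (E : C -> Prop) : Prop :=
  forall (w : C) (t : R), E w -> 0 <= t <= 1 -> E (Cmult (RtoC t) w).

Definition class_S_star (f : C -> C) (a : nat -> C) : Prop :=
  class_S f a /\ starlike_at_0 (disk_image f).

(* x^p for x >= 0 and p > 0.  The case x = 0 is separate because
   [Rpower 0 p] is 1 (it is exp (p * ln 0), and [ln 0] is 0). *)
Definition nneg_power (x p : R) : R :=
  if Req_dec_T x 0 then 0 else Rpower x p.

Definition polar (r t : R) : C := (r * cos t, r * sin t).

Definition integral_mean (p : R) (f : C -> C) (r : R) : R :=
  RInt (fun t : R => nneg_power (Cmod (f (polar r t))) p) 0 (2 * PI).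

(* For holomorphic [f] the integrand of [integral_mean] is continuous in [t],
   so the total operator [RInt] is the genuine integral here. *)
Definition Hardy (p : R) (f : C -> C) : Prop :=
  holomorphic_disk f /\
  exists M : R, forall r : R, 0 <= r < 1 -> integral_mean p f r <= M.

(* Main.v *)
Require Import Defs.
From Stdlib Require Import Reals Lra Lia Psatz Classical ClassicalEpsilon Ranalysis5.
From Coquelicot Require Import Coquelicot.

Local Open Scope R_scope.

(** Write [f z = z g z] and [P z = z f' z / f z = 1 + z g' z / g z], and let
    [c = |a_2| / 2].

    Starlikeness gives [Re P >= 0]: the lift [w] of [t f z] through [f] satisfies
    [w / z = t g z / g w], so Schwarz's lemma yields [|w| <= |z|], and letting [t]
    tend to 1 gives the sign ([starlike_subordination], [starlike_Re]).  The lift is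
    holomorphic because a univalent function is open and its derivative has no zero;
    the latter follows from the minimum principle for symmetric difference quotients
    ([univalent_open], [univalent_derivative_neq_0]).

    Next, [P = (1 + z phi) / (1 - z phi)] with [|phi| <= 1] and [phi 0 = a_2 / 2], and
    the lemma of Schwarz and Pick gives [|g' / g| <= 2 (c + r) / (1 - r^2)] on
    [|z| = r] ([starlike_log_derivative_bound]), whence [|g| <= (1 - r)^-(1 + c)]
    ([growth_bound]).  Since [d/dr |g|^q = q |g|^q (Re P - 1) / r] and [Re P] is
    nonnegative with mean 1, the growth bound alone controls the integral means of
    [|g|^q] when [q (1 + c) < 1] ([integral_means_bounded]).  This is the claim on [f].
    As [f' = g P] and [P] lies in [H^s] for all [s < 1] ([log_derivative_means_bounded]),
    the claim on [f'] follows by Hoelder's inequality with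
    [1 / p = 1 / q + 1 / s > 2 + c].

    All of this rests on the mean value property of continuously differentiable
    functions ([mean_value]), proved by differentiation under the integral sign, and
    on the maximum principle derived from it through Moebius maps ([max_modulus]).

    For the sharpness take [f z = z (1 - z)^-beta (1 + z)^-gamma] with
    [beta = 1 + alpha / 2] and [gamma = 1 - alpha / 2], for which [P] is a nonnegative
    combination of [(1 + z) / (1 - z)] and [(1 - z) / (1 + z)].  Conversely to the
    above, [Re P > 0] makes [f] univalent and starlike: [w -> ln f (e^w)] has a
    derivative of positive real part on a half-plane, which is convex
    ([radial_monotone], [criterion_injective], [criterion_starlike]).  Near [z = 1] the
    critical powers of [|f|] and [|f'|] are of the size of [1 / |1 - z|], whose circular
    means grow logarithmically ([unbounded_integral_means]). *)

(** * Continuity and complex differentiation *)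

Definition cts {T : UniformSpace} (f : T -> C) (x : T) : Prop :=
  @continuous T C_UniformSpace f x.

Definition rcts {T : UniformSpace} (f : T -> R) (x : T) : Prop :=
  @continuous T R_UniformSpace f x.

Lemma Cmod_ball (z w : C) (e : R) :
  ball (M := C_UniformSpace) z e w -> 0 < e -> Cmod (w - z) < 2 * e.
Proof.
  intros Hb He. assert (H := C_NormedModule_mixin_compat2 z w (mkposreal e He) Hb).
  simpl in H. change (minus w z) with (w - z)%C in H.
  assert (sqrt 2 < 2); [|nra].
  rewrite <- (sqrt_square 2) at 2 by lra. apply sqrt_lt_1; lra.
Qed.

Lemma locally_Cmod (P : C -> Prop) (z : C) (d : R) :
  0 < d -> (forall w, Cmod (w - z) < d -> P w) -> locally (T := C_UniformSpace) z P.
Proof.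
  intros Hd H. exists (mkposreal _ (Rdiv_lt_0_compat _ _ Hd Rlt_0_2)). intros w Hb.
  apply H. apply Cmod_ball in Hb; simpl in *; lra.
Qed.

Lemma cts_eps (f : C -> C) (z : C) :
  cts (T := C_UniformSpace) f z <->
  (forall eps, 0 < eps -> exists d, 0 < d /\
     forall w, Cmod (w - z) < d -> Cmod (f w - f z) < eps).
Proof.
  split.
  - intros H eps He.
    assert (Hs : 0 < eps / 2) by lra.
    destruct (proj1 (filterlim_locally _ _) H (mkposreal _ Hs)) as [d Hd].
    exists d; split; [apply cond_pos|].
    intros w Hw.
    assert (Hb : ball (f z) (mkposreal _ Hs) (f w)).
    { apply Hd. apply C_NormedModule_mixin_compat1. exact Hw. }
    apply Cmod_ball in Hb; simpl in *; lra.
  - intros H. apply filterlim_locally. intros eps.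
    destruct (H eps (cond_pos eps)) as [d [Hd Hw]].
    apply locally_Cmod with (1 := Hd). intros w H1.
    apply C_NormedModule_mixin_compat1. apply Hw, H1.
Qed.

Section Continuity.
Context {T : UniformSpace}.
Implicit Types (f g : T -> C) (u v : T -> R) (x : T).

Lemma cts_const (c : C) x : cts (fun _ => c) x.
Proof. apply continuous_const. Qed.

Lemma rcts_Re f x : cts f x -> rcts (fun y => Re (f y)) x.
Proof.
  intros H. apply (continuous_comp f (fst : C_UniformSpace -> R_UniformSpace)).
  exact H. apply continuous_fst.
Qed.

Lemma rcts_Im f x : cts f x -> rcts (fun y => Im (f y)) x.
Proof.
  intros H. apply (continuous_comp f (snd : C_UniformSpace -> R_UniformSpace)).
  exact H. apply continuous_snd.
Qed.

Lemma cts_pair u v x : rcts u x -> rcts v x -> cts (fun y => (u y, v y) : C) x.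
Proof.
  intros Hu Hv. apply filterlim_locally. intros eps.
  apply (filter_imp _ _ (fun y H => H)
    (filter_and _ _ (proj1 (filterlim_locally _ _) Hu eps)
                    (proj1 (filterlim_locally _ _) Hv eps))).
Qed.

Lemma cts_of_parts f x :
  rcts (fun y => Re (f y)) x -> rcts (fun y => Im (f y)) x -> cts f x.
Proof.
  intros Hu Hv.
  apply (@continuous_ext T C_UniformSpace (fun y => (Re (f y), Im (f y)))).
  - intros y. destruct (f y); reflexivity.
  - apply cts_pair; assumption.
Qed.

Lemma rcts_plus u v x : rcts u x -> rcts v x -> rcts (fun y => u y + v y) x.
Proof. exact (@continuous_plus T R_AbsRing R_NormedModule u v x). Qed.

Lemma rcts_opp u x : rcts u x -> rcts (fun y => - u y) x.
Proof. exact (@continuous_opp T R_AbsRing R_NormedModule u x). Qed.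

Lemma rcts_minus u v x : rcts u x -> rcts v x -> rcts (fun y => u y - v y) x.
Proof. exact (@continuous_minus T R_AbsRing R_NormedModule u v x). Qed.

Lemma rcts_mult u v x : rcts u x -> rcts v x -> rcts (fun y => u y * v y) x.
Proof. exact (@continuous_mult T R_AbsRing u v x). Qed.

Lemma rcts_comp (h : R -> R) u x :
  continuity_pt h (u x) -> rcts u x -> rcts (fun y => h (u y)) x.
Proof.
  intros Hh Hu.
  apply (continuous_comp u (h : R_UniformSpace -> R_UniformSpace)); [exact Hu|].
  apply continuity_pt_filterlim; exact Hh.
Qed.

Lemma cts_plus f g x : cts f x -> cts g x -> cts (fun y => (f y + g y)%C) x.
Proof.
  intros Hf Hg. apply cts_of_parts; simpl.
  - apply rcts_plus; apply rcts_Re; assumption.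
  - apply rcts_plus; apply rcts_Im; assumption.
Qed.

Lemma cts_opp f x : cts f x -> cts (fun y => (- f y)%C) x.
Proof.
  intros Hf. apply cts_of_parts; simpl; apply rcts_opp.
  - apply rcts_Re; assumption.
  - apply rcts_Im; assumption.
Qed.

Lemma cts_minus f g x : cts f x -> cts g x -> cts (fun y => (f y - g y)%C) x.
Proof. intros Hf Hg. apply cts_plus, cts_opp; assumption. Qed.

Lemma cts_mult f g x : cts f x -> cts g x -> cts (fun y => (f y * g y)%C) x.
Proof.
  intros Hf Hg.
  assert (Rf := rcts_Re _ _ Hf). assert (Rg := rcts_Re _ _ Hg).
  assert (If := rcts_Im _ _ Hf). assert (Ig := rcts_Im _ _ Hg).
  apply cts_of_parts; simpl.
  - apply rcts_minus; apply rcts_mult; assumption.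
  - apply rcts_plus; apply rcts_mult; assumption.
Qed.

Lemma cts_RtoC u x : rcts u x -> cts (fun y => RtoC (u y)) x.
Proof. intros H. apply cts_pair; [exact H | apply continuous_const]. Qed.

Lemma cts_comp (h : C -> C) f x :
  cts (T := C_UniformSpace) h (f x) -> cts f x -> cts (fun y => h (f y)) x.
Proof. intros Hh Hf. apply (continuous_comp f h); assumption. Qed.

Lemma rcts_Cmod f x : cts f x -> rcts (fun y => Cmod (f y)) x.
Proof.
  intros Hf. unfold Cmod. apply rcts_comp.
  - apply continuity_pt_sqrt. simpl. nra.
  - assert (Rf := rcts_Re f x Hf). assert (If := rcts_Im f x Hf).
    assert (O : rcts (fun _ : T => 1) x) by apply continuous_const.
    exact (rcts_plus _ _ _ (rcts_mult _ _ _ Rf (rcts_mult _ _ _ Rf O))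
                           (rcts_mult _ _ _ If (rcts_mult _ _ _ If O))).
Qed.

Lemma cts_loc f g x : locally x (fun y => f y = g y) -> cts f x -> cts g x.
Proof. intros H Hf. eapply continuous_ext_loc; eassumption. Qed.
End Continuity.

Lemma cts_id (z : C) : cts (T := C_UniformSpace) (fun w => w) z.
Proof. apply continuous_id. Qed.

Lemma cts_Cinv (z : C) : z <> 0%C -> cts (T := C_UniformSpace) Cinv z.
Proof.
  intros Hz.
  assert (Hn : Re z * (Re z * 1) + Im z * (Im z * 1) <> 0).
  { intros E; apply Hz; destruct z as [x y]; unfold Re, Im in E; simpl in E.
    apply injective_projections; simpl; nra. }
  assert (R : rcts (T := C_UniformSpace) Re z) by apply continuous_fst.
  assert (I : rcts (T := C_UniformSpace) Im z) by apply continuous_snd.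
  assert (O : rcts (T := C_UniformSpace) (fun _ => 1) z) by apply continuous_const.
  assert (N := rcts_plus (T := C_UniformSpace) _ _ _
    (rcts_mult (T := C_UniformSpace) _ _ _ R (rcts_mult (T := C_UniformSpace) _ _ _ R O))
    (rcts_mult (T := C_UniformSpace) _ _ _ I (rcts_mult (T := C_UniformSpace) _ _ _ I O))).
  assert (V := rcts_comp (T := C_UniformSpace) Rinv _ z
    (continuity_pt_inv _ _ (derivable_continuous_pt _ _ (derivable_pt_id _)) Hn) N).
  exact (cts_pair (T := C_UniformSpace) _ _ z
    (rcts_mult (T := C_UniformSpace) _ _ _ R V)
    (rcts_mult (T := C_UniformSpace) _ _ _ (rcts_opp (T := C_UniformSpace) _ _ I) V)).
Qed.

Lemma cts_inv {T : UniformSpace} (f : T -> C) (x : T) :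
  cts f x -> f x <> 0%C -> cts (fun y => (/ f y)%C) x.
Proof. intros Hf Hn. apply (cts_comp Cinv f); [apply cts_Cinv|]; assumption. Qed.

Lemma cts_div {T : UniformSpace} (f g : T -> C) (x : T) :
  cts f x -> cts g x -> g x <> 0%C -> cts (fun y => (f y / g y)%C) x.
Proof. intros Hf Hg Hn. apply cts_mult; [|apply cts_inv]; assumption. Qed.

(** Caratheodory's form of the derivative: the difference quotient at [z],
    completed by the value [l], is continuous at [z].  No neighbourhood is
    mentioned, so the product, chain and inverse function rules become identities
    between continuous functions. *)
Definition cderiv (f : C -> C) (z l : C) : Prop :=
  exists q : C -> C, cts (T := C_UniformSpace) q z /\ q z = l /\
    forall w, f w = (f z + q w * (w - z))%C.

Lemma Ceq_dec (z w : C) : {z = w} + {z <> w}.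
Proof.
  destruct z as [a b], w as [c d].
  destruct (Req_dec_T a c) as [->|H]; [destruct (Req_dec_T b d) as [->|H]|].
  - left; reflexivity.
  - right; intros E; apply H; congruence.
  - right; intros E; apply H; congruence.
Qed.

Lemma Csub_neq (z w : C) : z <> w -> (z - w)%C <> 0%C.
Proof. intros H E. apply H. replace z with (z - w + w)%C by ring. rewrite E. ring. Qed.

Lemma cderiv_eps (f : C -> C) (z l : C) :
  cderiv f z l <->
  (forall eps, 0 < eps -> exists d, 0 < d /\
     forall w, Cmod (w - z) < d ->
       Cmod (f w - f z - l * (w - z)) <= eps * Cmod (w - z)).
Proof.
  split.
  - intros [q [Hq [Hl Hw]]] eps He.
    destruct (proj1 (cts_eps _ _) Hq eps He) as [d [Hd H]].
    exists d; split; [exact Hd|]. intros w Hwd.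
    rewrite (Hw w). rewrite <- Hl.
    replace (f z + q w * (w - z) - f z - q z * (w - z))%C
      with ((q w - q z) * (w - z))%C by ring.
    rewrite Cmod_mult. apply Rmult_le_compat_r; [apply Cmod_ge_0|].
    left; apply H; exact Hwd.
  - intros H.
    exists (fun w => if Ceq_dec w z then l else ((f w - f z) / (w - z))%C).
    split; [|split].
    + apply cts_eps. intros eps He.
      destruct (H (eps / 2)) as [d [Hd Hw]]; [lra|].
      exists d; split; [exact Hd|]. intros w Hwd. cbv beta.
      destruct (Ceq_dec z z) as [_|E]; [|now destruct E].
      destruct (Ceq_dec w z) as [->|Hne].
      * unfold Cminus. rewrite Cplus_opp_r, Cmod_0; exact He.
      * assert (Hn := Csub_neq _ _ Hne).
        assert (Hp := proj1 (Cmod_gt_0 _) Hn).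
        replace ((f w - f z) / (w - z) - l)%C
          with ((f w - f z - l * (w - z)) / (w - z))%C by (field; exact Hn).
        rewrite Cmod_div by exact Hn.
        apply Rle_lt_trans with (eps / 2); [|lra].
        apply Rmult_le_reg_r with (Cmod (w - z)); [exact Hp|].
        unfold Rdiv at 1. rewrite Rmult_assoc, Rinv_l by lra.
        rewrite Rmult_1_r. apply Hw; exact Hwd.
    + destruct (Ceq_dec z z) as [_|E]; [reflexivity|now destruct E].
    + intros w. destruct (Ceq_dec w z) as [->|Hne].
      * ring.
      * field. apply Csub_neq; exact Hne.
Qed.

Lemma is_derive_cderiv (f : C -> C) (z l : C) :
  @is_derive C_AbsRing C_NormedModule f z l <-> cderiv f z l.
Proof.
  rewrite cderiv_eps. split.
  - intros [_ H] eps He.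
    destruct (H z (fun P HP => HP) (mkposreal _ He)) as [d Hd].
    exists d; split; [apply cond_pos|]. intros w Hw.
    specialize (Hd w Hw). simpl in Hd.
    replace (f w - f z - l * (w - z))%C with (f w - f z - (w - z) * l)%C by ring.
    exact Hd.
  - intros H. split.
    + apply (@is_linear_scal_l C_AbsRing C_NormedModule l).
    + intros x Hx.
      assert (E : z = x) by (apply (@is_filter_lim_locally_unique _ (AbsRing_NormedModule C_AbsRing)); exact Hx).
      subst x. intros eps.
      destruct (H eps (cond_pos eps)) as [d [Hd Hw]].
      exists (mkposreal _ Hd). intros w Hb. specialize (Hw w Hb).
      replace (f w - f z - l * (w - z))%C with (f w - f z - (w - z) * l)%C in Hw by ring.
      exact Hw.
Qed.

Lemma cderiv_cts (f : C -> C) (z l : C) :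
  cderiv f z l -> cts (T := C_UniformSpace) f z.
Proof.
  intros [q [Hq [_ Hw]]].
  apply (cts_loc (T := C_UniformSpace) (fun w => (f z + q w * (w - z))%C)).
  - apply filter_forall. intros w. symmetry. apply Hw.
  - apply (cts_plus (T := C_UniformSpace)); [apply cts_const|].
    apply (cts_mult (T := C_UniformSpace)); [exact Hq|].
    apply (cts_minus (T := C_UniformSpace)); [apply cts_id | apply cts_const].
Qed.

Lemma cderiv_const (c z : C) : cderiv (fun _ => c) z 0%C.
Proof.
  exists (fun _ => 0%C). split; [apply cts_const|]. split; [reflexivity|].
  intros w. ring.
Qed.

Lemma cderiv_id (z : C) : cderiv (fun w => w) z 1%C.
Proof.
  exists (fun _ => 1%C). split; [apply cts_const|]. split; [reflexivity|].
  intros w. ring.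
Qed.

Lemma cderiv_plus (f g : C -> C) (z k l : C) :
  cderiv f z k -> cderiv g z l -> cderiv (fun w => (f w + g w)%C) z (k + l)%C.
Proof.
  intros [q [Hq [Eq Hf]]] [r [Hr [Er Hg]]].
  exists (fun w => (q w + r w)%C). split; [apply (cts_plus (T := C_UniformSpace)); assumption|].
  split; [now rewrite Eq, Er|]. intros w. rewrite (Hf w), (Hg w). ring.
Qed.

Lemma cderiv_mult (f g : C -> C) (z k l : C) :
  cderiv f z k -> cderiv g z l ->
  cderiv (fun w => (f w * g w)%C) z (k * g z + f z * l)%C.
Proof.
  intros Df Dg. assert (Cg := cderiv_cts _ _ _ Dg).
  destruct Df as [q [Hq [Eq Hf]]], Dg as [r [Hr [Er Hg]]].
  exists (fun w => (q w * g w + f z * r w)%C). split.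
  - apply (cts_plus (T := C_UniformSpace)); apply (cts_mult (T := C_UniformSpace));
      try assumption; apply cts_const.
  - split; [now rewrite Eq, Er|]. intros w. rewrite (Hf w) at 1.
    replace (f z * g z)%C with (f z * (g w - r w * (w - z)))%C; [ring|].
    rewrite (Hg w). ring.
Qed.

Lemma cderiv_comp (f g : C -> C) (z k l : C) :
  cderiv f (g z) k -> cderiv g z l -> cderiv (fun w => f (g w)) z (k * l)%C.
Proof.
  intros [q [Hq [Eq Hf]]] Dg. assert (Cg := cderiv_cts _ _ _ Dg).
  destruct Dg as [r [Hr [Er Hg]]].
  exists (fun w => (q (g w) * r w)%C). split.
  - apply (cts_mult (T := C_UniformSpace)); [|exact Hr].
    apply (cts_comp (T := C_UniformSpace)); assumption.
  - split; [now rewrite Eq, Er|]. intros w. rewrite (Hf (g w)).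
    rewrite (Hg w) at 2. ring.
Qed.

Lemma cderiv_Cinv (z : C) : z <> 0%C -> cderiv Cinv z (- / (z * z))%C.
Proof.
  intros Hz. apply cderiv_eps. intros eps He.
  set (m := Cmod z). assert (Hm : 0 < m) by (apply Cmod_gt_0; exact Hz).
  exists (Rmin (m / 2) (eps * (m * m * m) / 2)). split.
  { apply Rmin_pos; [lra|]. apply Rdiv_lt_0_compat; [|lra].
    repeat apply Rmult_lt_0_compat; assumption. }
  intros w Hw.
  assert (H1 := Rlt_le_trans _ _ _ Hw (Rmin_l _ _)).
  assert (H2 := Rlt_le_trans _ _ _ Hw (Rmin_r _ _)).
  assert (Hwm : m / 2 < Cmod w).
  { assert (H := Cmod_triangle w (z - w)).
    replace (w + (z - w))%C with z in H by ring. fold m in H.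
    rewrite <- (Cmod_opp (z - w)) in H.
    replace (- (z - w))%C with (w - z)%C in H by ring. lra. }
  assert (Hw0 : w <> 0%C) by (apply Cmod_gt_0; lra).
  replace (/ w - / z - - / (z * z) * (w - z))%C
    with ((w - z) / (w * (z * z)) * (w - z))%C by (field; split; assumption).
  rewrite Cmod_mult. apply Rmult_le_compat_r; [apply Cmod_ge_0|].
  rewrite Cmod_div by (apply Cmult_neq_0; [|apply Cmult_neq_0]; assumption).
  rewrite !Cmod_mult. fold m.
  assert (Hmm : 0 < m * m) by nra.
  apply Rmult_le_reg_r with (Cmod w * (m * m)); [nra|].
  assert (HD : 0 < Cmod w * (m * m)) by nra.
  unfold Rdiv. rewrite Rmult_assoc, Rinv_l by lra.
  rewrite Rmult_1_r. apply Rle_trans with (eps * (m / 2 * (m * m))); [lra|].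
  apply Rmult_le_compat_l; nra.
Qed.

Lemma cderiv_ext (f g : C -> C) (z l : C) (d : R) :
  0 < d -> (forall w, Cmod (w - z) < d -> f w = g w) ->
  cderiv f z l -> cderiv g z l.
Proof.
  intros Hd E. rewrite !cderiv_eps. intros H eps He.
  destruct (H eps He) as [d' [Hd' Hw]].
  exists (Rmin d d'). split; [now apply Rmin_pos|]. intros w Hm.
  assert (Hz : Cmod (z - z) < d) by (unfold Cminus; rewrite Cplus_opp_r, Cmod_0; exact Hd).
  rewrite <- (E z Hz), <- (E w).
  - apply Hw. eapply Rlt_le_trans; [exact Hm|apply Rmin_r].
  - eapply Rlt_le_trans; [exact Hm|apply Rmin_l].
Qed.

(** If [f o h = g] near [a], with [h] continuous and [f' (h a) <> 0], then [h] is
    differentiable: writing [f w = f (h a) + q w (w - h a)] and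
    [g b = g a + r b (b - a)] one gets [h b - h a = r b / q (h b) * (b - a)]. *)
Lemma cderiv_lift (f g h : C -> C) (a k l : C) (d : R) :
  0 < d -> (forall b, Cmod (b - a) < d -> f (h b) = g b) ->
  cts (T := C_UniformSpace) h a -> cderiv f (h a) l -> l <> 0%C ->
  cderiv g a k -> cderiv h a (k / l)%C.
Proof.
  intros Hd E Ch [q [Hq [Eq Hf]]] Hl [s [Hs [Es Hg]]].
  set (r := fun b => q (h b)).
  assert (Cr : cts (T := C_UniformSpace) r a)
    by (apply (cts_comp (T := C_UniformSpace) q h); assumption).
  assert (Er : r a = l) by (unfold r; exact Eq).
  assert (Hlm : 0 < Cmod l) by (apply Cmod_gt_0; exact Hl).
  destruct (proj1 (cts_eps _ _) Cr (Cmod l) Hlm) as [d1 [Hd1 Hr]].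
  assert (Haa : Cmod (a - a) < d) by (unfold Cminus; rewrite Cplus_opp_r, Cmod_0; exact Hd).
  apply (cderiv_ext (fun b => (h a + s b / r b * (b - a))%C) _ _ _ (Rmin d d1)).
  - now apply Rmin_pos.
  - intros b Hb.
    assert (Hb1 := Rlt_le_trans _ _ _ Hb (Rmin_l _ _)).
    assert (Hb2 := Rlt_le_trans _ _ _ Hb (Rmin_r _ _)).
    assert (Hrb : r b <> 0%C).
    { intros E0. specialize (Hr b Hb2). rewrite Er, E0 in Hr.
      replace (0 - l)%C with (- l)%C in Hr by ring. rewrite Cmod_opp in Hr. lra. }
    assert (H := Hf (h b)). rewrite (E b Hb1), (E a Haa), (Hg b) in H. fold (r b) in H.
    replace (s b / r b * (b - a))%C with ((g a + s b * (b - a) - g a) / r b)%C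
      by (field; exact Hrb).
    rewrite H. field. exact Hrb.
  - exists (fun b => (s b / r b)%C). split; [|split].
    + apply (cts_div (T := C_UniformSpace)); [exact Hs | exact Cr | rewrite Er; exact Hl].
    + now rewrite Er, Es.
    + intros b. unfold Cminus. ring.
Qed.

(** Continuity of the derivative is part of the notion because the mean value property
    is proved by differentiating under the integral sign. *)
Definition holo (U : C -> Prop) (f f' : C -> C) : Prop :=
  forall z, U z -> cderiv f z (f' z) /\ cts (T := C_UniformSpace) f' z.

Section Holo.
Variable U : C -> Prop.
Implicit Types f g : C -> C.

Lemma holo_cts f f' z : holo U f f' -> U z -> cts (T := C_UniformSpace) f z.
Proof. intros H Hz. eapply cderiv_cts, H, Hz. Qed.

Lemma holo_const c : holo U (fun _ => c) (fun _ => 0%C).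
Proof. intros z _. split; [apply cderiv_const | apply cts_const]. Qed.

Lemma holo_id : holo U (fun w => w) (fun _ => 1%C).
Proof. intros z _. split; [apply cderiv_id | apply cts_const]. Qed.

Lemma holo_plus f f' g g' : holo U f f' -> holo U g g' ->
  holo U (fun w => (f w + g w)%C) (fun w => (f' w + g' w)%C).
Proof.
  intros Hf Hg z Hz. destruct (Hf z Hz), (Hg z Hz). split.
  - apply cderiv_plus; assumption.
  - apply (cts_plus (T := C_UniformSpace)); assumption.
Qed.

Lemma holo_mult f f' g g' : holo U f f' -> holo U g g' ->
  holo U (fun w => (f w * g w)%C) (fun w => (f' w * g w + f w * g' w)%C).
Proof.
  intros Hf Hg z Hz. destruct (Hf z Hz), (Hg z Hz). split.
  - apply cderiv_mult; assumption.
  - apply (cts_plus (T := C_UniformSpace)); apply (cts_mult (T := C_UniformSpace));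
      try assumption; eapply holo_cts; eassumption.
Qed.

Lemma holo_ext f f' g g' : (forall z, f z = g z) -> (forall z, f' z = g' z) ->
  holo U f f' -> holo U g g'.
Proof.
  intros E E' H z Hz. destruct (H z Hz) as [D Ct]. split.
  - rewrite <- E'. apply (cderiv_ext f _ _ _ 1); [lra | intros; apply E | exact D].
  - apply (cts_loc (T := C_UniformSpace) f'); [apply filter_forall; exact E' | exact Ct].
Qed.

Lemma holo_scal c f f' : holo U f f' -> holo U (fun w => (c * f w)%C) (fun w => (c * f' w)%C).
Proof.
  intros H. eapply holo_ext; [| |exact (holo_mult _ _ _ _ (holo_const c) H)];
    intros z; simpl; ring.
Qed.

Lemma holo_opp f f' : holo U f f' -> holo U (fun w => (- f w)%C) (fun w => (- f' w)%C).
Proof.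
  intros H. eapply holo_ext; [| |exact (holo_scal (- (1))%C _ _ H)];
    intros z; simpl; ring.
Qed.

Lemma holo_minus f f' g g' : holo U f f' -> holo U g g' ->
  holo U (fun w => (f w - g w)%C) (fun w => (f' w - g' w)%C).
Proof. intros Hf Hg. apply holo_plus, holo_opp; assumption. Qed.

Lemma holo_inv f f' : holo U f f' -> (forall z, U z -> f z <> 0%C) ->
  holo U (fun w => (/ f w)%C) (fun w => (- / (f w * f w) * f' w)%C).
Proof.
  intros H Hn z Hz. destruct (H z Hz) as [D Ct]. split.
  - apply (cderiv_comp Cinv f); [apply cderiv_Cinv, Hn, Hz | exact D].
  - apply (cts_mult (T := C_UniformSpace)); [|exact Ct].
    apply (cts_opp (T := C_UniformSpace)), (cts_inv (T := C_UniformSpace)).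
    + apply (cts_mult (T := C_UniformSpace)); eapply holo_cts; eassumption.
    + apply Cmult_neq_0; apply Hn, Hz.
Qed.

Lemma holo_div f f' g g' : holo U f f' -> holo U g g' ->
  (forall z, U z -> g z <> 0%C) ->
  holo U (fun w => (f w / g w)%C)
    (fun w => (f' w / g w + f w * (- / (g w * g w) * g' w))%C).
Proof. intros Hf Hg Hn. apply holo_mult, holo_inv; assumption. Qed.

Lemma holo_comp (V : C -> Prop) f f' g g' : holo V f f' -> holo U g g' ->
  (forall z, U z -> V (g z)) ->
  holo U (fun w => f (g w)) (fun w => (f' (g w) * g' w)%C).
Proof.
  intros Hf Hg HV z Hz. destruct (Hg z Hz) as [D Ct], (Hf _ (HV z Hz)) as [D' Ct'].
  split.
  - apply cderiv_comp; assumption.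
  - apply (cts_mult (T := C_UniformSpace)); [|exact Ct].
    apply (cts_comp (T := C_UniformSpace)); [exact Ct'|]. eapply cderiv_cts; eassumption.
Qed.

Lemma holo_ext_on f f' g g' :
  (forall z, U z -> exists d, 0 < d /\ forall w, Cmod (w - z) < d -> U w) ->
  (forall z, U z -> f z = g z) -> (forall z, U z -> f' z = g' z) ->
  holo U f f' -> holo U g g'.
Proof.
  intros HU E E' H z Hz. destruct (H z Hz) as [D Ct], (HU z Hz) as [d [Hd Hw]]. split.
  - rewrite <- E' by exact Hz. apply (cderiv_ext f _ _ _ d); auto.
  - apply (cts_loc (T := C_UniformSpace) f'); [|exact Ct].
    apply locally_Cmod with (1 := Hd). intros w H1. apply E', Hw, H1.
Qed.

Lemma holo_mono (V : C -> Prop) f f' : (forall z, V z -> U z) -> holo U f f' -> holo V f f'.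
Proof. intros H Hf z Hz. apply Hf, H, Hz. Qed.
End Holo.

(** * Differentiation along curves *)

(** To first order at [s] the product is [u s * v], because [v s = 0]. *)
Lemma is_derive_mult_vanishing (u v : R -> R) (s a : R) :
  rcts (T := R_UniformSpace) u s -> is_derive v s a -> v s = 0 ->
  is_derive (fun x => u x * v x) s (u s * a).
Proof.
  intros Hu Hv V0.
  apply is_derive_Reals. apply is_derive_Reals in Hv. intros eps He.
  assert (Hk : 0 < eps / (Rabs (u s) + 1 + Rabs a + 1)).
  { apply Rdiv_lt_0_compat; [exact He|].
    assert (H1 := Rabs_pos (u s)); assert (H2 := Rabs_pos a); lra. }
  set (k := Rmin 1 (eps / (Rabs (u s) + 1 + Rabs a + 1))).
  assert (Hkp : 0 < k) by (apply Rmin_pos; lra).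
  destruct (Hv k Hkp) as [d1 H1].
  destruct (proj1 (filterlim_locally _ _) Hu (mkposreal _ Hkp)) as [d2 H2].
  exists (mkposreal _ (Rmin_pos _ _ (cond_pos d1) (cond_pos d2))).
  intros h Hh Hd. simpl in Hd.
  specialize (H1 h Hh (Rlt_le_trans _ _ _ Hd (Rmin_l _ _))).
  assert (Hb : ball s d2 (s + h)).
  { change (Rabs (s + h - s) < d2). replace (s + h - s) with h by ring.
    exact (Rlt_le_trans _ _ _ Hd (Rmin_r _ _)). }
  assert (H3 : Rabs (u (s + h) - u s) < k) by exact (H2 _ Hb).
  rewrite V0 in *.
  set (Q := (v (s + h) - 0) / h) in *.
  replace ((u (s + h) * v (s + h) - u s * 0) / h - u s * a)
    with (u (s + h) * (Q - a) + (u (s + h) - u s) * a) by (unfold Q; field; exact Hh).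
  assert (Hk1 : k <= 1) by apply Rmin_l.
  assert (Hk2 : k * (Rabs (u s) + 1 + Rabs a + 1) <= eps).
  { apply Rle_trans with (eps / (Rabs (u s) + 1 + Rabs a + 1) * (Rabs (u s) + 1 + Rabs a + 1)).
    - apply Rmult_le_compat_r; [|apply Rmin_r].
      assert (H4 := Rabs_pos (u s)); assert (H5 := Rabs_pos a); lra.
    - right; field. assert (H4 := Rabs_pos (u s)); assert (H5 := Rabs_pos a); lra. }
  eapply Rle_lt_trans; [apply Rabs_triang|]. rewrite !Rabs_mult.
  assert (H6 : Rabs (u (s + h)) <= Rabs (u s) + 1).
  { replace (u (s + h)) with (u s + (u (s + h) - u s)) by ring.
    eapply Rle_trans; [apply Rabs_triang|]. lra. }
  assert (H4 := Rabs_pos (u s)); assert (H5 := Rabs_pos a).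
  assert (H7 := Rabs_pos (Q - a)); assert (H8 := Rabs_pos (u (s + h) - u s)).
  assert (H9 := Rabs_pos (u (s + h))). nra.
Qed.

Lemma is_derive_rcts (u : R -> R) (s a : R) :
  is_derive u s a -> rcts (T := R_UniformSpace) u s.
Proof. intros H. 
  apply (@ex_derive_continuous R_AbsRing R_NormedModule u s). exists a; exact H. Qed.

(** The chain rule, split into real and imaginary parts because circular means are
    taken of real functions. *)
Lemma cderiv_along (f : C -> C) (c : R -> C) (s : R) (l d : C) :
  cderiv f (c s) l ->
  is_derive (fun x => Re (c x)) s (Re d) -> is_derive (fun x => Im (c x)) s (Im d) ->
  is_derive (fun x => Re (f (c x))) s (Re (l * d)%C) /\
  is_derive (fun x => Im (f (c x))) s (Im (l * d)%C).
Proof.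
  intros [q [Hq [Eq Hf]]] D1 D2.
  assert (Cc : cts (T := R_UniformSpace) c s).
  { apply cts_of_parts; eapply is_derive_rcts; eassumption. }
  assert (Cq : cts (T := R_UniformSpace) (fun x => q (c x)) s)
    by (apply (cts_comp (T := R_UniformSpace)); assumption).
  assert (V1 : is_derive (fun x => Re (c x) - Re (c s)) s (Re d)).
  { replace (Re d) with (Re d - 0) by ring.
    apply (is_derive_minus (V := R_NormedModule)); [exact D1|].
    apply (is_derive_const (V := R_NormedModule)). }
  assert (V2 : is_derive (fun x => Im (c x) - Im (c s)) s (Im d)).
  { replace (Im d) with (Im d - 0) by ring.
    apply (is_derive_minus (V := R_NormedModule)); [exact D2|].
    apply (is_derive_const (V := R_NormedModule)). }
  assert (Cre := rcts_Re (T := R_UniformSpace) _ _ Cq).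
  assert (Cim := rcts_Im (T := R_UniformSpace) _ _ Cq).
  rewrite <- Eq. split.
  - apply (is_derive_ext (fun x => Re (f (c s)) +
      (Re (q (c x)) * (Re (c x) - Re (c s)) - Im (q (c x)) * (Im (c x) - Im (c s))))).
    { intros x. rewrite (Hf (c x)). simpl. unfold Re, Im. ring. }
    replace (Re (q (c s) * d)) with (0 + (Re (q (c s)) * Re d - Im (q (c s)) * Im d))
      by (simpl; unfold Re, Im; ring).
    apply (is_derive_plus (V := R_NormedModule)); [apply (is_derive_const (V := R_NormedModule))|].
    apply (is_derive_minus (V := R_NormedModule));
      apply (is_derive_mult_vanishing (fun x => _ (q (c x)))); try assumption; apply Rminus_diag.
  - apply (is_derive_ext (fun x => Im (f (c s)) +
      (Re (q (c x)) * (Im (c x) - Im (c s)) + Im (q (c x)) * (Re (c x) - Re (c s))))).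
    { intros x. rewrite (Hf (c x)). simpl. unfold Re, Im. ring. }
    replace (Im (q (c s) * d)) with (0 + (Re (q (c s)) * Im d + Im (q (c s)) * Re d))
      by (simpl; unfold Re, Im; ring).
    apply (is_derive_plus (V := R_NormedModule)); [apply (is_derive_const (V := R_NormedModule))|].
    apply (is_derive_plus (V := R_NormedModule));
      apply (is_derive_mult_vanishing (fun x => _ (q (c x)))); try assumption; apply Rminus_diag.
Qed.

(** * The mean value property and the maximum modulus principle *)

Lemma Cmod_polar (r t : R) : Cmod (polar r t) = Rabs r.
Proof.
  unfold Cmod, polar; simpl.
  replace (r * cos t * (r * cos t * 1) + r * sin t * (r * sin t * 1))
    with (Rsqr r * (Rsqr (sin t) + Rsqr (cos t))) by (unfold Rsqr; ring).
  rewrite sin2_cos2, Rmult_1_r. apply sqrt_Rsqr_abs.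
Qed.

Lemma polar_scal (r t : R) : polar r t = (RtoC r * polar 1 t)%C.
Proof. apply injective_projections; simpl; ring. Qed.

Lemma polar_0 (t : R) : polar 0 t = 0%C.
Proof. apply injective_projections; simpl; ring. Qed.

Lemma polar_period (r : R) : polar r (2 * PI) = polar r 0.
Proof. unfold polar. now rewrite sin_2PI, cos_2PI, sin_0, cos_0. Qed.

Lemma polar_surj (z : C) : exists t, 0 <= t <= 2 * PI /\ z = polar (Cmod z) t.
Proof.
  destruct (Ceq_dec z 0%C) as [->|Hz].
  { exists 0. assert (H := PI_RGT_0). rewrite Cmod_0, polar_0. split; [lra|reflexivity]. }
  assert (Hm := proj1 (Cmod_gt_0 _) Hz).
  destruct z as [x y]. set (m := Cmod (x, y)) in *.
  assert (Hq : m * m = x * x + y * y).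
  { unfold m, Cmod. rewrite sqrt_sqrt; simpl; [ring|nra]. }
  assert (Hx : -1 <= x / m <= 1).
  { split; apply Rmult_le_reg_r with m; try exact Hm;
      unfold Rdiv; rewrite Rmult_assoc, Rinv_l by lra; nra. }
  assert (Hs : sqrt (1 - (x / m)²) = Rabs (y / m)).
  { rewrite <- sqrt_Rsqr_abs. f_equal. unfold Rsqr. field_simplify; [|lra|lra].
    f_equal. rewrite <- ?Rsqr_pow2. unfold Rsqr. nra. }
  assert (Hmx : m * (x / m) = x) by (field; lra).
  assert (Hmy : m * (y / m) = y) by (field; lra).
  destruct (Rle_dec 0 y) as [Hy|Hy].
  - exists (acos (x / m)). split; [assert (H := acos_bound (x / m)); lra|]. unfold polar. rewrite cos_acos, sin_acos by exact Hx.
    rewrite Hs, Rabs_pos_eq by (apply Rdiv_le_0_compat; lra).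
    now rewrite Hmx, Hmy.
  - exists (- acos (x / m) + 2 * PI). split; [assert (H := acos_bound (x / m)); lra|].
    unfold polar. replace 2 with (2 * INR 1) by (simpl; ring).
    rewrite cos_period, sin_period, cos_neg, sin_neg, cos_acos, sin_acos by exact Hx.
    rewrite Hs, Rabs_left by (apply Rmult_lt_reg_r with m; [exact Hm|];
      unfold Rdiv; rewrite Rmult_assoc, Rinv_l by lra; lra).
    rewrite Ropp_involutive, Hmx. now rewrite Hmy.
Qed.

Notation RR := (prod_UniformSpace R_UniformSpace R_UniformSpace).

Lemma cts_polar {T : UniformSpace} (r t : T -> R) x :
  rcts r x -> rcts t x -> cts (fun y => polar (r y) (t y)) x.
Proof.
  intros Hr Ht. apply cts_pair; apply rcts_mult; try assumption; apply rcts_comp;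
    try assumption; [apply continuity_cos | apply continuity_sin].
Qed.

Lemma rcts_fst (p : RR) : rcts (T := RR) fst p.
Proof. apply continuous_fst. Qed.
Lemma rcts_snd (p : RR) : rcts (T := RR) snd p.
Proof. apply continuous_snd. Qed.

Lemma rcts_2d (u : R -> R -> R) (r t : R) :
  rcts (T := RR) (fun p => u (fst p) (snd p)) (r, t) <-> continuity_2d_pt u r t.
Proof. symmetry. apply continuity_2d_pt_filterlim. Qed.

Lemma rcts_slice (u : R -> R -> R) (r t : R) :
  rcts (T := RR) (fun p => u (fst p) (snd p)) (r, t) ->
  rcts (T := R_UniformSpace) (u r) t.
Proof.
  intros H.
  apply (continuous_comp (fun t => (r, t) : RR) (fun p : RR => u (fst p) (snd p)) t); [|exact H].
  apply (cts_pair (T := R_UniformSpace)); [apply continuous_const | apply continuous_id].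
Qed.

Lemma ex_RInt_rcts (u : R -> R) (a b : R) :
  (forall t, rcts (T := R_UniformSpace) u t) -> ex_RInt u a b.
Proof. intros H. apply (@ex_RInt_continuous R_CompleteNormedModule). intros t _. apply H. Qed.

Lemma is_derive_circle_int (u du : R -> R -> R) (lo hi r : R) :
  lo < r < hi ->
  (forall s t, lo < s < hi -> is_derive (fun x => u x t) s (du s t)) ->
  (forall s t, lo < s < hi -> rcts (T := RR) (fun p => du (fst p) (snd p)) (s, t)) ->
  (forall s t, lo < s < hi -> rcts (T := R_UniformSpace) (u s) t) ->
  is_derive (fun x => RInt (u x) 0 (2 * PI)) r (RInt (du r) 0 (2 * PI)).
Proof.
  intros Hr Hd Hc Hu.
  assert (Hl : locally r (fun s => lo < s < hi)).
  { apply (open_and _ _ (open_gt lo) (open_lt hi)); exact Hr. }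
  rewrite <- (RInt_ext (fun t => Derive (fun x => u x t) r) (du r)).
  2:{ intros t _. apply is_derive_unique, Hd, Hr. }
  apply is_derive_RInt_param.
  - apply (filter_imp (fun s => lo < s < hi)); [|exact Hl].
    intros s Hs t _. exists (du s t). apply Hd, Hs.
  - intros t _. apply (continuity_2d_pt_ext_loc du).
    + destruct Hl as [d Hl]. exists d. intros s v Hs _. symmetry.
      apply is_derive_unique, Hd, Hl, Hs.
    + apply rcts_2d, Hc, Hr.
  - apply (filter_imp (fun s => lo < s < hi)); [|exact Hl].
    intros s Hs. apply ex_RInt_rcts. intros t. apply Hu, Hs.
Qed.

Lemma circle_int_close (u : R -> R -> R) (r eps : R) :
  0 < eps ->
  (forall t, rcts (T := RR) (fun p => u (fst p) (snd p)) (r, t)) ->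
  exists d, 0 < d /\ forall s, Rabs (s - r) < d ->
    (forall t, rcts (T := R_UniformSpace) (u s) t) ->
    Rabs (RInt (u s) 0 (2 * PI) - RInt (u r) 0 (2 * PI)) <= 2 * PI * eps.
Proof.
  intros He Hc.
  destruct (uniform_continuity_2d_1d' u 0 (2 * PI) r
    (fun t _ => proj1 (rcts_2d u r t) (Hc t)) (mkposreal _ He)) as [d Hd].
  exists d; split; [apply cond_pos|]. intros s Hs Hu.
  assert (Hr : forall t, rcts (T := R_UniformSpace) (u r) t) by (intros t; apply rcts_slice, Hc).
  assert (E : RInt (u s) 0 (2 * PI) - RInt (u r) 0 (2 * PI)
              = RInt (fun t => u s t - u r t) 0 (2 * PI)).
  { symmetry. apply (RInt_minus (V := R_CompleteNormedModule)); apply ex_RInt_rcts; assumption. }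
  rewrite E. assert (HPI := PI_RGT_0).
  replace (2 * PI * eps) with ((2 * PI - 0) * eps) by ring.
  apply abs_RInt_le_const; [lra| |].
  - apply ex_RInt_rcts. intros t. apply (rcts_minus (T := R_UniformSpace)); auto.
  - intros t Ht. apply Rabs_def2 in Hs. assert (Hdp := cond_pos d). left.
    apply Hd; try lra. rewrite Rminus_diag, Rabs_R0. exact Hdp.
Qed.

Lemma polar_derive_r (r t : R) :
  is_derive (fun x => Re (polar x t)) r (Re (polar 1 t)) /\
  is_derive (fun x => Im (polar x t)) r (Im (polar 1 t)).
Proof. split; unfold polar, Re, Im; simpl; auto_derive; trivial. Qed.

Lemma polar_derive_t (r t : R) :
  is_derive (fun x => Re (polar r x)) t (Re (Ci * polar r t)%C) /\
  is_derive (fun x => Im (polar r x)) t (Im (Ci * polar r t)%C).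
Proof. split; unfold polar, Re, Im; simpl; auto_derive; trivial; ring. Qed.

(** In polar coordinates the Cauchy-Riemann equations read
    [r * d/dr Re G = d/dt Im G].  Integrating over a period of [t] shows that the
    circular means of [Re G] do not depend on the radius; continuity carries this
    to the centre and to the bounding circle.  The punctured disk in the hypothesis
    makes this a removable singularity theorem as well, which serves for difference
    quotients. *)
Lemma mean_value (G G' : C -> C) (R : R) :
  0 < R -> (forall z, Cmod z <= R -> cts (T := C_UniformSpace) G z) ->
  holo (fun z => 0 < Cmod z < R) G G' ->
  RInt (fun t => Re (G (polar R t))) 0 (2 * PI) = 2 * PI * Re (G 0%C).
Proof.
  intros HR HG Hh. assert (HPI := PI_RGT_0).
  set (u := fun r t => Re (G (polar r t))).
  set (I := fun r => RInt (u r) 0 (2 * PI)).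
  change (I R = 2 * PI * Re (G 0%C)).
  assert (Hm : forall r t, 0 <= r -> Cmod (polar r t) = r).
  { intros r t Hr. rewrite Cmod_polar. now apply Rabs_pos_eq. }
  assert (Cu : forall r t, 0 <= r <= R -> rcts (T := RR) (fun p => u (fst p) (snd p)) (r, t)).
  { intros r t Hr. unfold u. apply (rcts_Re (T := RR)), (cts_comp (T := RR) G).
    - apply HG. simpl. rewrite Hm; lra.
    - apply (cts_polar (T := RR)); [apply rcts_fst | apply rcts_snd]. }
  assert (I0 : I 0 = 2 * PI * Re (G 0%C)).
  { unfold I, u. rewrite (RInt_ext _ (fun _ => Re (G 0%C))).
    - rewrite RInt_const. simpl. unfold scal; simpl; unfold mult; simpl. ring.
    - intros t _. now rewrite polar_0. }
  assert (DI : forall r, 0 < r < R -> is_derive I r 0).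
  { intros r Hr.
    set (du := fun r t => Re (G' (polar r t) * polar 1 t)%C).
    assert (Cdu : forall s t, 0 < s < R -> rcts (T := RR) (fun p => du (fst p) (snd p)) (s, t)).
    { intros s t Hs. unfold du. apply (rcts_Re (T := RR)), (cts_mult (T := RR)).
      - apply (cts_comp (T := RR) G').
        + apply Hh. simpl. rewrite Hm; lra.
        + apply (cts_polar (T := RR)); [apply rcts_fst | apply rcts_snd].
      - apply (cts_polar (T := RR)); [apply continuous_const | apply rcts_snd]. }
    assert (E : RInt (du r) 0 (2 * PI) = 0).
    { assert (F : is_RInt (du r) 0 (2 * PI)
        (minus (Im (G (polar r (2 * PI))) / r) (Im (G (polar r 0)) / r))).
      { apply (is_RInt_derive (V := R_CompleteNormedModule) (fun t => Im (G (polar r t)) / r)).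
        - intros t _. assert (Hz : 0 < Cmod (polar r t) < R) by (rewrite Hm; lra).
          destruct (polar_derive_t r t) as [D1 D2].
          destruct (cderiv_along G (polar r) t _ _ (proj1 (Hh _ Hz)) D1 D2) as [_ D].
          replace (du r t) with (/ r * Im (G' (polar r t) * (Ci * polar r t))%C).
          + apply (is_derive_ext (fun x => / r * Im (G (polar r x)))).
            { intros x. apply Rmult_comm. }
            apply (is_derive_scal (fun x => Im (G (polar r x)))). exact D.
          + unfold du, polar, Re, Im. simpl. field. lra.
        - intros t _. apply (rcts_slice du), Cdu, Hr. }
      apply (is_RInt_unique (V := R_CompleteNormedModule)) in F. rewrite F, polar_period.
      apply (minus_eq_zero (G := R_AbelianGroup)). }
    rewrite <- E. apply (is_derive_circle_int u du 0 R r Hr).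
    - intros s t Hs. assert (Hz : 0 < Cmod (polar s t) < R) by (rewrite Hm; lra).
      destruct (polar_derive_r s t) as [D1 D2].
      exact (proj1 (cderiv_along G (fun x => polar x t) s _ _ (proj1 (Hh _ Hz)) D1 D2)).
    - exact Cdu.
    - intros s t Hs. apply rcts_slice, Cu. lra. }
  assert (HI : forall a b, 0 < a -> a < b -> b < R -> I a = I b).
  { intros a b Ha Hab Hb. apply (eq_is_derive (V := R_NormedModule) I); [|exact Hab].
    intros t Ht. apply DI. lra. }
  rewrite <- I0. apply cond_eq. intros eps He.
  assert (He' : 0 < eps / (8 * PI)) by (apply Rdiv_lt_0_compat; lra).
  destruct (circle_int_close u R _ He') as [d1 [Hd1 H1]]; [intros; apply Cu; lra|].
  destruct (circle_int_close u 0 _ He') as [d2 [Hd2 H2]]; [intros; apply Cu; lra|].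
  set (s := Rmin (d2 / 2) (R / 4)). set (w := Rmax (R - d1 / 2) (R / 2)).
  assert (Hs1 := Rmin_l (d2 / 2) (R / 4)). assert (Hs2 := Rmin_r (d2 / 2) (R / 4)).
  assert (Hs3 : 0 < s) by (apply Rmin_pos; lra). fold s in Hs1, Hs2.
  assert (Hw1 := Rmax_l (R - d1 / 2) (R / 2)). assert (Hw2 := Rmax_r (R - d1 / 2) (R / 2)).
  assert (Hw3 : w < R) by (apply Rmax_lub_lt; lra). fold w in Hw1, Hw2.
  assert (K1 : Rabs (I w - I R) <= 2 * PI * (eps / (8 * PI))).
  { apply H1; [apply Rabs_def1; lra|]. intros t. apply rcts_slice, Cu. lra. }
  assert (K2 : Rabs (I s - I 0) <= 2 * PI * (eps / (8 * PI))).
  { apply H2; [apply Rabs_def1; lra|]. intros t. apply rcts_slice, Cu. lra. }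
  rewrite (HI s w) in K2 by lra.
  replace (2 * PI * (eps / (8 * PI))) with (eps / 4) in K1, K2 by (field; lra).
  replace (I R - I 0) with (- (I w - I R) + (I w - I 0)) by ring.
  eapply Rle_lt_trans; [apply Rabs_triang|]. rewrite Rabs_Ropp. lra.
Qed.

Lemma Re_le_Cmod (z : C) : Re z <= Cmod z.
Proof. eapply Rle_trans; [apply Rle_abs | apply re_le_Cmod]. Qed.

Lemma max_modulus_centre (G G' : C -> C) (R M : R) :
  0 < R -> (forall z, Cmod z <= R -> cts (T := C_UniformSpace) G z) ->
  holo (fun z => 0 < Cmod z < R) G G' ->
  (forall z, Cmod z = R -> Cmod (G z) <= M) -> Cmod (G 0%C) <= M.
Proof.
  intros HR HG Hh HM. assert (HPI := PI_RGT_0).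
  destruct (Ceq_dec (G 0%C) 0%C) as [E|Hn].
  { rewrite E, Cmod_0. eapply Rle_trans; [apply Cmod_ge_0|].
    apply (HM (RtoC R)). rewrite Cmod_R. apply Rabs_pos_eq; lra. }
  (* A rotation makes the value at the centre real and positive. *)
  set (c := (Cconj (G 0%C) / RtoC (Cmod (G 0%C)))%C).
  assert (Hp := proj1 (Cmod_gt_0 _) Hn).
  assert (Hc0 : RtoC (Cmod (G 0%C)) <> 0%C) by (intros E; apply RtoC_inj in E; lra).
  assert (Hc : Cmod c = 1).
  { unfold c. rewrite Cmod_div by exact Hc0. rewrite Cmod_conj, Cmod_R, Rabs_pos_eq by lra.
    field. lra. }
  assert (HcG : (c * G 0%C)%C = RtoC (Cmod (G 0%C))).
  { unfold c. replace (Cconj (G 0%C) / RtoC (Cmod (G 0%C)) * G 0%C)%C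
      with (G 0%C * Cconj (G 0%C) / RtoC (Cmod (G 0%C)))%C by (field; exact Hc0).
    rewrite <- Cmod2_conj. rewrite RtoC_pow. simpl. field. exact Hc0. }
  assert (HcC : forall z, Cmod z <= R -> cts (T := C_UniformSpace) (fun z => (c * G z)%C) z).
  { intros z Hz. apply (cts_mult (T := C_UniformSpace)); [apply cts_const|auto]. }
  assert (H := mean_value _ _ R HR HcC (holo_scal _ c _ _ Hh)).
  cbv beta in H. rewrite HcG in H. change (Re (RtoC (Cmod (G 0%C)))) with (Cmod (G 0%C)) in H.
  assert (Hle : RInt (fun t => Re (c * G (polar R t))%C) 0 (2 * PI) <= RInt (fun _ => M) 0 (2 * PI)).
  { apply RInt_le; [lra| | |].
    - apply ex_RInt_rcts. intros t. apply (rcts_Re (T := R_UniformSpace)).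
      apply (cts_comp (T := R_UniformSpace) (fun z => (c * G z)%C)).
      + apply HcC. rewrite Cmod_polar, Rabs_pos_eq; lra.
      + apply (cts_polar (T := R_UniformSpace)); [apply continuous_const | apply continuous_id].
    - apply ex_RInt_const.
    - intros t _. eapply Rle_trans; [apply Re_le_Cmod|].
      rewrite Cmod_mult, Hc, Rmult_1_l. apply HM. rewrite Cmod_polar, Rabs_pos_eq; lra. }
  rewrite H, RInt_const in Hle.
  change (scal (2 * PI - 0) M) with ((2 * PI - 0) * M) in Hle. apply Rmult_le_reg_l with (2 * PI); lra.
Qed.

Lemma C_two : RtoC 2 = (1 + 1)%C.
Proof. rewrite <- RtoC_plus. f_equal; ring. Qed.

Lemma Cmod_sqr (z : C) : Cmod z * Cmod z = Re z * Re z + Im z * Im z.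
Proof. assert (H := Cmod2_alt z). simpl in H. lra. Qed.

(** The map [z -> (z + b) / (1 + Cconj b * z)] preserves the unit disk and its boundary. *)
Lemma moebius_identity (b z : C) :
  Cmod (1 + Cconj b * z) * Cmod (1 + Cconj b * z) - Cmod (z + b) * Cmod (z + b)
  = (1 - Cmod z * Cmod z) * (1 - Cmod b * Cmod b).
Proof. rewrite !Cmod_sqr. destruct b, z; unfold Re, Im; simpl. ring. Qed.

Lemma moebius_denominator (b z : C) :
  Cmod b < 1 -> Cmod z <= 1 -> (1 + Cconj b * z)%C <> 0%C.
Proof.
  intros Hb Hz E.
  assert (H : Cmod (- (Cconj b * z)) = Cmod b * Cmod z)
    by now rewrite Cmod_opp, Cmod_mult, Cmod_conj.
  replace (- (Cconj b * z))%C with (1 - (1 + Cconj b * z))%C in H by ring.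
  rewrite E in H. replace (1 - 0)%C with (RtoC 1) in H by ring. rewrite Cmod_1 in H.
  assert (H1 := Cmod_ge_0 b). assert (H2 := Cmod_ge_0 z). nra.
Qed.

(** The maximum principle at an arbitrary point [a] of the disk: a Moebius
    automorphism moves [a] to the centre. *)
Lemma max_modulus (F F' : C -> C) (rho M : R) (a : C) :
  0 < rho -> Cmod a < rho ->
  (forall z, Cmod z <= rho -> cts (T := C_UniformSpace) F z) ->
  holo (fun z => Cmod z < rho) F F' ->
  (forall z, Cmod z = rho -> Cmod (F z) <= M) -> Cmod (F a) <= M.
Proof.
  intros Hr Ha HF Hh HM.
  assert (Hr0 : RtoC rho <> 0%C) by (intros E; apply RtoC_inj in E; lra).
  set (b := (a / RtoC rho)%C).
  assert (Hb : Cmod b < 1).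
  { unfold b. rewrite Cmod_div by exact Hr0. rewrite Cmod_R, Rabs_pos_eq by lra.
    apply Rmult_lt_reg_r with rho; [exact Hr|].
    unfold Rdiv. rewrite Rmult_assoc, Rinv_l; lra. }
  set (phi := fun z => (RtoC rho * ((z + b) / (1 + Cconj b * z)))%C).
  assert (Hphi : forall z, Cmod z <= 1 ->
    Cmod (phi z) = rho * (Cmod (z + b) / Cmod (1 + Cconj b * z)) /\
    0 < Cmod (1 + Cconj b * z)).
  { intros z Hz. assert (Hn := moebius_denominator b z Hb Hz).
    split; [|apply Cmod_gt_0; exact Hn]. unfold phi.
    rewrite Cmod_mult, Cmod_div, Cmod_R, Rabs_pos_eq by (exact Hn || lra). reflexivity. }
  assert (Hlt : forall z, Cmod z < 1 -> Cmod (phi z) < rho).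
  { intros z Hz. destruct (Hphi z (Rlt_le _ _ Hz)) as [-> Hp].
    assert (Hi := moebius_identity b z).
    assert (H1 := Cmod_ge_0 b). assert (H2 := Cmod_ge_0 z). assert (H3 := Cmod_ge_0 (z + b)).
    assert (Cmod (z + b) / Cmod (1 + Cconj b * z) < 1); [|nra].
    apply Rmult_lt_reg_r with (Cmod (1 + Cconj b * z)); [exact Hp|].
    unfold Rdiv. rewrite Rmult_assoc, Rinv_l by lra.
    assert (0 < (1 - Cmod z * Cmod z) * (1 - Cmod b * Cmod b)) by (apply Rmult_lt_0_compat; nra).
    nra. }
  assert (Heq : forall z, Cmod z = 1 -> Cmod (phi z) = rho).
  { intros z Hz. destruct (Hphi z (Req_le _ _ Hz)) as [-> Hp].
    assert (Hi := moebius_identity b z). rewrite Hz in Hi.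
    assert (H3 := Cmod_ge_0 (z + b)).
    replace (Cmod (z + b)) with (Cmod (1 + Cconj b * z)) by nra. field. lra. }
  set (U := fun z => Cmod z <= 1).
  assert (H1 : holo U (fun z => (1 + Cconj b * z)%C) (fun _ => (0 + Cconj b * 1)%C)).
  { apply holo_plus; [apply holo_const | apply holo_scal, holo_id]. }
  assert (H2 : holo U (fun z => (z + b)%C) (fun _ => (1 + 0)%C)).
  { apply holo_plus; [apply holo_id | apply holo_const]. }
  assert (H3 := holo_scal U (RtoC rho) _ _
    (holo_div U _ _ _ _ H2 H1 (fun z Hz => moebius_denominator b z Hb Hz))).
  assert (E : a = phi 0%C).
  { unfold phi, b. replace (1 + Cconj (a / rho) * 0)%C with (RtoC 1) by ring.
    field. exact Hr0. }
  rewrite E.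
  assert (HU1 : forall z, 0 < Cmod z < 1 -> U z) by (intros z Hz; unfold U; lra).
  assert (HU2 : forall z, 0 < Cmod z < 1 -> Cmod (phi z) < rho) by (intros z Hz; apply Hlt; lra).
  assert (H4 := holo_comp _ _ F F' phi _ Hh (holo_mono _ _ _ _ HU1 H3) HU2).
  apply (max_modulus_centre (fun z => F (phi z)) _ 1 M) with (3 := H4).
  - lra.
  - intros z Hz. apply (cts_comp (T := C_UniformSpace) F phi).
    + apply HF. destruct (Rle_lt_or_eq_dec _ _ Hz) as [L|L].
      * left; apply Hlt, L.
      * right; apply Heq, L.
    + apply (holo_cts U _ _ z H3 Hz).
  - intros z Hz. apply HM, Heq, Hz.
Qed.

Lemma disk_0 : disk 0%C.
Proof. unfold disk. rewrite Cmod_0. lra. Qed.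

(** Schwarz's lemma.  The hypothesis gives [|G| <= 1 / rho] on [|z| = rho], and [rho]
    may be taken arbitrarily close to 1. *)
Lemma schwarz_quotient (G G' : C -> C) :
  holo disk G G' -> (forall z, disk z -> Cmod (z * G z) <= 1) ->
  forall z, disk z -> Cmod (G z) <= 1.
Proof.
  intros HG HM a Ha. destruct (Rle_dec (Cmod (G a)) 1) as [L|L]; [exact L|exfalso].
  assert (Hi : / Cmod (G a) < 1).
  { rewrite <- Rinv_1. apply Rinv_lt_contravar; lra. }
  assert (Hip : 0 < / Cmod (G a)) by (apply Rinv_0_lt_compat; lra).
  set (rho := (Rmax (Cmod a) (/ Cmod (G a)) + 1) / 2).
  assert (H1 := Rmax_l (Cmod a) (/ Cmod (G a))). assert (H2 := Rmax_r (Cmod a) (/ Cmod (G a))).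
  assert (H3 : Rmax (Cmod a) (/ Cmod (G a)) < 1) by (apply Rmax_lub_lt; assumption).
  assert (Hr1 : Cmod a < rho) by (unfold rho; unfold disk in Ha; lra).
  assert (Hr2 : / Cmod (G a) < rho) by (unfold rho; lra).
  assert (Hr3 : rho < 1) by (unfold rho; lra).
  assert (H : Cmod (G a) <= / rho).
  { apply (max_modulus G G' rho); try assumption; try lra.
    - intros z Hz. apply (holo_cts disk G G'); [exact HG|]. unfold disk. lra.
    - intros z Hz. apply HG. unfold disk. lra.
    - intros z Hz. apply Rmult_le_reg_l with rho; [lra|]. rewrite Rinv_r by lra.
      rewrite <- Hz, <- Cmod_mult. apply HM. unfold disk. lra. }
  assert (/ rho < Cmod (G a)); [|lra].
  rewrite <- (Rinv_inv (Cmod (G a))). apply Rinv_lt_contravar; [|exact Hr2]. nra.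
Qed.

(** The minimum principle, by applying the maximum principle to [1 / F]. *)
Lemma min_modulus_zero (F F' : C -> C) (rho m : R) (a : C) :
  0 < rho -> Cmod a < rho ->
  (forall z, Cmod z <= rho -> cts (T := C_UniformSpace) F z) ->
  holo (fun z => Cmod z < rho) F F' ->
  (forall z, Cmod z = rho -> m <= Cmod (F z)) -> Cmod (F a) < m ->
  exists z, Cmod z < rho /\ F z = 0%C.
Proof.
  intros Hr Ha HF Hh Hm Hlt. apply NNPP. intros Hno.
  assert (Hm0 : 0 < m) by (eapply Rle_lt_trans; [apply Cmod_ge_0 | exact Hlt]).
  assert (Hn : forall z, Cmod z <= rho -> F z <> 0%C).
  { intros z Hz E. destruct (Rle_lt_or_eq_dec _ _ Hz) as [L|L].
    - apply Hno. exists z. split; assumption.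
    - specialize (Hm z L). rewrite E, Cmod_0 in Hm. lra. }
  assert (H : Cmod (/ F a) <= / m).
  { apply (max_modulus (fun z => (/ F z)%C) (fun w => (- / (F w * F w) * F' w)%C) rho); try assumption.
    - intros z Hz. apply (cts_inv (T := C_UniformSpace)); auto.
    - apply holo_inv; [exact Hh|]. intros z Hz. apply Hn. lra.
    - intros z Hz. rewrite Cmod_inv by (apply Hn; lra).
      apply Rinv_le_contravar; auto. }
  assert (Hp : 0 < Cmod (F a)) by (apply Cmod_gt_0, Hn; lra).
  rewrite Cmod_inv in H by (apply Cmod_gt_0; exact Hp).
  assert (/ m < / Cmod (F a)); [|lra]. apply Rinv_lt_contravar; nra.
Qed.

(** * Univalent functions *)

(** Near each point [(x, y)] one has [u >= u x y / 2], and the rectangle is compact. *)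
Lemma positive_lower_bound (u : R -> R -> R) (a b c d : R) :
  (forall x y, a <= x <= b -> c <= y <= d ->
     rcts (T := RR) (fun p => u (fst p) (snd p)) (x, y) /\ 0 < u x y) ->
  exists m, 0 < m /\ forall x y, a <= x <= b -> c <= y <= d -> m <= u x y.
Proof.
  intros H.
  assert (Hd : forall x y, exists e : posreal, a <= x <= b -> c <= y <= d ->
    forall v w, Rabs (v - x) < e -> Rabs (w - y) < e -> e <= u v w).
  { intros x y. destruct (classic (a <= x <= b /\ c <= y <= d)) as [[Hx Hy]|N].
    2:{ exists (mkposreal _ Rlt_0_1). intros Hx Hy. now destruct N. }
    destruct (H x y Hx Hy) as [Hc Hp]. apply rcts_2d in Hc.
    assert (Hp2 : 0 < u x y / 2) by lra.
    destruct (Hc (mkposreal _ Hp2)) as [e He].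
    exists (mkposreal _ (Rmin_pos _ _ (cond_pos e) Hp2)). intros _ _ v w Hv Hw. simpl in *.
    assert (L := He v w (Rlt_le_trans _ _ _ Hv (Rmin_l _ _)) (Rlt_le_trans _ _ _ Hw (Rmin_l _ _))).
    apply Rabs_def2 in L. assert (H2 := Rmin_r e (u x y / 2)). lra. }
  set (delta := fun x y => proj1_sig (constructive_indefinite_description _ (Hd x y))).
  destruct (compactness_value_2d a b c d delta) as [m Hm].
  exists m. split; [apply cond_pos|]. intros x y Hx Hy.
  destruct (Rle_dec m (u x y)) as [L|L]; [exact L|exfalso].
  apply (Hm x y Hx Hy). intros [v [w [Hv [Hw [H1 [H2 H3]]]]]]. apply L.
  eapply Rle_trans; [exact H3|]. unfold delta in *.
  destruct (constructive_indefinite_description _ (Hd v w)) as [e He]. simpl in *.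
  apply He; assumption.
Qed.

Lemma disk_open (z : C) : disk z -> exists d, 0 < d /\ forall w, Cmod (w - z) < d -> disk w.
Proof.
  intros Hz. exists (1 - Cmod z). unfold disk in *. split; [lra|]. intros w Hw.
  replace w with (z + (w - z))%C by ring. eapply Rle_lt_trans; [apply Cmod_triangle|]. lra.
Qed.

Definition injective_disk (f : C -> C) : Prop :=
  forall z w, disk z -> disk w -> f z = f w -> z = w.

(** The symmetric difference quotient [(f (p + h) - f (p - h)) / (2 h)] of an
    injective [f] has no zero for [h <> 0], and tends to [f' p] at [0].  So the
    minimum principle bounds [f' p] below, unless it is zero, by the minimum of
    the quotient over a circle. *)
Lemma univalent_derivative_gap (f f' : C -> C) (p : C) (e m : R) :
  holo disk f f' -> injective_disk f -> 0 < e -> 0 < m ->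
  (forall h, Cmod h <= e -> disk (p + h)) ->
  (forall h, Cmod h = e -> m <= Cmod (f (p + h) - f (p - h))%C / (2 * e)) ->
  f' p <> 0%C -> m <= Cmod (f' p).
Proof.
  intros Hf Hinj He Hm Hdisk Hmin Hp.
  assert (Hdisk' : forall h, Cmod h <= e -> disk (p - h)).
  { intros h Hh. apply (Hdisk (- h)%C). rewrite Cmod_opp. exact Hh. }
  assert (Dp : disk p).
  { replace p with (p + 0)%C by ring. apply Hdisk. rewrite Cmod_0. lra. }
  destruct (proj1 (Hf p Dp)) as [q [Cq [Eq Hq]]].
  assert (H2 : RtoC 2 <> 0%C) by (intros E; apply RtoC_inj in E; lra).
  (* [q] is a difference quotient of [f] at [p], continuous there; hence so is [Q] at 0 *)
  set (Q := fun h => ((q (p + h) + q (p - h)) / RtoC 2)%C).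
  assert (EQ : forall h : C, h <> 0%C -> Q h = ((f (p + h) - f (p - h)) / (RtoC 2 * h))%C).
  { intros h Hh. unfold Q. rewrite (Hq (p + h)%C), (Hq (p - h)%C).
    field; try split; assumption. }
  assert (Q0 : Q 0%C = f' p).
  { unfold Q. replace (p + 0)%C with p by ring. replace (p - 0)%C with p by ring.
    rewrite Eq. replace (f' p + f' p)%C with (RtoC 2 * f' p)%C; [field; exact H2|].
    rewrite C_two. ring. }
  assert (Hne : forall h, Cmod h <= e -> Q h <> 0%C).
  { intros h Hh. destruct (Ceq_dec h 0%C) as [->|Hh0]; [now rewrite Q0|].
    rewrite (EQ h Hh0). intros E.
    assert (E2 : (f (p + h) - f (p - h))%C = 0%C).
    { replace (f (p + h) - f (p - h))%C
        with ((f (p + h) - f (p - h)) / (RtoC 2 * h) * (RtoC 2 * h))%C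
        by (field; try split; assumption). rewrite E. ring. }
    assert (E3 : f (p + h)%C = f (p - h)%C).
    { replace (f (p + h)%C) with (f (p + h) - f (p - h) + f (p - h))%C by ring.
      rewrite E2. ring. }
    apply Hinj in E3; auto. apply Hh0.
    replace h with ((p + h - (p - h)) / RtoC 2)%C.
    - rewrite E3. unfold Cminus. rewrite Cplus_opp_r. unfold Cdiv. ring.
    - replace (p + h - (p - h))%C with (RtoC 2 * h)%C; [field; exact H2|].
      rewrite C_two. ring. }
  set (W := fun h => 0 < Cmod h < e).
  assert (HW : forall z, W z -> exists d, 0 < d /\ forall w, Cmod (w - z) < d -> W w).
  { intros z [Z1 Z2]. exists (Rmin (Cmod z) (e - Cmod z)).
    split; [apply Rmin_pos; lra|]. intros w Hw.
    assert (L1 := Rlt_le_trans _ _ _ Hw (Rmin_l _ _)).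
    assert (L2 := Rlt_le_trans _ _ _ Hw (Rmin_r _ _)).
    assert (T1 := Cmod_triangle z (w - z)). replace (z + (w - z))%C with w in T1 by ring.
    assert (T2 := Cmod_triangle w (- (w - z))). rewrite Cmod_opp in T2.
    replace (w + - (w - z))%C with z in T2 by ring. unfold W. lra. }
  set (V := fun h => 0 < Cmod h /\ Cmod h <= e).
  assert (Hv : forall h, V h -> h <> 0%C) by (intros h [Hh _]; apply Cmod_gt_0, Hh).
  assert (HQ : exists Q', holo V
      (fun h => ((f (p + h) - f (p - h)) / (RtoC 2 * h))%C) Q').
  { assert (A1 : holo V (fun h => (p + h)%C) (fun _ => (0 + 1)%C))
      by (apply holo_plus; [apply holo_const | apply holo_id]).
    assert (A2 : holo V (fun h => (p - h)%C) (fun _ => (0 - 1)%C))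
      by (apply holo_minus; [apply holo_const | apply holo_id]).
    assert (A3 := holo_comp V disk f f' _ _ Hf A1 (fun z Hz => Hdisk z (proj2 Hz))).
    assert (A4 := holo_comp V disk f f' _ _ Hf A2 (fun z Hz => Hdisk' z (proj2 Hz))).
    eexists. apply (holo_div V _ _ _ _ (holo_minus V _ _ _ _ A3 A4)
      (holo_scal V (RtoC 2) _ _ (holo_id V))).
    intros z Hz. apply Cmult_neq_0; [exact H2 | apply Hv, Hz]. }
  destruct HQ as [Q' HQ].
  assert (CQ : forall z, Cmod z <= e -> cts (T := C_UniformSpace) Q z).
  { intros z Hz. destruct (Ceq_dec z 0%C) as [->|Hz0].
    - unfold Q. apply (cts_div (T := C_UniformSpace)); [|apply cts_const|exact H2].
      apply (cts_plus (T := C_UniformSpace)).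
      + apply (cts_comp (T := C_UniformSpace) q (fun h => (p + h)%C)).
        * replace (p + 0)%C with p by ring. exact Cq.
        * apply (cts_plus (T := C_UniformSpace)); [apply cts_const | apply cts_id].
      + apply (cts_comp (T := C_UniformSpace) q (fun h => (p - h)%C)).
        * replace (p - 0)%C with p by ring. exact Cq.
        * apply (cts_minus (T := C_UniformSpace)); [apply cts_const | apply cts_id].
    - assert (Z1 := proj1 (Cmod_gt_0 _) Hz0).
      apply (cts_loc (T := C_UniformSpace) (fun h => ((f (p + h) - f (p - h)) / (RtoC 2 * h))%C)).
      + apply locally_Cmod with (1 := Z1). intros w Hb.
        symmetry. apply EQ. intros ->.
        replace (0 - z)%C with (- z)%C in Hb by ring. rewrite Cmod_opp in Hb. lra.
      + apply (holo_cts V _ _ z HQ). split; assumption. }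
  assert (HQW : holo W Q Q').
  { apply (holo_ext_on W (fun h => ((f (p + h) - f (p - h)) / (RtoC 2 * h))%C) Q'); try easy.
    - intros z [Z1 _]. symmetry. apply EQ. apply Cmod_gt_0, Z1.
    - apply (holo_mono V); [|exact HQ]. intros z [Z1 Z2]. split; lra. }
  assert (L : Cmod (/ Q 0%C) <= / m).
  { apply (max_modulus_centre (fun h => (/ Q h)%C) (fun h => (- / (Q h * Q h) * Q' h)%C) e); try assumption.
    - intros z Hz. apply (cts_inv (T := C_UniformSpace)); auto.
    - apply holo_inv; [exact HQW|]. intros z [_ Hz]. apply Hne. lra.
    - intros z Hz. rewrite Cmod_inv by (apply Hne; lra).
      apply Rinv_le_contravar; [exact Hm|].
      assert (Hz0 : z <> 0%C) by (apply Cmod_gt_0; lra).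
      rewrite EQ, Cmod_div, Cmod_mult, Cmod_R, Rabs_pos_eq, Hz by (lra || (try apply Cmult_neq_0; assumption)).
      apply Hmin, Hz. }
  rewrite Q0, Cmod_inv in L by exact Hp.
  assert (P := proj1 (Cmod_gt_0 _) Hp).
  apply Rinv_le_contravar in L; [|now apply Rinv_0_lt_compat].
  now rewrite !Rinv_inv in L.
Qed.

(** By the previous lemma [|f'|] omits an interval [(0, m)] along a segment from
    the centre, where [f'] is not zero. *)
Lemma univalent_derivative_neq_0 (f f' : C -> C) :
  holo disk f f' -> injective_disk f -> f' 0%C <> 0%C ->
  forall z, disk z -> f' z <> 0%C.
Proof.
  intros Hf Hinj H0 z Hz E. assert (HPI := PI_RGT_0).
  set (e := (1 - Cmod z) / 2). assert (He : 0 < e) by (unfold e, disk in *; lra).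
  assert (Hsz : forall s, 0 <= s <= 1 -> Cmod (RtoC s * z) <= Cmod z).
  { intros s Hs. rewrite Cmod_mult, Cmod_R, Rabs_pos_eq by lra.
    assert (H := Cmod_ge_0 z). nra. }
  assert (Hd : forall s h, 0 <= s <= 1 -> Cmod h <= e -> disk (RtoC s * z + h)).
  { intros s h Hs Hh. unfold disk, e in *. eapply Rle_lt_trans; [apply Cmod_triangle|].
    assert (H := Hsz s Hs). lra. }
  assert (Hd' : forall s h, 0 <= s <= 1 -> Cmod h <= e -> disk (RtoC s * z - h)).
  { intros s h Hs Hh. apply (Hd s (- h)%C Hs). rewrite Cmod_opp. exact Hh. }
  assert (Hpe : forall t, Cmod (polar e t) = e) by (intros t; rewrite Cmod_polar; apply Rabs_pos_eq; lra).
  destruct (positive_lower_bound (fun s t =>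
    Cmod (f (RtoC s * z + polar e t) - f (RtoC s * z - polar e t))%C * / (2 * e)) 0 1 0 (2 * PI))
    as [m [Hm Hmin]].
  { intros s t Hs Ht. split.
    - assert (C1 : cts (T := RR) (fun p => (RtoC (fst p) * z)%C) (s, t)).
      { apply (cts_mult (T := RR)); [|apply cts_const]. apply (cts_RtoC (T := RR)), rcts_fst. }
      assert (C2 : cts (T := RR) (fun p => polar e (snd p)) (s, t)).
      { apply (cts_polar (T := RR)); [apply continuous_const | apply rcts_snd]. }
      apply (rcts_mult (T := RR)); [|apply continuous_const].
      apply (rcts_Cmod (T := RR)), (cts_minus (T := RR)).
      + apply (cts_comp (T := RR) f); [|exact (cts_plus _ _ _ C1 C2)].
        apply (holo_cts disk f f'); [exact Hf|]. apply Hd; [exact Hs | rewrite Hpe; lra].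
      + apply (cts_comp (T := RR) f); [|exact (cts_minus _ _ _ C1 C2)].
        apply (holo_cts disk f f'); [exact Hf|]. apply Hd'; [exact Hs | rewrite Hpe; lra].
    - apply Rmult_lt_0_compat; [|apply Rinv_0_lt_compat; lra].
      apply Cmod_gt_0, Csub_neq. intros E2.
      apply Hinj in E2; [|apply Hd; [exact Hs | rewrite Hpe; lra] | apply Hd'; [exact Hs | rewrite Hpe; lra]].
      assert (E3 : (polar e t + polar e t)%C = 0%C).
      { replace (polar e t + polar e t)%C
          with (RtoC s * z + polar e t - (RtoC s * z - polar e t))%C by ring.
        rewrite E2. ring. }
      assert (E4 : Cmod (polar e t + polar e t)%C = 2 * e).
      { replace (polar e t + polar e t)%C with (RtoC 2 * polar e t)%C
          by (rewrite C_two; ring).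
        rewrite Cmod_mult, Hpe, Cmod_R, Rabs_pos_eq; lra. }
      rewrite E3, Cmod_0 in E4. lra. }
  assert (Gap : forall s, 0 <= s <= 1 -> f' (RtoC s * z)%C <> 0%C -> m <= Cmod (f' (RtoC s * z)%C)).
  { intros s Hs Hn. apply (univalent_derivative_gap f f' _ e m); auto.
    intros h Hh. destruct (polar_surj h) as [t [Ht Et]]. rewrite Hh in Et.
    rewrite Et. apply Hmin; assumption. }
  (* the value [m / 2] lies in the omitted interval *)
  destruct (IVT_interv (fun s => m / 2 - Cmod (f' (RtoC s * z)%C)) 0 1) as [s [Hs Es]].
  - intros s Hs. apply continuity_pt_filterlim.
    apply (rcts_minus (T := R_UniformSpace)); [apply continuous_const|].
    apply (rcts_Cmod (T := R_UniformSpace)), (cts_comp (T := R_UniformSpace) f').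
    + apply Hf. simpl. unfold disk in *. eapply Rle_lt_trans; [apply Hsz, Hs | exact Hz].
    + apply (cts_mult (T := R_UniformSpace)); [|apply cts_const].
      apply (cts_RtoC (T := R_UniformSpace)), continuous_id.
  - lra.
  - assert (H1 : m <= Cmod (f' (RtoC 0 * z)%C)).
    { apply Gap; [lra|]. rewrite Cmult_0_l. exact H0. }
    lra.
  - cbv beta. rewrite Cmult_1_l, E, Cmod_0. lra.
  - assert (H1 : f' (RtoC s * z)%C <> 0%C) by (apply Cmod_gt_0; lra).
    assert (H2 := Gap s Hs H1). lra.
Qed.

(** [f - w] is small at [p] when [w] is close to [f p], but bounded below on a circle
    around [p], so it has a zero inside. *)
Lemma univalent_open (f f' : C -> C) (p : C) (d : R) :
  holo disk f f' -> injective_disk f -> disk p -> 0 < d ->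
  exists e, 0 < e /\ forall w, Cmod (w - f p) < e ->
    exists z, disk z /\ Cmod (z - p) < d /\ f z = w.
Proof.
  intros Hf Hinj Hp Hd.
  set (r := Rmin (d / 2) ((1 - Cmod p) / 2)).
  assert (Hr1 := Rmin_l (d / 2) ((1 - Cmod p) / 2)).
  assert (Hr2 := Rmin_r (d / 2) ((1 - Cmod p) / 2)).
  assert (Hr : 0 < r) by (unfold disk in Hp; apply Rmin_pos; lra).
  fold r in Hr1, Hr2.
  assert (Hdisk : forall h, Cmod h <= r -> disk (p + h)).
  { intros h Hh. unfold disk in *. eapply Rle_lt_trans; [apply Cmod_triangle|]. lra. }
  assert (Hpe : forall t, Cmod (polar r t) = r) by (intros t; rewrite Cmod_polar; apply Rabs_pos_eq; lra).
  assert (CF : forall h, Cmod h <= r -> cts (T := C_UniformSpace) (fun h => f (p + h)%C) h).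
  { intros h Hh. apply (cts_comp (T := C_UniformSpace) f (fun h => (p + h)%C)).
    - apply (holo_cts disk f f'); [exact Hf | apply Hdisk, Hh].
    - apply (cts_plus (T := C_UniformSpace)); [apply cts_const | apply cts_id]. }
  destruct (positive_lower_bound (fun _ t => Cmod (f (p + polar r t) - f p)%C) 0 1 0 (2 * PI))
    as [m [Hm Hmin]].
  { intros s t _ _. split.
    - apply (rcts_Cmod (T := RR)), (cts_minus (T := RR)); [|apply cts_const].
      apply (cts_comp (T := RR) (fun h => f (p + h)%C) (fun q => polar r (snd q))).
      + apply CF. rewrite Hpe. lra.
      + apply (cts_polar (T := RR)); [apply continuous_const | apply rcts_snd].
    - apply Cmod_gt_0, Csub_neq. intros E. apply Hinj in E; [|apply Hdisk; rewrite Hpe; lra|exact Hp].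
      assert (E2 : polar r t = 0%C).
      { replace (polar r t) with (p + polar r t - p)%C by ring. rewrite E. ring. }
      specialize (Hpe t). rewrite E2, Cmod_0 in Hpe. lra. }
  exists (m / 2). split; [lra|]. intros w Hw.
  assert (A : holo (fun h => Cmod h < r) (fun h => (p + h)%C) (fun _ => (0 + 1)%C))
    by (apply holo_plus; [apply holo_const | apply holo_id]).
  assert (B := holo_comp _ disk f f' _ _ Hf A (fun h Hh => Hdisk h (Rlt_le _ _ Hh))).
  assert (D := holo_minus _ _ _ _ _ B (holo_const _ w)).
  assert (Z : exists h, Cmod h < r /\ (f (p + h) - w)%C = 0%C).
  { eapply (min_modulus_zero (fun h => (f (p + h) - w)%C) _ r (m / 2) 0%C Hr).
    - rewrite Cmod_0. exact Hr.
    - intros z Hz. apply (cts_minus (T := C_UniformSpace)); [apply CF, Hz | apply cts_const].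
    - exact D.
    - intros z Hz. destruct (polar_surj z) as [t [Ht Et]]. rewrite Hz in Et. rewrite Et.
      assert (L := Hmin 0 t (conj (Rle_refl 0) Rle_0_1) Ht).
      assert (T1 := Cmod_triangle (f (p + polar r t) - w)%C (w - f p)%C).
      replace (f (p + polar r t) - w + (w - f p))%C with (f (p + polar r t) - f p)%C in T1 by ring.
      lra.
    - rewrite Cplus_0_r. rewrite <- Cmod_opp.
      replace (- (f p - w))%C with (w - f p)%C by ring. exact Hw.
  }
  destruct Z as [h [Hh Eh]].
  exists (p + h)%C. split; [apply Hdisk; lra|]. split.
  - replace (p + h - p)%C with h by ring. lra.
  - replace (f (p + h)%C) with (f (p + h) - w + w)%C by ring. rewrite Eh. ring.
Qed.

(** A selection of preimages is continuous by the open mapping property, hence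
    differentiable, because [f'] has no zero. *)
Lemma univalent_lift_holo (f f' g g' k : C -> C) :
  holo disk f f' -> injective_disk f -> f' 0%C <> 0%C -> holo disk g g' ->
  (forall z, disk z -> disk (k z) /\ f (k z) = g z) ->
  holo disk k (fun z => (g' z / f' (k z))%C).
Proof.
  intros Hf Hinj H0 Hg Hk.
  assert (Ck : forall z, disk z -> cts (T := C_UniformSpace) k z).
  { intros z Hz. apply cts_eps. intros e He.
    destruct (Hk z Hz) as [Dk Ek].
    destruct (univalent_open f f' (k z) e Hf Hinj Dk He) as [d [Hd Ho]].
    destruct (proj1 (cts_eps _ _) (holo_cts _ _ _ _ Hg Hz) d Hd) as [d1 [Hd1 Hc]].
    destruct (disk_open z Hz) as [d2 [Hd2 Hdk]].
    exists (Rmin d1 d2). split; [now apply Rmin_pos|]. intros w Hw.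
    assert (L1 := Rlt_le_trans _ _ _ Hw (Rmin_l _ _)).
    assert (L2 := Rlt_le_trans _ _ _ Hw (Rmin_r _ _)).
    destruct (Hk w (Hdk w L2)) as [Dw Ew].
    destruct (Ho (g w)) as [v [Dv [Hv Ev]]].
    - rewrite Ek. apply Hc, L1.
    - replace (k w) with v; [exact Hv|]. apply Hinj; congruence. }
  assert (Hne := univalent_derivative_neq_0 f f' Hf Hinj H0).
  intros z Hz. destruct (Hk z Hz) as [Dk _]. split.
  - destruct (disk_open z Hz) as [d [Hd Hdk]].
    apply (cderiv_lift f g k z (g' z) (f' (k z)) d Hd); auto.
    + intros b Hb. apply Hk, Hdk, Hb.
    + apply Hf, Dk.
    + apply Hg, Hz.
  - apply (cts_div (T := C_UniformSpace)).
    + apply Hg, Hz.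
    + apply (cts_comp (T := C_UniformSpace) f' k); [apply Hf, Dk | apply Ck, Hz].
    + apply Hne, Dk.
Qed.

(** The disks [|z| <= r] have starlike images too: the lift [k] of [t f] through
    [f] satisfies [k z / z = t g z / g (k z)], and Schwarz's lemma applies. *)
Lemma starlike_subordination (f f' g g' : C -> C) :
  holo disk f f' -> holo disk g g' -> injective_disk f -> f' 0%C <> 0%C ->
  (forall z, disk z -> f z = (z * g z)%C) -> (forall z, disk z -> g z <> 0%C) ->
  starlike_at_0 (disk_image f) ->
  forall z t, disk z -> 0 <= t <= 1 ->
    exists w, disk w /\ Cmod w <= Cmod z /\ f w = (RtoC t * f z)%C.
Proof.
  intros Hf Hg Hinj H0 E Hn Hs z t Hz Ht.
  assert (Hk : forall z, exists w, disk z -> disk w /\ f w = (RtoC t * f z)%C).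
  { intros v. destruct (classic (disk v)) as [Hv|Hv]; [|now exists 0%C].
    destruct (Hs (f v) t) as [w Hw]; [exists v; now split | exact Ht |].
    exists w. intros _. exact Hw. }
  set (k := fun z => proj1_sig (constructive_indefinite_description _ (Hk z))).
  assert (Pk : forall z, disk z -> disk (k z) /\ f (k z) = (RtoC t * f z)%C).
  { intros v Hv. unfold k. destruct (constructive_indefinite_description _ _) as [w Hw].
    exact (Hw Hv). }
  assert (Hk' := univalent_lift_holo f f' _ _ k Hf Hinj H0 (holo_scal _ (RtoC t) _ _ Hf) Pk).
  assert (HG := holo_div disk _ _ _ _ (holo_scal _ (RtoC t) _ _ Hg)
    (holo_comp disk disk g g' k _ Hg Hk' (fun v Hv => proj1 (Pk v Hv)))
    (fun v Hv => Hn _ (proj1 (Pk v Hv)))).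
  assert (EG : forall v, disk v -> (v * (RtoC t * g v / g (k v)))%C = k v).
  { intros v Hv. destruct (Pk v Hv) as [Dk Ek]. rewrite (E _ Dk), (E _ Hv) in Ek.
    replace (v * (RtoC t * g v / g (k v)))%C with (RtoC t * (v * g v) / g (k v))%C
      by (field; apply Hn, Dk).
    rewrite <- Ek. field. apply Hn, Dk. }
  assert (B := schwarz_quotient _ _ HG). cbv beta in B.
  assert (B1 : Cmod (RtoC t * g z / g (k z)) <= 1).
  { apply B; [|exact Hz]. intros v Hv. rewrite (EG v Hv). left. apply (Pk v Hv). }
  exists (k z). destruct (Pk z Hz) as [Dk Ek]. split; [exact Dk|]. split; [|exact Ek].
  rewrite <- (EG z Hz), Cmod_mult. assert (H := Cmod_ge_0 z). nra.
Qed.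

(** Solve [f w = t f z] with [|w| <= |z|].  Then [Re (Cconj z * (w - z)) <= 0], while
    [f' z * (w - z)] is close to [(t - 1) * f z], where [t - 1 < 0]; let [t] tend to 1. *)
Lemma starlike_Re (f f' g g' : C -> C) :
  holo disk f f' -> holo disk g g' -> injective_disk f -> f' 0%C <> 0%C ->
  (forall z, disk z -> f z = (z * g z)%C) -> (forall z, disk z -> g z <> 0%C) ->
  starlike_at_0 (disk_image f) ->
  forall z, disk z -> 0 <= Re (f' z * z * Cconj (f z))%C.
Proof.
  intros Hf Hg Hinj H0 E Hn Hs z Hz.
  destruct (Rle_dec 0 (Re (f' z * z * Cconj (f z))%C)) as [L|L]; [exact L|exfalso].
  destruct (proj1 (Hf z Hz)) as [q [Cq [Eq Hq]]].
  assert (Cr : rcts (T := C_UniformSpace) (fun w => Re (q w * z * Cconj (f z))%C) z).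
  { apply (rcts_Re (T := C_UniformSpace)). apply (cts_mult (T := C_UniformSpace)); [|apply cts_const].
    apply (cts_mult (T := C_UniformSpace)); [exact Cq | apply cts_const]. }
  assert (Hneg : 0 < - Re (f' z * z * Cconj (f z))%C) by lra.
  destruct (proj1 (filterlim_locally _ _) Cr (mkposreal _ Hneg)) as [d Hd].
  destruct (univalent_open f f' z (d / 2) Hf Hinj Hz) as [e [He Ho]].
  { assert (H := cond_pos d). lra. }
  (* [t < 1] close enough to 1 for the preimage of [t f z] to be close to [z] *)
  set (c := Cmod (f z)). assert (Hc : 0 <= c) by apply Cmod_ge_0.
  set (t := 1 - Rmin 1 (e / (2 * (c + 1)))).
  assert (Hp : 0 < e / (2 * (c + 1))) by (apply Rdiv_lt_0_compat; lra).
  assert (M1 := Rmin_l 1 (e / (2 * (c + 1)))). assert (M2 := Rmin_r 1 (e / (2 * (c + 1)))).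
  assert (M3 : 0 < Rmin 1 (e / (2 * (c + 1)))) by (apply Rmin_pos; lra).
  assert (M4 : e / (2 * (c + 1)) * (c + 1) = e / 2) by (field; lra).
  destruct (starlike_subordination f f' g g' Hf Hg Hinj H0 E Hn Hs z t Hz) as [w [Dw [Lw Ew]]].
  { unfold t. lra. }
  destruct (Ho (RtoC t * f z)%C) as [v [Dv [Lv Ev]]].
  { replace (RtoC t * f z - f z)%C with (RtoC (t - 1) * f z)%C by (rewrite RtoC_minus; ring).
    rewrite Cmod_mult, Cmod_R. fold c. unfold t.
    rewrite Rabs_left1 by lra. nra. }
  assert (v = w) by (apply Hinj; congruence). subst v.
  assert (Hb : ball (M := C_UniformSpace) z d w).
  { apply C_NormedModule_mixin_compat1. change (minus w z) with (w - z)%C.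
    assert (H := cond_pos d). lra. }
  assert (B : Rabs (Re (q w * z * Cconj (f z))%C - Re (q z * z * Cconj (f z))%C)
              < - Re (f' z * z * Cconj (f z))%C) by exact (Hd w Hb).
  rewrite Eq in B. apply Rabs_def2 in B.
  assert (Q : (q w * (w - z))%C = (RtoC (t - 1) * f z)%C).
  { assert (H := Hq w). rewrite Ew in H.
    replace (q w * (w - z))%C with (f z + q w * (w - z) - f z)%C by ring.
    rewrite <- H, RtoC_minus. ring. }
  assert (S : (t - 1) * Re (q w * z * Cconj (f z))%C
              = Cmod (q w) * Cmod (q w) * Re (Cconj z * (w - z))%C).
  { rewrite Cmod_sqr. transitivity (Re (q w * z * Cconj (RtoC (t - 1) * f z))%C).
    - destruct (q w), z, (f (r1, r2)); unfold Re, Im; simpl; ring.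
    - rewrite <- Q. destruct (q w), z, w; unfold Re, Im; simpl; ring. }
  assert (T1 : 2 * Re (Cconj z * (w - z))%C
     = Cmod w * Cmod w - Cmod z * Cmod z - Cmod (w - z) * Cmod (w - z)).
  { rewrite !Cmod_sqr. destruct z, w; unfold Re, Im; simpl; ring. }
  assert (T2 : Cmod w * Cmod w <= Cmod z * Cmod z).
  { assert (H := Cmod_ge_0 w). nra. }
  assert (T3 : Re (Cconj z * (w - z))%C <= 0).
  { assert (H := Cmod_ge_0 (w - z)). nra. }
  assert (T4 : 0 <= Cmod (q w) * Cmod (q w)).
  { assert (H := Cmod_ge_0 (q w)). nra. }
  assert (t - 1 < 0) by (unfold t; lra). nra.
Qed.

(** * Complex power series on the unit disk *)

(** The radius of convergence is at least 1.  Stated as Cauchy's estimates, this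
    passes at once to shifted and differentiated series. *)
Definition radius_one (a : nat -> C) : Prop :=
  forall r, 0 < r < 1 -> exists M, forall n, Cmod (a n) * r ^ n <= M.

Notation csum a z l := (@is_pseries C_AbsRing C_NormedModule a z l).

Lemma csum_iff (a : nat -> C) (z l : C) :
  csum a z l <-> @is_series C_AbsRing C_NormedModule (fun n => (a n * z ^ n)%C) l.
Proof.
  assert (E : forall n, scal (pow_n (z : C_AbsRing) n) (a n : C_NormedModule) = (a n * z ^ n)%C).
  { intros n. change (Cmult (pow_n (z : C_AbsRing) n) (a n) = (a n * z ^ n)%C).
    rewrite Cmult_comm. reflexivity. }
  split; apply is_series_ext; intros n; rewrite E; reflexivity.
Qed.

Lemma is_series_Cmod_le (e : nat -> C) (b : nat -> R) (l : C) (B : R) :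
  @is_series C_AbsRing C_NormedModule e l -> is_series b B ->
  (forall n, Cmod (e n) <= b n) -> Cmod l <= B.
Proof.
  intros He Hb H.
  assert (L : is_lim_seq (fun n => Cmod (sum_n (G := C_NormedModule) e n)) (Cmod l)).
  { assert (N := filterlim_norm (V := C_NormedModule) l).
    exact (filterlim_comp _ _ _ _ _ _ _ _ He N). }
  assert (L2 : is_lim_seq (sum_n b) B) by exact Hb.
  apply (is_lim_seq_le _ _ (Cmod l) B) with (2 := L) (3 := L2).
  intros n. induction n as [|n IH].
  - rewrite !sum_O. apply H.
  - rewrite !sum_Sn. eapply Rle_trans; [apply Cmod_triangle|].
    apply Rplus_le_compat; [exact IH | apply H].
Qed.

Lemma eventually_bounded (u : nat -> R) (N : nat) (K : R) :
  (forall n, (N <= n)%nat -> u n <= K) -> exists M, forall n, u n <= M.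
Proof.
  revert K. induction N as [|N IH]; intros K H.
  - exists K. intros n. apply H. lia.
  - apply (IH (Rmax K (u N))). intros n Hn.
    destruct (Nat.eq_dec n N) as [->|Hne]; [apply Rmax_r|].
    eapply Rle_trans; [apply H; lia | apply Rmax_l].
Qed.

Lemma csum_radius (a : nat -> C) :
  (forall z, disk z -> exists l, csum a z l) -> radius_one a.
Proof.
  intros H r Hr.
  destruct (H (RtoC r)) as [l Hl].
  { unfold disk. rewrite Cmod_R, Rabs_pos_eq; lra. }
  apply csum_iff in Hl.
  assert (Hc := Cauchy_ex_series (V := C_CompleteNormedModule) _ (ex_intro _ l Hl)).
  destruct (Hc (mkposreal _ Rlt_0_1)) as [N HN].
  apply (eventually_bounded _ N 1). intros n Hn.
  specialize (HN n n Hn Hn). rewrite sum_n_n in HN.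
  assert (L : Cmod (a n * RtoC r ^ n) < 1) by exact HN.
  rewrite Cmod_mult, Cmod_pow, Cmod_R, Rabs_pos_eq in L by lra. lra.
Qed.

Lemma radius_one_ex_series (a : nat -> C) (r : R) :
  radius_one a -> 0 <= r < 1 -> ex_series (fun n => Cmod (a n) * r ^ n).
Proof.
  intros Ha Hr. set (s := (r + 1) / 2). assert (Hs : r < s < 1) by (unfold s; lra).
  destruct (Ha s) as [M HM]; [lra|].
  apply (ex_series_le (V := R_CompleteNormedModule) _ (fun n => M * (r / s) ^ n)).
  - intros n. assert (H1 := Cmod_ge_0 (a n)). assert (H2 := pow_le r n (proj1 Hr)).
    change (Rabs (Cmod (a n) * r ^ n) <= M * (r / s) ^ n).
    rewrite Rabs_pos_eq by nra.
    replace (r ^ n) with (s ^ n * (r / s) ^ n) by (rewrite <- Rpow_mult_distr; f_equal; field; lra).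
    rewrite <- Rmult_assoc. apply Rmult_le_compat_r; [|apply HM].
    apply pow_le, Rdiv_le_0_compat; lra.
  - apply (ex_series_scal_l (V := R_NormedModule) M), ex_series_geom.
    rewrite Rabs_pos_eq by (apply Rdiv_le_0_compat; lra).
    apply Rmult_lt_reg_r with s; [lra|]. unfold Rdiv. rewrite Rmult_assoc, Rinv_l; lra.
Qed.

Lemma radius_one_csum (a : nat -> C) (z : C) :
  radius_one a -> disk z -> exists l, csum a z l.
Proof.
  intros Ha Hz.
  destruct (ex_series_le (V := C_CompleteNormedModule) (fun n => (a n * z ^ n)%C)
    (fun n => Cmod (a n) * Cmod z ^ n)) as [l Hl].
  - intros n. rewrite <- Cmod_pow, <- Cmod_mult. apply Rle_refl.
  - apply radius_one_ex_series; [exact Ha|]. split; [apply Cmod_ge_0 | exact Hz].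
  - exists l. apply csum_iff. exact Hl.
Qed.

Lemma radius_one_sum (a : nat -> C) : radius_one a ->
  exists f : C -> C, forall z, disk z -> csum a z (f z).
Proof.
  intros Ha.
  assert (H : forall z, exists l, disk z -> csum a z l).
  { intros z. destruct (classic (disk z)) as [Hz|Hz]; [|now exists (RtoC 0)].
    destruct (radius_one_csum a z Ha Hz) as [l Hl]. exists l; auto. }
  exists (fun z => proj1_sig (constructive_indefinite_description _ (H z))).
  intros z Hz. destruct (constructive_indefinite_description _ (H z)) as [l Hl]. exact (Hl Hz).
Qed.

Lemma radius_one_shift (a : nat -> C) : radius_one a -> radius_one (fun n => a (S n)).
Proof.
  intros Ha r Hr. destruct (Ha r Hr) as [M HM]. exists (M / r). intros n.
  specialize (HM (S n)). simpl in HM. apply Rmult_le_reg_r with r; [lra|].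
  unfold Rdiv. rewrite (Rmult_assoc M), Rinv_l; lra.
Qed.

Lemma radius_one_scal_INR (a : nat -> C) :
  radius_one a -> radius_one (fun n => (RtoC (INR n) * a n)%C).
Proof.
  intros Ha r Hr. set (s := (r + 1) / 2). assert (Hs : r < s < 1) by (unfold s; lra).
  destruct (Ha s) as [M HM]; [lra|].
  set (h := s / r - 1).
  assert (Hh : 0 < h).
  { unfold h. assert (1 < s / r); [|lra]. apply Rmult_lt_reg_r with r; [lra|].
    unfold Rdiv. rewrite Rmult_assoc, Rinv_l; lra. }
  exists (M / h). intros n.
  rewrite Cmod_mult, Cmod_R, Rabs_pos_eq by apply pos_INR.
  assert (B := poly n h Hh).
  replace (1 + h) with (s / r) in B by (unfold h; ring).
  assert (P1 := pow_lt r n (proj1 Hr)).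
  assert (E : (s / r) ^ n * r ^ n = s ^ n) by (rewrite <- Rpow_mult_distr; f_equal; field; lra).
  apply Rmult_le_reg_r with h; [exact Hh|].
  unfold Rdiv. rewrite (Rmult_assoc M), Rinv_l, Rmult_1_r by lra.
  eapply Rle_trans; [|apply (HM n)]. rewrite <- E.
  assert (P2 := Cmod_ge_0 (a n)).
  replace (INR n * Cmod (a n) * r ^ n * h) with (Cmod (a n) * (INR n * h * r ^ n)) by ring.
  apply Rmult_le_compat_l; [exact P2|]. apply Rmult_le_compat_r; lra.
Qed.

(** With [E n] for the remainder on the left, [E (n + 1) = w E n + n z^(n - 1) (w - z)^2]. *)
Lemma pow_second_difference (r : R) (z w : C) (n : nat) :
  0 < r -> Cmod z <= r -> Cmod w <= r ->
  Cmod (w ^ n - z ^ n - RtoC (INR n) * z ^ (n - 1) * (w - z)) * (r * r)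
    <= INR n * INR n * r ^ n * (Cmod (w - z) * Cmod (w - z)).
Proof.
  intros Hr Hz Hw. induction n as [|n IH].
  - assert (E : (w ^ 0 - z ^ 0 - RtoC (INR 0) * z ^ (0 - 1) * (w - z))%C = 0%C) by (simpl; ring).
    rewrite E, Cmod_0. simpl. lra.
  - set (E := (w ^ n - z ^ n - RtoC (INR n) * z ^ (n - 1) * (w - z))%C) in *.
    set (d := Cmod (w - z)) in *. assert (Hd : 0 <= d) by apply Cmod_ge_0.
    (* the factor [n] makes the truncated exponent [n - 1] harmless *)
    assert (Z : (RtoC (INR n) * z ^ n)%C = (RtoC (INR n) * (z ^ (n - 1) * z))%C).
    { destruct n as [|m]; [simpl; ring|]. replace (S m - 1)%nat with m by lia. simpl. ring. }
    assert (EE : (w ^ S n - z ^ S n - RtoC (INR (S n)) * z ^ (S n - 1) * (w - z))%C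
       = (w * E + RtoC (INR n) * z ^ (n - 1) * (w - z) * (w - z))%C).
    { replace (S n - 1)%nat with n by lia. rewrite S_INR, RtoC_plus.
      transitivity (w * (w ^ n - z ^ n) - (RtoC (INR n) * z ^ n) * (w - z))%C.
      - simpl. ring.
      - rewrite Z. unfold E. ring. }
    rewrite EE.
    assert (P : 0 <= r ^ n) by (apply pow_le; lra).
    assert (T1 : Cmod (w * E) * (r * r) <= r * (INR n * INR n * r ^ n * (d * d))).
    { rewrite Cmod_mult, Rmult_assoc. apply Rmult_le_compat; [apply Cmod_ge_0| |exact Hw|exact IH].
      apply Rmult_le_pos; [apply Cmod_ge_0|nra]. }
    assert (T2 : Cmod (RtoC (INR n) * z ^ (n - 1) * (w - z) * (w - z)) * (r * r)
                 <= INR n * r ^ S n * (d * d)).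
    { rewrite !Cmod_mult, Cmod_R, Rabs_pos_eq, Cmod_pow by apply pos_INR. fold d.
      destruct n as [|m]; [simpl; lra|]. replace (S m - 1)%nat with m by lia.
      assert (Q1 : Cmod z ^ m <= r ^ m) by (apply pow_incr; split; [apply Cmod_ge_0|exact Hz]).
      replace (INR (S m) * Cmod z ^ m * d * d * (r * r))
        with (INR (S m) * (d * d) * (r * r) * Cmod z ^ m) by ring.
      replace (INR (S m) * r ^ S (S m) * (d * d))
        with (INR (S m) * (d * d) * (r * r) * r ^ m) by (simpl; ring).
      apply Rmult_le_compat_l; [|exact Q1]. assert (Q := pos_INR (S m)).
      repeat apply Rmult_le_pos; lra. }
    assert (T3 := Cmod_triangle (w * E) (RtoC (INR n) * z ^ (n - 1) * (w - z) * (w - z))).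
    rewrite S_INR. assert (Q := pos_INR n).
    assert (Q2 : 0 <= r ^ S n * (d * d)).
    { apply Rmult_le_pos; [apply pow_le; lra|nra]. }
    change (r ^ S n) with (r * r ^ n) in *. nra.
Qed.

(** The remainder of the termwise linear approximation is at most
    [|w - z|^2] times the sum of [n^2 |a_n| r^(n - 2)]. *)
Lemma csum_deriv (a : nat -> C) (f f1 : C -> C) (z : C) :
  radius_one a -> (forall z, disk z -> csum a z (f z)) ->
  disk z -> csum (fun n => (RtoC (INR (S n)) * a (S n))%C) z (f1 z) ->
  cderiv f z (f1 z).
Proof.
  intros Ha Hf Hz Hf1. apply cderiv_eps. intros eps He.
  set (r := (1 + Cmod z) / 2). assert (Hz0 := Cmod_ge_0 z).
  unfold disk in Hz. assert (Hr : Cmod z < r < 1) by (unfold r; lra).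
  assert (Ha2 := radius_one_scal_INR _ (radius_one_scal_INR _ Ha)).
  destruct (radius_one_ex_series _ r Ha2) as [B HB]; [lra|].
  assert (HB0 : 0 <= B).
  { destruct (radius_one_csum _ (RtoC r) Ha2) as [l Hl].
    - unfold disk. rewrite Cmod_R, Rabs_pos_eq; lra.
    - apply Rle_trans with (1 := Cmod_ge_0 l).
      apply (is_series_Cmod_le _ _ _ _ (proj1 (csum_iff _ _ _) Hl) HB). intros n.
      rewrite Cmod_mult, Cmod_pow, Cmod_R, Rabs_pos_eq by lra. apply Rle_refl. }
  set (K := B / (r * r)). assert (HK : 0 <= K) by (apply Rdiv_le_0_compat; nra).
  exists (Rmin (r - Cmod z) (eps / (K + 1))). split.
  { apply Rmin_pos; [lra|]. apply Rdiv_lt_0_compat; lra. }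
  intros w Hw.
  assert (L1 := Rlt_le_trans _ _ _ Hw (Rmin_l _ _)).
  assert (L2 := Rlt_le_trans _ _ _ Hw (Rmin_r _ _)).
  assert (Hwr : Cmod w <= r).
  { replace w with (z + (w - z))%C by ring. eapply Rle_trans; [apply Cmod_triangle|]. lra. }
  assert (S1 : @is_series C_AbsRing C_NormedModule
    (fun n => (RtoC (INR n) * a n * z ^ (n - 1))%C) (f1 z)).
  { apply is_series_decr_1.
    apply (is_series_ext (fun n => (RtoC (INR (S n)) * a (S n) * z ^ n)%C)).
    - intros n. replace (S n - 1)%nat with n by lia. reflexivity.
    - apply csum_iff in Hf1.
      refine (eq_ind (f1 z) (fun l => is_series _ l) Hf1 _ _).
      change (f1 z = f1 z + - (RtoC 0 * a 0%nat * z ^ (0 - 1)))%C. ring. }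
  assert (S2 := proj1 (csum_iff _ _ _) (Hf w (Rle_lt_trans _ _ _ Hwr (proj2 Hr)))).
  assert (S3 := proj1 (csum_iff _ _ _) (Hf z Hz)).
  assert (S4 := is_series_minus (V := C_NormedModule) _ _ _ _
    (is_series_minus (V := C_NormedModule) _ _ _ _ S2 S3)
    (is_series_scal (V := C_NormedModule) (w - z)%C _ _ S1)).
  set (d := Cmod (w - z)) in *. assert (Hd : 0 <= d) by apply Cmod_ge_0.
  assert (Main : Cmod (f w - f z - (w - z) * f1 z)%C <= K * (d * d)).
  { replace (K * (d * d)) with ((d * d / (r * r)) * B) by (unfold K; field; lra).
    apply (is_series_Cmod_le _ _ _ _ S4
      (is_series_scal (V := R_NormedModule) (d * d / (r * r)) _ _ HB)).
    intros n.
    change (Cmod (a n * w ^ n - a n * z ^ n - (w - z) * (RtoC (INR n) * a n * z ^ (n - 1)))%C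
      <= d * d / (r * r) * (Cmod (RtoC (INR n) * (RtoC (INR n) * a n)) * r ^ n)).
    replace (a n * w ^ n - a n * z ^ n - (w - z) * (RtoC (INR n) * a n * z ^ (n - 1)))%C
      with (a n * (w ^ n - z ^ n - RtoC (INR n) * z ^ (n - 1) * (w - z)))%C by ring.
    rewrite !Cmod_mult, !Cmod_R, !Rabs_pos_eq by apply pos_INR.
    assert (D := pow_second_difference r z w n ltac:(lra) ltac:(lra) Hwr). fold d in D.
    apply Rmult_le_reg_r with (r * r); [nra|].
    replace (d * d / (r * r) * (INR n * (INR n * Cmod (a n)) * r ^ n) * (r * r))
      with (Cmod (a n) * (INR n * INR n * r ^ n * (d * d))) by (field; lra).
    rewrite Rmult_assoc. apply Rmult_le_compat_l; [apply Cmod_ge_0 | exact D]. }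
  replace (f w - f z - f1 z * (w - z))%C with (f w - f z - (w - z) * f1 z)%C by ring.
  eapply Rle_trans; [exact Main|]. rewrite <- Rmult_assoc.
  apply Rmult_le_compat_r; [exact Hd|].
  apply Rle_trans with ((K + 1) * (eps / (K + 1))); [nra|]. right. field. lra.
Qed.

Lemma csum_holo (a : nat -> C) (f : C -> C) :
  (forall z, disk z -> csum a z (f z)) ->
  exists f', holo disk f f' /\
    forall z, disk z -> csum (fun n => (RtoC (INR (S n)) * a (S n))%C) z (f' z).
Proof.
  intros Hf.
  assert (Ha : radius_one a) by (apply csum_radius; intros z Hz; exists (f z); auto).
  assert (Ha1 := radius_one_shift _ (radius_one_scal_INR _ Ha)). cbv beta in Ha1.
  assert (Ha2 := radius_one_shift _ (radius_one_scal_INR _ Ha1)). cbv beta in Ha2.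
  destruct (radius_one_sum _ Ha1) as [f1 H1]. destruct (radius_one_sum _ Ha2) as [f2 H2].
  exists f1. split; [|exact H1]. intros z Hz. split.
  - apply (csum_deriv a); auto.
  - eapply cderiv_cts. apply (csum_deriv _ f1 f2 z Ha1 H1 Hz). exact (H2 z Hz).
Qed.

Lemma csum_unique (a : nat -> C) (z l k : C) : csum a z l -> csum a z k -> l = k.
Proof.
  unfold is_pseries, is_series. intros H1 H2.
  exact (filterlim_locally_unique (F := eventually) _ _ _ H1 H2).
Qed.

Lemma csum_0 (a : nat -> C) (l : C) : csum a (RtoC 0) l -> l = a 0%nat.
Proof.
  intros H. apply (csum_unique a (RtoC 0)); [exact H|].
  exact (is_pseries_0 (V := C_NormedModule) a).
Qed.

(** Division by [z] at the level of series, so that the quotient is holomorphic at the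
    centre too, as Schwarz's lemma requires. *)
Lemma csum_factor (a : nat -> C) (f : C -> C) :
  (forall z, disk z -> csum a z (f z)) ->
  exists g : C -> C, (forall z, disk z -> csum (fun n => a (S n)) z (g z)) /\
    forall z, disk z -> f z = (a 0%nat + z * g z)%C.
Proof.
  intros Hf.
  assert (Ha : radius_one a) by (apply csum_radius; intros z Hz; exists (f z); auto).
  destruct (radius_one_sum _ (radius_one_shift _ Ha)) as [g P]. exists g.
  split; [exact P|]. intros z Hz. specialize (P z Hz).
  set (l := g z) in *. apply csum_iff in P.
  assert (Q : @is_series C_AbsRing C_NormedModule (fun n => (a n * z ^ n)%C) (a 0%nat + z * l)%C).
  { apply is_series_decr_1.
    apply (is_series_ext (fun n => scal (z : C_AbsRing) ((a (S n) * z ^ n)%C : C_NormedModule))).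
    - intros n. change ((z * (a (S n) * z ^ n))%C = (a (S n) * z ^ S n)%C). simpl. ring.
    - refine (eq_ind (z * l)%C (fun l => is_series _ l) _ _ _).
      + apply (is_series_scal (V := C_NormedModule)). exact P.
      + change ((z * l)%C = (a 0%nat + z * l + - (a 0%nat * z ^ 0))%C). simpl. ring. }
  apply (csum_unique a z); [apply Hf, Hz|]. apply csum_iff. exact Q.
Qed.

(** * The logarithmic derivative of a starlike function *)

Lemma Cmod_add_sqr (z w : C) :
  Cmod (z + w) * Cmod (z + w) = Cmod z * Cmod z + Cmod w * Cmod w + 2 * Re (z * Cconj w)%C.
Proof. rewrite !Cmod_sqr. destruct z, w; unfold Re, Im; simpl; ring. Qed.

Lemma Cmod_le_sqr (z w : C) : Cmod z * Cmod z <= Cmod w * Cmod w -> Cmod z <= Cmod w.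
Proof. intros H. assert (H1 := Cmod_ge_0 z). assert (H2 := Cmod_ge_0 w). nra. Qed.

(** Squaring and [Re (x * Cconj b) <= |x| |b|] lead to
    [(|x| - |b|)^2 <= r^2 (1 - |b| |x|)^2]. *)
Lemma schwarz_pick_algebra (b x : C) (r : R) :
  Cmod b <= 1 -> Cmod x <= 1 -> 0 <= r < 1 ->
  Cmod (x - b) <= r * Cmod (1 - Cconj b * x) ->
  Cmod x * (1 + Cmod b * r) <= Cmod b + r.
Proof.
  intros Hb Hx Hr H.
  assert (B0 := Cmod_ge_0 b). assert (X0 := Cmod_ge_0 x).
  set (s := Re (x * Cconj b)%C).
  assert (Hs : s <= Cmod x * Cmod b).
  { unfold s. rewrite <- (Cmod_conj b), <- Cmod_mult. apply Re_le_Cmod. }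
  assert (E1 : Cmod (x - b) * Cmod (x - b) = Cmod x * Cmod x + Cmod b * Cmod b - 2 * s).
  { unfold s. rewrite !Cmod_sqr. destruct x, b; unfold Re, Im; simpl; ring. }
  assert (E2 : Cmod (1 - Cconj b * x) * Cmod (1 - Cconj b * x)
     = 1 + Cmod b * Cmod b * (Cmod x * Cmod x) - 2 * s).
  { unfold s. rewrite !Cmod_sqr. destruct x, b; unfold Re, Im; simpl; ring. }
  assert (H0 := Cmod_ge_0 (x - b)). assert (H1 := Cmod_ge_0 (1 - Cconj b * x)).
  assert (S : Cmod (x - b) * Cmod (x - b)
    <= r * r * (Cmod (1 - Cconj b * x) * Cmod (1 - Cconj b * x))).
  { replace (r * r * (Cmod (1 - Cconj b * x) * Cmod (1 - Cconj b * x)))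
      with (r * Cmod (1 - Cconj b * x) * (r * Cmod (1 - Cconj b * x))) by ring.
    apply Rmult_le_compat; assumption. }
  rewrite E1, E2 in S.
  set (c := Cmod b) in *. set (y := Cmod x) in *.
  assert (Q : (y - c) * (y - c) <= (r * (1 - c * y)) * (r * (1 - c * y))).
  { assert (0 <= (1 - r * r) * (y * c - s)) by (apply Rmult_le_pos; nra). nra. }
  assert (Hcy : 0 <= r * (1 - c * y)) by (apply Rmult_le_pos; nra).
  assert (y - c <= r * (1 - c * y)); [|lra].
  destruct (Rle_dec (y - c) (r * (1 - c * y))) as [L|L]; [exact L|]. nra.
Qed.

(** [phi z = g' z / (2 g z + z g' z)] is [w / z] for the Schwarz function [w]
    such that [z f' / f = (1 + w) / (1 - w)].  The lemma of Schwarz and Pick for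
    [phi], whose value at the centre is [a_2 / 2], bounds [g' / g]. *)
Lemma starlike_log_derivative_bound (f : C -> C) (a : nat -> C) :
  class_S_star f a ->
  exists g g' : C -> C,
    holo disk g g' /\ (exists g'', holo disk g' g'') /\ g 0%C = 1%C /\
    holo disk f (fun z => (g z + z * g' z)%C) /\
    (forall z, disk z -> f z = (z * g z)%C) /\
    (forall z, disk z -> g z <> 0%C) /\
    (forall z, disk z -> 0 <= Re ((g z + z * g' z) * Cconj (g z))%C) /\
    Cmod (a 2%nat) <= 2 /\
    forall z, disk z -> Cmod (g' z) * (1 - Cmod z * Cmod z)
                        <= 2 * (Cmod (a 2%nat) / 2 + Cmod z) * Cmod (g z).
Proof.
  intros [[_ [Hinj [A0 [A1 Hser]]]] Hstar].
  destruct (csum_factor a f Hser) as [g [Sg Ef]].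
  assert (Ef' : forall z, disk z -> f z = (z * g z)%C).
  { intros z Hz. rewrite (Ef z Hz), A0. ring. }
  destruct (csum_holo _ g Sg) as [g' [Hg Sg']].
  destruct (csum_holo _ g' Sg') as [g'' [Hg' _]].
  destruct (csum_factor _ g Sg) as [T2 [ST2 ET2]].
  destruct (csum_holo _ T2 ST2) as [T2' [HT2 _]].
  destruct (csum_factor _ g' Sg') as [T1 [ST1 ET1]].
  destruct (csum_holo _ T1 ST1) as [T1' [HT1 _]].
  assert (Hf : holo disk f (fun z => (g z + z * g' z)%C)).
  { apply (holo_ext_on disk (fun z => (z * g z)%C) (fun z => (1 * g z + z * g' z)%C)).
    - exact disk_open.
    - intros z Hz. now rewrite Ef'.
    - intros z Hz. ring.
    - apply holo_mult; [apply holo_id | exact Hg]. }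
  assert (G0 : g 0%C = 1%C) by (rewrite (csum_0 _ _ (Sg _ disk_0)); exact A1).
  assert (G0' : g' 0%C = a 2%nat).
  { rewrite (csum_0 _ _ (Sg' _ disk_0)). simpl. ring. }
  assert (Gn : forall z, disk z -> g z <> 0%C).
  { intros z Hz E. destruct (Ceq_dec z 0%C) as [->|Hz0].
    - rewrite G0 in E. apply RtoC_inj in E. lra.
    - apply Hz0. apply Hinj; [exact Hz | exact disk_0 |].
      rewrite (Ef' z Hz), (Ef' _ disk_0), E. ring. }
  assert (F0 : (g 0 + 0 * g' 0)%C <> 0%C).
  { rewrite G0. replace (1 + 0 * g' 0)%C with (RtoC 1) by ring.
    intros E. apply RtoC_inj in E. lra. }
  assert (HRe : forall z, disk z -> 0 <= Re ((g z + z * g' z) * Cconj (g z))%C).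
  { intros z Hz. destruct (Ceq_dec z 0%C) as [->|Hz0].
    - rewrite G0. unfold Re. simpl. lra.
    - assert (H := starlike_Re f _ g g' Hf Hg Hinj F0 Ef' Gn Hstar z Hz).
      rewrite (Ef' z Hz) in H.
      assert (E : Re ((g z + z * g' z) * z * Cconj (z * g z))%C
        = Cmod z * Cmod z * Re ((g z + z * g' z) * Cconj (g z))%C).
      { rewrite Cmod_sqr. set (x := (g z + z * g' z)%C). set (y := g z).
        clearbody x y. destruct z, x, y; unfold Re, Im; simpl; ring. }
      cbv beta in H. rewrite E in H.
      assert (P := proj1 (Cmod_gt_0 _) Hz0). apply Rmult_le_reg_l with (Cmod z * Cmod z); nra. }
  set (h := fun z => (RtoC 2 * g z + z * g' z)%C).
  assert (Hh : holo disk h (fun z => (RtoC 2 * g' z + (1 * g' z + z * g'' z))%C)).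
  { apply holo_plus; [apply holo_scal, Hg | apply holo_mult; [apply holo_id | exact Hg']]. }
  assert (Hh2 : forall z, disk z ->
    Cmod (h z) * Cmod (h z) = Cmod (z * g' z) * Cmod (z * g' z)
      + 4 * Re ((g z + z * g' z) * Cconj (g z))%C).
  { intros z Hz. unfold h. rewrite !Cmod_sqr.
    set (x := (z * g' z)%C). set (y := g z). clearbody x y.
    destruct x, y; unfold Re, Im; simpl; ring. }
  assert (Hhn : forall z, disk z -> h z <> 0%C).
  { intros z Hz E. assert (H := HRe z Hz). assert (P := proj1 (Cmod_gt_0 _) (Gn z Hz)).
    assert (E2 : (z * g' z)%C = (- (RtoC 2 * g z))%C).
    { replace (z * g' z)%C with (h z - RtoC 2 * g z)%C by (unfold h; ring). rewrite E. ring. }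
    rewrite E2 in H.
    assert (E3 : Re ((g z + - (RtoC 2 * g z)) * Cconj (g z))%C = - (Cmod (g z) * Cmod (g z))).
    { rewrite Cmod_sqr. set (y := g z). clearbody y. destruct y; unfold Re, Im; simpl; ring. }
    nra. }
  set (phi := fun z => (g' z / h z)%C).
  assert (Hphi := holo_div disk _ _ _ _ Hg' Hh Hhn).
  assert (Bphi : forall z, disk z -> Cmod (phi z) <= 1).
  { apply (schwarz_quotient _ _ Hphi). intros z Hz. cbv beta.
    replace (z * (g' z / h z))%C with (z * g' z / h z)%C by (field; apply Hhn, Hz).
    assert (P := proj1 (Cmod_gt_0 _) (Hhn z Hz)).
    rewrite Cmod_div by apply Hhn, Hz. apply Rmult_le_reg_r with (Cmod (h z)); [exact P|].
    unfold Rdiv. rewrite Rmult_assoc, Rinv_l, Rmult_1_r, Rmult_1_l by lra.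
    apply Cmod_le_sqr. rewrite (Hh2 z Hz). assert (H := HRe z Hz). lra. }
  set (b := (a 2%nat / RtoC 2)%C).
  assert (C2n : RtoC 2 <> 0%C) by (intros E; apply RtoC_inj in E; lra).
  assert (Hb : Cmod b = Cmod (a 2%nat) / 2).
  { unfold b. rewrite Cmod_div by exact C2n. rewrite Cmod_R, Rabs_pos_eq; lra. }
  assert (Phi0 : phi 0%C = b).
  { unfold phi, h, b. rewrite G0, G0'. field; try exact C2n. }
  assert (Hb1 : Cmod b <= 1) by (rewrite <- Phi0; apply Bphi, disk_0).
  assert (B0 := Cmod_ge_0 b).
  assert (SP : forall z, disk z -> Cmod (phi z) * (1 + Cmod b * Cmod z) <= Cmod b + Cmod z).
  { intros z Hz. assert (Z0 := Cmod_ge_0 z). assert (Bz := Bphi z Hz).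
    assert (P0 := Cmod_ge_0 (phi z)).
    destruct (Rle_lt_or_eq_dec _ _ Hb1) as [Hlt|Heq]; [|rewrite Heq; nra].
    (* [(phi - b) / (1 - Cconj b * phi)] vanishes at the centre; division of its
       numerator by [z] is possible in the power series of [g] and [g'] *)
    set (N := fun z => (T1 z - RtoC 2 * b * T2 z - b * g' z)%C).
    assert (HN : holo disk N (fun z => (T1' z - RtoC 2 * b * T2' z - b * g'' z)%C)).
    { apply holo_minus; [apply holo_minus|]; [exact HT1 | apply holo_scal, HT2 | apply holo_scal, Hg']. }
    assert (EN : forall z, disk z -> (z * N z)%C = (g' z - b * h z)%C).
    { intros w Hw. unfold N, h.
      replace (w * (T1 w - RtoC 2 * b * T2 w - b * g' w))%C
        with (a 2%nat + w * T1 w - RtoC 2 * b * (1 + w * T2 w) - b * (w * g' w)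
              - (a 2%nat - RtoC 2 * b))%C by ring.
      replace (1 + w * T2 w)%C with (g w) by (rewrite (ET2 w Hw), A1; reflexivity).
      replace (a 2%nat + w * T1 w)%C with (g' w) by (rewrite (ET1 w Hw); simpl; ring).
      unfold b. field; try exact C2n. }
    assert (Hden : forall z, disk z -> (h z - Cconj b * g' z)%C <> 0%C).
    { intros w Hw. replace (h w - Cconj b * g' w)%C
        with (h w * (1 + Cconj b * (- phi w)))%C by (unfold phi; field; apply Hhn, Hw).
      apply Cmult_neq_0; [apply Hhn, Hw|]. apply moebius_denominator; [exact Hlt|].
      rewrite Cmod_opp. apply Bphi, Hw. }
    assert (Hpsi := holo_div disk _ _ _ _ HN
      (holo_minus _ _ _ _ _ Hh (holo_scal _ (Cconj b) _ _ Hg')) Hden).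
    assert (Epsi : forall w, disk w -> (w * (N w / (h w - Cconj b * g' w)))%C
       = ((phi w - b) / (1 - Cconj b * phi w))%C).
    { intros w Hw.
      assert (D : (1 - Cconj b * phi w)%C <> 0%C).
      { replace (1 - Cconj b * phi w)%C with (1 + Cconj b * (- phi w))%C by ring.
        apply moebius_denominator; [exact Hlt|]. rewrite Cmod_opp. apply Bphi, Hw. }
      replace (w * (N w / (h w - Cconj b * g' w)))%C
        with (w * N w / (h w - Cconj b * g' w))%C by (field; apply Hden, Hw).
      rewrite (EN w Hw).
      replace (g' w) with (phi w * h w)%C by (unfold phi; field; apply Hhn, Hw).
      field. split; [exact D|].
      replace (h w - Cconj b * (phi w * h w))%C with ((1 - Cconj b * phi w) * h w)%C by ring.
      apply Cmult_neq_0; [exact D | apply Hhn, Hw]. }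
    assert (Hmu : forall w, disk w -> 0 < Cmod (1 - Cconj b * phi w) /\
       Cmod (phi w - b) <= Cmod (1 - Cconj b * phi w)).
    { intros w Hw. split.
      - apply Cmod_gt_0.
        replace (1 - Cconj b * phi w)%C with (1 + Cconj b * (- phi w))%C by ring.
        apply moebius_denominator; [exact Hlt|]. rewrite Cmod_opp. apply Bphi, Hw.
      - apply Cmod_le_sqr. assert (I := moebius_identity b (- phi w)).
        replace (1 + Cconj b * - phi w)%C with (1 - Cconj b * phi w)%C in I by ring.
        replace (- phi w + b)%C with (- (phi w - b))%C in I by ring.
        rewrite !Cmod_opp in I.
        assert (Q1 := Bphi w Hw). assert (Q2 := Cmod_ge_0 (phi w)).
        assert (0 <= (1 - Cmod (phi w) * Cmod (phi w)) * (1 - Cmod b * Cmod b)); [|lra].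
        apply Rmult_le_pos; nra. }
    assert (Bpsi := schwarz_quotient _ _ Hpsi). cbv beta in Bpsi.
    assert (Bz2 : Cmod (N z / (h z - Cconj b * g' z)) <= 1).
    { apply Bpsi; [|exact Hz]. intros w Hw. rewrite (Epsi w Hw).
      destruct (Hmu w Hw) as [M1 M2].
      rewrite Cmod_div by (apply Cmod_gt_0; exact M1).
      apply Rmult_le_reg_r with (1 := M1). unfold Rdiv.
      rewrite Rmult_assoc, Rinv_l, Rmult_1_r, Rmult_1_l by lra. exact M2. }
    apply schwarz_pick_algebra; try assumption; [split; assumption|].
    destruct (Hmu z Hz) as [M1 M2].
    replace (phi z - b)%C with ((phi z - b) / (1 - Cconj b * phi z) * (1 - Cconj b * phi z))%C
      by (field; apply Cmod_gt_0; exact M1).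
    rewrite <- (Epsi z Hz), !Cmod_mult. apply Rmult_le_compat_r; [lra|]. nra. }
  exists g, g'. split; [exact Hg|]. split; [exists g''; exact Hg'|]. split; [exact G0|].
  split; [exact Hf|]. split; [exact Ef'|]. split; [exact Gn|]. split; [exact HRe|].
  split; [lra|]. intros z Hz. rewrite <- Hb.
  assert (S := SP z Hz). assert (Z0 := Cmod_ge_0 z). assert (X0 := Cmod_ge_0 (phi z)).
  assert (D0 := Cmod_ge_0 (g' z)). assert (K0 := Cmod_ge_0 (g z)).
  assert (Eg : g' z = (phi z * h z)%C) by (unfold phi; field; apply Hhn, Hz).
  assert (L : Cmod (g' z) <= Cmod (phi z) * (2 * Cmod (g z) + Cmod z * Cmod (g' z))).
  { rewrite Eg at 1. rewrite Cmod_mult. apply Rmult_le_compat_l; [exact X0|].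
    unfold h. eapply Rle_trans; [apply Cmod_triangle|].
    rewrite !Cmod_mult, Cmod_R, Rabs_pos_eq by lra. apply Rle_refl. }
  assert (L2 : Cmod (g' z) * (1 + Cmod b * Cmod z)
     <= (Cmod b + Cmod z) * (2 * Cmod (g z) + Cmod z * Cmod (g' z))).
  { apply Rle_trans with (Cmod (phi z) * (2 * Cmod (g z) + Cmod z * Cmod (g' z)) * (1 + Cmod b * Cmod z)).
    - apply Rmult_le_compat_r; [nra|exact L].
    - replace (Cmod (phi z) * (2 * Cmod (g z) + Cmod z * Cmod (g' z)) * (1 + Cmod b * Cmod z))
        with (Cmod (phi z) * (1 + Cmod b * Cmod z) * (2 * Cmod (g z) + Cmod z * Cmod (g' z))) by ring.
      apply Rmult_le_compat_r; [nra|exact S]. }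
  nra.
Qed.

(** * Exponential and logarithm *)

Definition Cexp (z : C) : C := polar (exp (Re z)) (Im z).

(** The principal branch on the right half-plane only. *)
Definition Clog (z : C) : C := (ln (Cmod z), atan (Im z / Re z)).

Lemma Cexp_plus (z w : C) : Cexp (z + w) = (Cexp z * Cexp w)%C.
Proof.
  unfold Cexp, polar, Re, Im; destruct z as [x y], w as [u v]; simpl.
  rewrite exp_plus, cos_plus, sin_plus. apply injective_projections; simpl; ring.
Qed.

Lemma Cexp_0 : Cexp 0%C = 1%C.
Proof.
  unfold Cexp, polar, Re, Im; simpl. rewrite exp_0, cos_0, sin_0.
  apply injective_projections; simpl; ring.
Qed.

Lemma Cmod_Cexp (z : C) : Cmod (Cexp z) = exp (Re z).
Proof. unfold Cexp. rewrite Cmod_polar. apply Rabs_pos_eq. left; apply exp_pos. Qed.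

Lemma Cexp_neq_0 (z : C) : Cexp z <> 0%C.
Proof. apply Cmod_gt_0. rewrite Cmod_Cexp. apply exp_pos. Qed.

Lemma derivable_pt_lim_0_eps (f : R -> R) (l : R) :
  derivable_pt_lim f 0 l -> forall eps, 0 < eps -> exists d, 0 < d /\
    forall h, Rabs h < d -> Rabs (f h - f 0 - l * h) <= eps * Rabs h.
Proof.
  intros H eps He. destruct (H eps He) as [d Hd].
  exists d. split; [apply cond_pos|]. intros h Hh.
  destruct (Req_dec h 0) as [->|Hn].
  - replace (f 0 - f 0 - l * 0) with 0 by ring. rewrite Rabs_R0. lra.
  - specialize (Hd h Hn Hh). rewrite Rplus_0_l in Hd.
    replace (f h - f 0 - l * h) with (((f h - f 0) / h - l) * h) by (field; exact Hn).
    rewrite Rabs_mult. apply Rmult_le_compat_r; [apply Rabs_pos | lra].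
Qed.

Lemma Cmod_le_parts (z : C) : Cmod z <= Rabs (Re z) + Rabs (Im z).
Proof.
  assert (H := Rabs_pos (Re z)). assert (H2 := Rabs_pos (Im z)).
  assert (H3 := Cmod_sqr z). assert (H4 := Cmod_ge_0 z).
  assert (E1 : Rabs (Re z) * Rabs (Re z) = Re z * Re z).
  { rewrite <- Rabs_mult. apply Rabs_pos_eq. nra. }
  assert (E2 : Rabs (Im z) * Rabs (Im z) = Im z * Im z).
  { rewrite <- Rabs_mult. apply Rabs_pos_eq. nra. }
  nra.
Qed.

Lemma Im_le_Cmod (z : C) : Rabs (Im z) <= Cmod z.
Proof. eapply Rle_trans; [apply Rmax_r | apply (Rmax_Cmod z)]. Qed.

Lemma cderiv_Cexp_0 : cderiv Cexp 0%C 1%C.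
Proof.
  apply cderiv_eps. intros eps He.
  assert (He' : 0 < eps / 8) by lra.
  destruct (derivable_pt_lim_0_eps _ _ derivable_pt_lim_exp_0 _ He') as [d1 [D1 H1]].
  destruct (derivable_pt_lim_0_eps _ _ (derivable_pt_lim_sin 0) _ He') as [d2 [D2 H2]].
  destruct (derivable_pt_lim_0_eps _ _ (derivable_pt_lim_cos 0) _ He') as [d3 [D3 H3]].
  rewrite cos_0, sin_0 in *.
  exists (Rmin (Rmin d1 d2) (Rmin d3 (Rmin 1 eps / 8 / (1 + eps)))). split.
  { repeat apply Rmin_pos; try assumption.
    repeat apply Rdiv_lt_0_compat; try lra. apply Rmin_pos; lra. }
  intros w Hw. replace (w - 0)%C with w in * by ring. rewrite Cexp_0.
  assert (L1 := Rlt_le_trans _ _ _ Hw (Rmin_l _ _)).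
  assert (L2 := Rlt_le_trans _ _ _ Hw (Rmin_r _ _)).
  assert (L3 := Rlt_le_trans _ _ _ L1 (Rmin_l _ _)).
  assert (L4 := Rlt_le_trans _ _ _ L1 (Rmin_r _ _)).
  assert (L5 := Rlt_le_trans _ _ _ L2 (Rmin_l _ _)).
  assert (L6 := Rlt_le_trans _ _ _ L2 (Rmin_r _ _)).
  assert (X := re_le_Cmod w). assert (Y := Im_le_Cmod w).
  set (x := Re w) in *. set (y := Im w) in *. set (m := Cmod w) in *.
  specialize (H1 x ltac:(lra)). specialize (H2 y ltac:(lra)). specialize (H3 y ltac:(lra)).
  rewrite exp_0 in H1.
  assert (M0 : 0 <= m) by apply Cmod_ge_0.
  assert (Hm : m * (1 + eps) <= Rmin 1 eps / 8).
  { apply Rlt_le in L6. apply Rmult_le_compat_r with (r := 1 + eps) in L6; [|lra].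
    eapply Rle_trans; [exact L6|]. right. field. lra. }
  assert (N1 := Rmin_l 1 eps). assert (N2 := Rmin_r 1 eps).
  assert (Ex : Rabs (exp x - 1) <= (1 + eps) * m).
  { replace (exp x - 1) with ((exp x - 1 - 1 * x) + x) by ring.
    eapply Rle_trans; [apply Rabs_triang|]. nra. }
  assert (E2 : exp x <= 2).
  { assert (T := Rle_abs (exp x - 1)). lra. }
  assert (Ep := exp_pos x).
  (* e^w - 1 - w = e^x (cos y - 1 + i (sin y - y)) + (e^x - 1 - x) + i y (e^x - 1) *)
  assert (R1 : Rabs (Re (Cexp w - 1 - 1 * w)%C) <= 3 * (eps / 8) * m).
  { replace (Re (Cexp w - 1 - 1 * w)%C)
      with (exp x * (cos y - 1 - - 0 * y) + (exp x - 1 - 1 * x))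
      by (unfold Cexp, polar, x, y, Re, Im; simpl; ring).
    eapply Rle_trans; [apply Rabs_triang|]. rewrite Rabs_mult, (Rabs_pos_eq (exp x)) by lra.
    assert (P := Rabs_pos (cos y - 1 - - 0 * y)).
    assert (exp x * Rabs (cos y - 1 - - 0 * y) <= 2 * (eps / 8 * m)); [|nra].
    apply Rmult_le_compat; [lra|exact P|exact E2|]. nra. }
  assert (R2 : Rabs (Im (Cexp w - 1 - 1 * w)%C) <= 3 * (eps / 8) * m).
  { replace (Im (Cexp w - 1 - 1 * w)%C)
      with (exp x * (sin y - 0 - 1 * y) + y * (exp x - 1))
      by (unfold Cexp, polar, x, y, Re, Im; simpl; ring).
    eapply Rle_trans; [apply Rabs_triang|].
    rewrite !Rabs_mult, (Rabs_pos_eq (exp x)) by lra.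
    assert (P := Rabs_pos (sin y - 0 - 1 * y)). assert (P2 := Rabs_pos y).
    assert (exp x * Rabs (sin y - 0 - 1 * y) <= 2 * (eps / 8 * m)).
    { apply Rmult_le_compat; [lra|exact P|exact E2|]. nra. }
    assert (Rabs y * Rabs (exp x - 1) <= m * (eps / 8)); [|nra].
    apply Rmult_le_compat; [exact P2|apply Rabs_pos|exact Y|]. lra. }
  eapply Rle_trans; [apply Cmod_le_parts|]. nra.
Qed.

Lemma cderiv_Cexp (z : C) : cderiv Cexp z (Cexp z).
Proof.
  assert (D : cderiv (fun w => (w + - z)%C) z (1 + 0)%C)
    by (apply cderiv_plus; [apply cderiv_id | apply cderiv_const]).
  assert (E0 : (z + - z)%C = 0%C) by ring.
  assert (D2 : cderiv (fun w => Cexp (w + - z)) z (1 * (1 + 0))%C).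
  { apply (cderiv_comp Cexp); [rewrite E0; exact cderiv_Cexp_0 | exact D]. }
  assert (D3 := cderiv_mult _ _ _ _ _ (cderiv_const (Cexp z) z) D2).
  replace (Cexp z) with (0 * Cexp (z + - z) + Cexp z * (1 * (1 + 0)))%C by ring.
  apply (cderiv_ext _ _ _ _ 1) with (3 := D3); [lra|].
  intros w _. rewrite <- Cexp_plus. f_equal. ring.
Qed.

Lemma Clog_spec (z : C) : 0 < Re z -> Cexp (Clog z) = z.
Proof.
  intros Hz. destruct z as [x y]. unfold Cexp, Clog, polar, Re, Im in *; simpl in *.
  assert (Hm : 0 < Cmod (x, y)) by (apply Cmod_gt_0; intros E; injection E; lra).
  rewrite exp_ln, cos_atan, sin_atan by exact Hm.
  assert (E : Cmod (x, y) = x * sqrt (1 + (y / x)²)).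
  { unfold Cmod; simpl. rewrite <- (sqrt_square x) at 3 by lra.
    rewrite <- sqrt_mult by (try nra; assert (H := Rle_0_sqr (y / x)); lra).
    f_equal. unfold Rsqr. field. lra. }
  assert (S : 0 < sqrt (1 + (y / x)²)).
  { apply sqrt_lt_R0. assert (H := Rle_0_sqr (y / x)); lra. }
  rewrite E. apply injective_projections; simpl; field; lra.
Qed.

Lemma cts_Clog (z : C) : 0 < Re z -> cts (T := C_UniformSpace) Clog z.
Proof.
  intros Hz.
  assert (Hm : 0 < Cmod z).
  { eapply Rlt_le_trans; [exact Hz | apply Re_le_Cmod]. }
  apply (cts_pair (T := C_UniformSpace)).
  - apply (rcts_comp (T := C_UniformSpace) ln).
    + apply derivable_continuous_pt. exists (/ Cmod z). apply derivable_pt_lim_ln, Hm.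
    + apply (rcts_Cmod (T := C_UniformSpace)), cts_id.
  - apply (rcts_comp (T := C_UniformSpace) atan).
    + apply derivable_continuous_pt, derivable_pt_atan.
    + apply (rcts_mult (T := C_UniformSpace)).
      * apply (rcts_Im (T := C_UniformSpace)), cts_id.
      * apply (rcts_comp (T := C_UniformSpace) Rinv).
        -- apply continuity_pt_inv; [apply derivable_continuous_pt, derivable_pt_id | lra].
        -- apply (rcts_Re (T := C_UniformSpace)), cts_id.
Qed.

Definition right_half_plane (z : C) : Prop := 0 < Re z.

Lemma holo_Clog : holo right_half_plane Clog (fun z => (1 / z)%C).
Proof.
  intros z Hz. unfold right_half_plane in Hz.
  assert (Hz0 : z <> 0%C) by (intros ->; simpl in Hz; lra).
  split.
  - rewrite <- (Clog_spec z Hz) at 2.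
    apply (cderiv_lift Cexp (fun w => w) Clog z 1%C (Cexp (Clog z)) (Re z) Hz).
    + intros b Hb. apply Clog_spec.
      assert (H := re_le_Cmod (b - z)). assert (H2 := Rle_abs (- Re (b - z)%C)).
      rewrite Rabs_Ropp in H2.
      replace (Re (b - z)%C) with (Re b - Re z) in * by (unfold Re; simpl; ring). lra.
    + apply cts_Clog, Hz.
    + apply cderiv_Cexp.
    + apply Cexp_neq_0.
    + apply cderiv_id.
  - apply (cts_div (T := C_UniformSpace)); [apply cts_const | apply cts_id | exact Hz0].
Qed.

Lemma holo_Cexp : holo (fun _ => True) Cexp Cexp.
Proof. intros z _. split; [|eapply cderiv_cts]; apply cderiv_Cexp. Qed.

(** * Integral means of starlike functions *)

Lemma exp_le_mono (x y : R) : x <= y -> exp x <= exp y.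
Proof. intros [H| ->]; [left; apply exp_increasing, H | apply Rle_refl]. Qed.

Lemma nonincreasing_of_derivative (F dF : R -> R) (a b : R) :
  a <= b -> (forall x, a <= x <= b -> is_derive F x (dF x) /\ dF x <= 0) -> F b <= F a.
Proof.
  intros Hab H.
  destruct (MVT_gen F a b dF) as [c [Hc E]].
  - rewrite Rmin_left, Rmax_right by exact Hab. intros x Hx. apply H. lra.
  - rewrite Rmin_left, Rmax_right by exact Hab. intros x Hx.
    apply continuity_pt_filterlim. eapply is_derive_rcts. apply H. exact Hx.
  - rewrite Rmin_left, Rmax_right in Hc by exact Hab. destruct (H c Hc) as [_ Hle]. nra.
Qed.

Lemma is_derive_ln_Cmod (f : C -> C) (c : R -> C) (s : R) (l d : C) :
  cderiv f (c s) l -> f (c s) <> 0%C ->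
  is_derive (fun x => Re (c x)) s (Re d) -> is_derive (fun x => Im (c x)) s (Im d) ->
  is_derive (fun x => ln (Cmod (f (c x)))) s (Re (l * d / f (c s))%C).
Proof.
  intros Df Hn D1 D2.
  destruct (cderiv_along f c s l d Df D1 D2) as [E1 E2].
  set (u := fun x => Re (f (c x))) in *. set (v := fun x => Im (f (c x))) in *.
  assert (P := proj1 (Cmod_gt_0 _) Hn). assert (Q := Cmod_sqr (f (c s))).
  fold (u s) (v s) in Q.
  assert (HQ : 0 < u s * u s + v s * v s) by nra.
  apply (is_derive_ext (fun x => ln (sqrt (u x * u x + v x * v x)))).
  { intros x. f_equal. unfold Cmod. f_equal. unfold u, v, Re, Im. simpl. ring. }
  assert (E : Re (l * d / f (c s))%C
    = (u s * Re (l * d)%C + v s * Im (l * d)%C) / (u s * u s + v s * v s)).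
  { unfold u, v in *. set (p := (l * d)%C). set (y := f (c s)) in *. clearbody p y.
    destruct p, y; unfold Re, Im in *; simpl in *. field. lra. }
  rewrite E. set (du := Re (l * d)%C) in *. set (dv := Im (l * d)%C) in *.
  change (is_derive u s du) in E1. change (is_derive v s dv) in E2.
  clearbody u v du dv. clear - E1 E2 HQ.
  assert (Hs : 0 < sqrt (u s * u s + v s * v s)) by (apply sqrt_lt_R0; exact HQ).
  assert (Hss := sqrt_sqrt _ (Rlt_le _ _ HQ)).
  assert (X1 : ex_derive u s) by (exists du; exact E1).
  assert (X2 : ex_derive v s) by (exists dv; exact E2).
  assert (Y1 := is_derive_unique _ _ _ E1). assert (Y2 := is_derive_unique _ _ _ E2).
  auto_derive.
  - repeat split; trivial.
  - change (Derive (fun x => u x) s) with (Derive u s).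
    change (Derive (fun x => v x) s) with (Derive v s).
    rewrite Y1, Y2. rewrite <- Hss at 3. field. lra.
Qed.

Section IntegralMeans.
Variables g g' : C -> C.
Variable c : R.
Hypothesis Hg : holo disk g g'.
Hypothesis G0 : g 0%C = 1%C.
Hypothesis Gn : forall z, disk z -> g z <> 0%C.
Hypothesis Hc : 0 <= c <= 1.
Hypothesis HRe : forall z, disk z -> 0 <= Re ((g z + z * g' z) * Cconj (g z))%C.
Hypothesis Hlog : forall z, disk z ->
  Cmod (g' z) * (1 - Cmod z * Cmod z) <= 2 * (c + Cmod z) * Cmod (g z).

Let K (r t : R) : R := Re (g' (polar r t) * polar 1 t / g (polar r t))%C.

Lemma disk_polar (r t : R) : -1 < r < 1 -> disk (polar r t).
Proof. intros Hr. unfold disk. rewrite Cmod_polar. apply Rabs_def1; lra. Qed.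

Lemma is_derive_ln_ray (r t : R) : -1 < r < 1 ->
  is_derive (fun x => ln (Cmod (g (polar x t)))) r (K r t).
Proof.
  intros Hr. destruct (polar_derive_r r t) as [D1 D2].
  apply (is_derive_ln_Cmod g (fun x => polar x t) r _ (polar 1 t)).
  - apply Hg, disk_polar, Hr.
  - apply Gn, disk_polar, Hr.
  - exact D1.
  - exact D2.
Qed.

(** Integration of [Hlog] along a radius, with
    [2 (c + r) / (1 - r^2) <= (1 + c) / (1 - r)]. *)
Lemma growth_bound (r t : R) : 0 <= r < 1 ->
  ln (Cmod (g (polar r t))) <= - (1 + c) * ln (1 - r).
Proof.
  intros Hr.
  set (F := fun x => ln (Cmod (g (polar x t))) + (1 + c) * ln (1 - x)).
  assert (F r <= F 0).
  { apply (nonincreasing_of_derivative F (fun x => K x t + (1 + c) * (- / (1 - x)))); [lra|].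
    intros x Hx. split.
    - apply (is_derive_plus (V := R_NormedModule)); [apply is_derive_ln_ray; lra|].
      apply (is_derive_scal (fun x => ln (1 - x))). auto_derive; [lra|field; lra].
    - assert (Hd : disk (polar x t)) by (apply disk_polar; lra).
      assert (P := proj1 (Cmod_gt_0 _) (Gn _ Hd)).
      assert (H := Hlog _ Hd). rewrite Cmod_polar, Rabs_pos_eq in H by lra.
      assert (HK : K x t <= Cmod (g' (polar x t)) / Cmod (g (polar x t))).
      { unfold K. eapply Rle_trans; [apply Re_le_Cmod|].
        rewrite Cmod_div, Cmod_mult, Cmod_polar, Rabs_R1, Rmult_1_r by (apply Gn, Hd).
        apply Rle_refl. }
      set (k := Cmod (g' (polar x t)) / Cmod (g (polar x t))) in *.
      assert (Ek : k * Cmod (g (polar x t)) = Cmod (g' (polar x t))) by (unfold k; field; lra).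
      rewrite <- Ek in H.
      assert (H2 : k * (1 - x * x) <= 2 * (c + x)) by (apply Rmult_le_reg_r with (1 := P); nra).
      assert (H3 : k * (1 - x) <= 1 + c) by nra.
      assert (H4 : k <= (1 + c) * / (1 - x)).
      { apply Rmult_le_reg_r with (1 - x); [lra|]. rewrite Rmult_assoc, Rinv_l; lra. }
      lra. }
  unfold F in H. rewrite polar_0, G0, Cmod_1, Rminus_0_r, ln_1 in H. lra.
Qed.

Lemma cts2_ray (h : C -> C) (r t : R) :
  cts (T := C_UniformSpace) h (polar r t) ->
  cts (T := RR) (fun p => h (polar (fst p) (snd p))) (r, t).
Proof.
  intros H. apply (cts_comp (T := RR) h (fun p => polar (fst p) (snd p))); [exact H|].
  apply (cts_polar (T := RR)); [apply rcts_fst | apply rcts_snd].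
Qed.

Lemma rcts_pow_ray (h : C -> C) (q r t : R) :
  cts (T := C_UniformSpace) h (polar r t) -> h (polar r t) <> 0%C ->
  rcts (T := RR) (fun p => exp (q * ln (Cmod (h (polar (fst p) (snd p)))))) (r, t).
Proof.
  intros H Hn. apply (rcts_comp (T := RR) exp).
  - apply derivable_continuous_pt, derivable_pt_exp.
  - apply (rcts_mult (T := RR)); [apply continuous_const|].
    apply (rcts_comp (T := RR) ln).
    + apply derivable_continuous_pt. eexists. apply derivable_pt_lim_ln.
      apply Cmod_gt_0. exact Hn.
    + apply (rcts_Cmod (T := RR)), cts2_ray, H.
Qed.

Lemma rcts_K (r t : R) : -1 < r < 1 -> rcts (T := RR) (fun p => K (fst p) (snd p)) (r, t).
Proof.
  intros Hr. assert (Hd := disk_polar r t Hr).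
  unfold K. apply (rcts_Re (T := RR)), (cts_div (T := RR)).
  - apply (cts_mult (T := RR)); [apply cts2_ray, Hg, Hd|].
    apply (cts_polar (T := RR)); [apply continuous_const | apply rcts_snd].
  - apply cts2_ray. apply (holo_cts disk g g'); [exact Hg | exact Hd].
  - apply Gn, Hd.
Qed.

Lemma one_plus_rK_nonneg (r t : R) : -1 < r < 1 -> 0 <= 1 + r * K r t.
Proof.
  intros Hr. assert (Hd := disk_polar r t Hr).
  assert (P := proj1 (Cmod_gt_0 _) (Gn _ Hd)). assert (H := HRe _ Hd).
  assert (E : Re ((g (polar r t) + polar r t * g' (polar r t)) * Cconj (g (polar r t)))%C
     = Cmod (g (polar r t)) * Cmod (g (polar r t)) * (1 + r * K r t)).
  { unfold K. assert (Q := Cmod_sqr (g (polar r t))). rewrite Q.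
    assert (Q2 : Re (g (polar r t)) * Re (g (polar r t)) + Im (g (polar r t)) * Im (g (polar r t)) <> 0)
      by nra.
    rewrite (polar_scal r t). rewrite (polar_scal r t) in Q2.
    set (e := polar 1 t) in *. set (y := g (RtoC r * e)%C) in *. set (x := g' (RtoC r * e)%C).
    clearbody e x y. destruct e, x, y; unfold Re, Im in *; simpl in *. field. lra. }
  rewrite E in H. apply Rmult_le_reg_l with (Cmod (g (polar r t)) * Cmod (g (polar r t))); nra.
Qed.

Hypothesis Hg2 : exists g'', holo disk g' g''.

(** [r K] is the real part of [z g' / g], which vanishes at the centre. *)
Lemma mean_one_plus_rK (r : R) : 0 < r < 1 ->
  is_RInt (fun t => 1 + r * K r t) 0 (2 * PI) (2 * PI).
Proof.
  intros Hr. destruct Hg2 as [g'' Hg'].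
  assert (H := holo_div disk _ _ _ _ (holo_mult _ _ _ _ _ (holo_id _) Hg') Hg Gn).
  assert (Hm : forall z, Cmod z <= r -> disk z) by (intros z Hz; unfold disk; lra).
  assert (HU : forall z, 0 < Cmod z < r -> disk z) by (intros z Hz; unfold disk; lra).
  assert (M := mean_value _ _ r (proj1 Hr) (fun z Hz => holo_cts _ _ _ _ H (Hm z Hz))
    (holo_mono _ _ _ _ HU H)). cbv beta in M.
  assert (Ez : (0 * g' 0 / g 0)%C = 0%C) by (rewrite G0; field).
  rewrite Ez in M. change (Re 0%C) with 0 in M. rewrite Rmult_0_r in M.
  assert (X : ex_RInt (fun t => r * K r t) 0 (2 * PI)).
  { apply ex_RInt_rcts. intros t. apply (rcts_mult (T := R_UniformSpace)); [apply continuous_const|].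
    apply (rcts_slice K), rcts_K. lra. }
  assert (E : RInt (fun t => r * K r t) 0 (2 * PI) = 0).
  { etransitivity; [|exact M]. apply RInt_ext. intros t _. unfold K. rewrite (polar_scal r t).
    set (e := polar 1 t). assert (Hn : g (RtoC r * e)%C <> 0%C).
    { unfold e. rewrite <- polar_scal. apply Gn, disk_polar. lra. }
    transitivity (Re (RtoC r * (g' (RtoC r * e) * e / g (RtoC r * e)))%C).
    - unfold Re; simpl; ring.
    - f_equal. field. exact Hn. }
  apply (RInt_correct (V := R_CompleteNormedModule)) in X. rewrite E in X.
  replace (2 * PI) with (plus ((2 * PI - 0) * 1) 0) at 2
    by (unfold plus; simpl; ring).
  apply (is_RInt_plus (V := R_NormedModule)); [|exact X].
  apply (is_RInt_const (V := R_NormedModule)).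
Qed.

(** Prawitz' argument: as [1 + r d/dr ln |g|] is nonnegative and has mean 1,
    [d/dr] of the mean of [|g|^q] is at most [q / r] times the maximum of [|g|^q];
    for [q (1 + c) < 1] the bound [growth_bound] makes it integrable. *)
Lemma integral_means_bounded (q : R) : 0 < q -> q * (1 + c) < 1 ->
  exists M, forall r, 0 <= r < 1 ->
    RInt (fun t => exp (q * ln (Cmod (g (polar r t))))) 0 (2 * PI) <= M.
Proof.
  intros Hq Hk. assert (HPI := PI_RGT_0).
  set (k := q * (1 + c)) in *. assert (Hk0 : 0 < k) by (unfold k; nra).
  set (v := fun r t => exp (q * ln (Cmod (g (polar r t))))).
  set (B := fun r => exp (- k * ln (1 - r))).
  set (I := fun r => RInt (v r) 0 (2 * PI)).
  change (exists M, forall r, 0 <= r < 1 -> I r <= M).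
  assert (HvB : forall r t, 0 <= r < 1 -> v r t <= B r).
  { intros r t Hr. unfold v, B. apply exp_le_mono.
    replace (- k * ln (1 - r)) with (q * (- (1 + c) * ln (1 - r))) by (unfold k; ring).
    apply Rmult_le_compat_l; [lra | apply growth_bound, Hr]. }
  assert (Cv : forall r t, -1 < r < 1 -> rcts (T := RR) (fun p => v (fst p) (snd p)) (r, t)).
  { intros r t Hr. apply (rcts_pow_ray g q r t).
    - apply (holo_cts disk g g'); [exact Hg | apply disk_polar, Hr].
    - apply Gn, disk_polar, Hr. }
  assert (Xv : forall r, -1 < r < 1 -> ex_RInt (v r) 0 (2 * PI)).
  { intros r Hr. apply ex_RInt_rcts. intros t. apply rcts_slice, Cv, Hr. }
  set (dv := fun r t => v r t * (q * K r t)).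
  assert (DI : forall r, 0 < r < 1 -> is_derive I r (RInt (dv r) 0 (2 * PI))).
  { intros r Hr. apply (is_derive_circle_int v dv 0 1 r Hr).
    - intros s t Hs. unfold v, dv.
      assert (D := is_derive_ln_ray s t ltac:(lra)).
      replace (v s t * (q * K s t)) with (scal (q * K s t) (v s t))
        by (unfold scal; simpl; unfold mult; simpl; ring).
      apply (is_derive_comp exp (fun x => q * ln (Cmod (g (polar x t))))).
      + apply is_derive_exp.
      + apply (is_derive_scal (fun x => ln (Cmod (g (polar x t))))). exact D.
    - intros s t Hs. apply (rcts_mult (T := RR)); [apply Cv; lra|].
      apply (rcts_mult (T := RR)); [apply continuous_const | apply rcts_K; lra].
    - intros s t Hs. apply rcts_slice, Cv. lra. }
  assert (Bdv : forall r, / 2 <= r < 1 -> RInt (dv r) 0 (2 * PI) <= 4 * PI * q * B r).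
  { intros r Hr.
    assert (W := mean_one_plus_rK r ltac:(lra)).
    assert (W2 := is_RInt_scal (V := R_NormedModule) _ _ _ (2 * q * B r) _ W).
    assert (X : ex_RInt (dv r) 0 (2 * PI)).
    { apply ex_RInt_rcts. intros t. apply rcts_slice.
      apply (rcts_mult (T := RR)); [apply Cv; lra|].
      apply (rcts_mult (T := RR)); [apply continuous_const | apply rcts_K; lra]. }
    replace (4 * PI * q * B r) with (scal (2 * q * B r) (2 * PI))
      by (unfold scal; simpl; unfold mult; simpl; ring).
    apply (is_RInt_le (dv r) _ 0 (2 * PI)) with (3 := W2); [lra| |].
    - apply (RInt_correct (V := R_CompleteNormedModule)), X.
    - intros t _. unfold scal; simpl; unfold mult; simpl.
      assert (N := one_plus_rK_nonneg r t ltac:(lra)).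
      assert (L := HvB r t ltac:(lra)).
      assert (V0 : 0 < v r t) by apply exp_pos. unfold dv.
      apply Rle_trans with (2 * q * v r t * (1 + r * K r t)).
      + destruct (Rle_dec 0 (K r t)).
        * assert (K r t <= 2 * (1 + r * K r t)) by nra.
          replace (2 * q * v r t * (1 + r * K r t)) with (v r t * (q * (2 * (1 + r * K r t)))) by ring.
          apply Rmult_le_compat_l; [lra|]. apply Rmult_le_compat_l; lra.
        * assert (v r t * (q * K r t) <= 0).
          { assert (0 <= v r t * (q * - K r t)) by (repeat apply Rmult_le_pos; lra). lra. }
          assert (0 <= 2 * q * v r t * (1 + r * K r t)) by (repeat apply Rmult_le_pos; lra). lra.
      + apply Rmult_le_compat_r; [exact N|]. apply Rmult_le_compat_l; lra. }
  (* a primitive of [4 * PI * q * B] *)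
  set (A := fun r => - (4 * PI * q / (1 - k)) * exp ((1 - k) * ln (1 - r))).
  exists (Rmax (2 * PI * B (/ 2)) (I (/ 2) - A (/ 2))). intros r Hr.
  destruct (Rle_dec r (/ 2)) as [L|L].
  - eapply Rle_trans; [|apply Rmax_l].
    assert (Hle : I r <= RInt (fun _ => B (/ 2)) 0 (2 * PI)).
    { apply RInt_le; [lra | apply Xv; lra | apply ex_RInt_const |].
      intros t _. eapply Rle_trans; [apply HvB, Hr|]. unfold B. apply exp_le_mono.
      assert (ln (1 - / 2) <= ln (1 - r)); [|nra]. apply ln_le; lra. }
    rewrite RInt_const in Hle. unfold scal in Hle; simpl in Hle; unfold mult in Hle; simpl in Hle. lra.
  - eapply Rle_trans; [|apply Rmax_r].
    assert (A0 : A r <= 0).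
    { unfold A. assert (0 < 4 * PI * q / (1 - k)) by (apply Rdiv_lt_0_compat; [nra|lra]).
      assert (E := exp_pos ((1 - k) * ln (1 - r))). nra. }
    assert (H : I r - A r <= I (/ 2) - A (/ 2)); [|lra].
    apply (nonincreasing_of_derivative (fun x => I x - A x)
      (fun x => RInt (dv x) 0 (2 * PI) - 4 * PI * q * B x)); [lra|].
    intros x Hx. split.
    + apply (is_derive_minus (V := R_NormedModule)); [apply DI; lra|].
      unfold A. auto_derive; [lra|].
      unfold B. replace ((1 - k) * ln (1 + - x)) with (- k * ln (1 - x) + ln (1 - x))
        by (unfold Rminus; ring).
      rewrite exp_plus, exp_ln by lra. field. lra.
    + assert (H := Bdv x ltac:(lra)). lra.
Qed.

(** Kolmogorov's argument: [W = 2 + z g' / g] has real part at least 1, so [W^s] is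
    holomorphic with [|W|^s <= Re W^s / cos (s PI / 2)], and [Re W^s] has a constant
    circular mean. *)
Lemma log_derivative_means_bounded (s : R) : 0 < s < 1 ->
  exists M, forall r, 0 < r < 1 ->
    ex_RInt (fun t => exp (s * ln (Cmod (RtoC 2 + polar r t * g' (polar r t) / g (polar r t))))) 0 (2 * PI) /\
    RInt (fun t => exp (s * ln (Cmod (RtoC 2 + polar r t * g' (polar r t) / g (polar r t))))) 0 (2 * PI) <= M.
Proof.
  intros Hs. assert (HPI := PI_RGT_0). destruct Hg2 as [g'' Hg'].
  set (W := fun z => (RtoC 2 + z * g' z / g z)%C).
  assert (HW := holo_plus disk _ _ _ _ (holo_const _ (RtoC 2))
    (holo_div disk _ _ _ _ (holo_mult _ _ _ _ _ (holo_id _) Hg') Hg Gn)).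
  assert (RW : forall z, disk z -> 1 <= Re (W z)).
  { intros z Hz. assert (P := proj1 (Cmod_gt_0 _) (Gn z Hz)). assert (H := HRe z Hz).
    assert (E : Re ((g z + z * g' z) * Cconj (g z))%C = Cmod (g z) * Cmod (g z) * (Re (W z) - 1)).
    { unfold W. assert (Q := Cmod_sqr (g z)). rewrite Q.
      assert (Q2 : Re (g z) * Re (g z) + Im (g z) * Im (g z) <> 0) by nra.
      set (x := g' z). set (y := g z) in *. clearbody x y.
      destruct z, x, y; unfold Re, Im in *; simpl in *. field. lra. }
    rewrite E in H. assert (0 <= Re (W z) - 1); [|lra].
    apply Rmult_le_reg_l with (Cmod (g z) * Cmod (g z)); nra. }
  assert (RW' : forall z, disk z -> right_half_plane (W z)).
  { intros z Hz. assert (H := RW z Hz). unfold right_half_plane. lra. }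
  assert (HL := holo_comp disk right_half_plane _ _ W _ holo_Clog HW RW').
  assert (HF := holo_comp disk (fun _ => True) _ _ _ _ holo_Cexp (holo_scal _ (RtoC s) _ _ HL)
    (fun _ _ => Logic.I)).
  set (F := fun z => Cexp (RtoC s * Clog (W z))).
  assert (cpos : 0 < cos (s * (PI / 2))) by (apply cos_gt_0; nra).
  assert (BF : forall z, disk z ->
    exp (s * ln (Cmod (W z))) * cos (s * (PI / 2)) <= Re (F z)).
  { intros z Hz. unfold F, Cexp, Clog, polar.
    set (th := atan (Im (W z) / Re (W z))).
    assert (T := atan_bound (Im (W z) / Re (W z))). fold th in T.
    replace (Re (RtoC s * (ln (Cmod (W z)), th))%C) with (s * ln (Cmod (W z)))
      by (unfold Re; simpl; ring).
    replace (Im (RtoC s * (ln (Cmod (W z)), th))%C) with (s * th) by (unfold Im; simpl; ring).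
    change (exp (s * ln (Cmod (W z))) * cos (s * (PI / 2))
      <= exp (s * ln (Cmod (W z))) * cos (s * th)).
    apply Rmult_le_compat_l; [left; apply exp_pos|].
    destruct (Rle_dec 0 th) as [L|L].
    - apply cos_decr_1; nra.
    - rewrite <- (cos_neg (s * th)). apply cos_decr_1; nra. }
  exists (2 * PI * Re (F 0%C) / cos (s * (PI / 2))). intros r Hr.
  assert (X : ex_RInt (fun t => exp (s * ln (Cmod (W (polar r t))))) 0 (2 * PI)).
  { apply ex_RInt_rcts. intros t.
    apply (rcts_slice (fun r t => exp (s * ln (Cmod (W (polar r t)))))).
    assert (Hd := disk_polar r t ltac:(lra)).
    apply (rcts_pow_ray W s r t); [exact (holo_cts _ _ _ _ HW Hd)|].
    intros E. assert (H := RW _ Hd). rewrite E in H. simpl in H. lra. }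
  split; [exact X|].
  assert (Hm : forall z, Cmod z <= r -> disk z) by (intros z Hz; unfold disk; lra).
  assert (HU : forall z, 0 < Cmod z < r -> disk z) by (intros z Hz; unfold disk; lra).
  assert (M := mean_value _ _ r (proj1 Hr) (fun z Hz => holo_cts _ _ _ _ HF (Hm z Hz))
    (holo_mono _ _ _ _ HU HF)).
  change (RInt (fun t => Re (F (polar r t))) 0 (2 * PI) = 2 * PI * Re (F 0%C)) in M.
  rewrite <- M.
  apply Rmult_le_reg_r with (1 := cpos).
  unfold Rdiv. rewrite (Rmult_assoc (RInt _ _ _) (/ _)), Rinv_l, Rmult_1_r by lra.
  rewrite Rmult_comm.
  assert (E : cos (s * (PI / 2)) * RInt (fun t => exp (s * ln (Cmod (W (polar r t))))) 0 (2 * PI)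
    = RInt (fun t => scal (cos (s * (PI / 2))) (exp (s * ln (Cmod (W (polar r t)))))) 0 (2 * PI)).
  { symmetry. apply (RInt_scal (V := R_CompleteNormedModule)). exact X. }
  change (cos (s * (PI / 2)) * RInt (fun t => exp (s * ln (Cmod (W (polar r t))))) 0 (2 * PI)
    <= RInt (fun t => Re (F (polar r t))) 0 (2 * PI)).
  rewrite E. apply RInt_le; [lra| | |].
  - apply (ex_RInt_scal (V := R_NormedModule)). exact X.
  - apply ex_RInt_rcts. intros t. apply (rcts_Re (T := R_UniformSpace)).
    apply (cts_comp (T := R_UniformSpace) F).
    + apply (holo_cts disk _ _ _ HF), disk_polar. lra.
    + apply (cts_polar (T := R_UniformSpace)); [apply continuous_const | apply continuous_id].
  - intros t _. unfold scal; simpl; unfold mult; simpl. rewrite Rmult_comm.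
    apply BF, disk_polar. lra.
Qed.
End IntegralMeans.

Lemma nneg_power_pos (x p : R) : 0 < x -> nneg_power x p = exp (p * ln x).
Proof. intros Hx. unfold nneg_power. destruct (Req_dec_T x 0); [lra|reflexivity]. Qed.

Lemma ex_RInt_pow_circle (h : C -> C) (p r : R) :
  (forall t, cts (T := C_UniformSpace) h (polar r t) /\ h (polar r t) <> 0%C) ->
  ex_RInt (fun t => exp (p * ln (Cmod (h (polar r t))))) 0 (2 * PI).
Proof.
  intros H. apply ex_RInt_rcts. intros t.
  apply (rcts_slice (fun r t => exp (p * ln (Cmod (h (polar r t)))))).
  apply (rcts_pow_ray h); apply H.
Qed.

Lemma integral_mean_eq (h : C -> C) (p r : R) :
  (forall t, h (polar r t) <> 0%C) ->
  integral_mean p h r = RInt (fun t => exp (p * ln (Cmod (h (polar r t))))) 0 (2 * PI).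
Proof.
  intros H. apply RInt_ext. intros t _. apply nneg_power_pos, Cmod_gt_0, H.
Qed.

Lemma holo_holomorphic (f f' : C -> C) : holo disk f f' -> holomorphic_disk f.
Proof. intros H z Hz. exists (f' z). apply is_derive_cderiv, H, Hz. Qed.

Lemma C_derive_holo (f f' : C -> C) (z : C) : holo disk f f' -> disk z -> C_derive f z = f' z.
Proof. intros H Hz. apply is_C_derive_unique, is_derive_cderiv, H, Hz. Qed.

Lemma starlike_Hardy (f : C -> C) (a : nat -> C) (q : R) :
  class_S_star f a -> 0 < q < 2 / (2 + Cmod (a 2%nat)) -> Hardy q f.
Proof.
  intros Hf Hq. assert (HPI := PI_RGT_0).
  destruct (starlike_log_derivative_bound f a Hf)
    as [g [g' [Hg [Hg2 [G0 [Hf' [Ef [Gn [HRe [A2 Hlog]]]]]]]]]].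
  set (c := Cmod (a 2%nat) / 2) in *.
  assert (Hc : 0 <= c <= 1) by (assert (H := Cmod_ge_0 (a 2%nat)); unfold c; lra).
  replace (2 / (2 + Cmod (a 2%nat))) with (/ (1 + c)) in Hq by (unfold c; field; unfold c in Hc; lra).
  assert (Hk : q * (1 + c) < 1).
  { apply Rmult_lt_reg_r with (/ (1 + c)); [apply Rinv_0_lt_compat; lra|].
    rewrite Rmult_assoc, Rinv_r; lra. }
  split; [exact (holo_holomorphic f _ Hf')|].
  destruct (integral_means_bounded g g' c Hg G0 Gn Hc HRe Hlog Hg2 q (proj1 Hq) Hk) as [M HM].
  exists (Rmax M 0). intros r Hr.
  destruct (Req_dec r 0) as [->|Hr0].
  - unfold integral_mean. rewrite (RInt_ext _ (fun _ => 0)).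
    + rewrite RInt_const. unfold scal; simpl; unfold mult; simpl. rewrite Rmult_0_r. apply Rmax_r.
    + intros t _. rewrite polar_0, (Ef _ disk_0), Cmult_0_l, Cmod_0.
      unfold nneg_power. now destruct (Req_dec_T 0 0).
  - eapply Rle_trans; [|apply Rmax_l]. eapply Rle_trans; [|apply (HM r Hr)].
    assert (Hn : forall t, f (polar r t) <> 0%C).
    { intros t. assert (Hd := disk_polar r t ltac:(lra)). rewrite (Ef _ Hd).
      apply Cmult_neq_0; [|apply Gn, Hd]. apply Cmod_gt_0. rewrite Cmod_polar, Rabs_pos_eq; lra. }
    rewrite integral_mean_eq by exact Hn.
    apply RInt_le; [lra| | |].
    + apply ex_RInt_pow_circle. intros t. split; [|apply Hn].
      apply (holo_cts disk _ _ _ Hf'), disk_polar. lra.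
    + apply ex_RInt_pow_circle. intros t.
      assert (Hd := disk_polar r t ltac:(lra)). split; [|apply Gn, Hd].
      apply (holo_cts disk _ _ _ Hg), Hd.
    + intros t _. assert (Hd := disk_polar r t ltac:(lra)).
      apply exp_le_mono, Rmult_le_compat_l; [lra|].
      apply ln_le; [apply Cmod_gt_0, Hn|].
      rewrite (Ef _ Hd), Cmod_mult, Cmod_polar, Rabs_pos_eq by lra.
      assert (H := Cmod_ge_0 (g (polar r t))). nra.
Qed.

(** [f' = g * (1 + z g' / g)], where [g] lies in [H^q] for [1 / q > 1 + c] and the other
    factor in [H^s] for [1 / s > 1]; Hoelder's inequality for [1 / p = 1 / q + 1 / s],
    in the weak form [x^p y^p <= x^q + y^s]. *)
Lemma starlike_derivative_Hardy (f : C -> C) (a : nat -> C) (p : R) :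
  class_S_star f a -> 0 < p < 2 / (4 + Cmod (a 2%nat)) -> Hardy p (C_derive f).
Proof.
  intros Hf Hp. assert (HPI := PI_RGT_0).
  destruct (starlike_log_derivative_bound f a Hf)
    as [g [g' [Hg [Hg2 [G0 [Hf' [Ef [Gn [HRe [A2 Hlog]]]]]]]]]].
  set (c := Cmod (a 2%nat) / 2) in *.
  assert (Hc : 0 <= c <= 1) by (assert (H := Cmod_ge_0 (a 2%nat)); unfold c; lra).
  replace (2 / (4 + Cmod (a 2%nat))) with (/ (2 + c)) in Hp by (unfold c; field; unfold c in Hc; lra).
  assert (Hp1 : 2 + c < / p).
  { rewrite <- (Rinv_inv (2 + c)). apply Rinv_lt_contravar; [|lra].
    apply Rmult_lt_0_compat; lra. }
  (* the gap in [1 / p > 2 + c] is shared equally between [1 / q > 1 + c] and [1 / s > 1] *)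
  set (e := (/ p - 2 - c) / 2). assert (He : 0 < e) by (unfold e; lra).
  set (q := / (1 + c + e)). set (s := / (1 + e)).
  assert (Hq : 0 < q) by (apply Rinv_0_lt_compat; lra).
  assert (Hqc : q * (1 + c) < 1).
  { unfold q. apply Rmult_lt_reg_r with (1 + c + e); [lra|].
    replace (/ (1 + c + e) * (1 + c) * (1 + c + e)) with (1 + c) by (field; lra). lra. }
  assert (Hs : 0 < s < 1).
  { unfold s. split; [apply Rinv_0_lt_compat; lra|].
    rewrite <- Rinv_1. apply Rinv_lt_contravar; lra. }
  assert (Hpqs : p * (/ q + / s) = 1).
  { unfold q, s, e. rewrite !Rinv_inv. field. lra. }
  set (f' := fun z => (g z + z * g' z)%C) in *.
  assert (EC : forall z, disk z -> C_derive f z = f' z) by (intros z Hz; apply C_derive_holo; assumption).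
  destruct Hg2 as [g'' Hg'].
  assert (Hf2 : holo disk f' (fun z => (g' z + (1 * g' z + z * g'' z))%C)).
  { apply holo_plus; [exact Hg | apply holo_mult; [apply holo_id | exact Hg']]. }
  assert (Fn : forall z, disk z -> f' z <> 0%C).
  { apply (univalent_derivative_neq_0 f f' Hf'); [exact (proj1 (proj2 (proj1 Hf)))|].
    unfold f'. rewrite G0. replace (1 + 0 * g' 0)%C with (RtoC 1) by ring.
    intros E. apply RtoC_inj in E. lra. }
  split.
  { apply (holo_holomorphic (C_derive f) (fun z => (g' z + (1 * g' z + z * g'' z))%C)).
    apply (holo_ext_on disk f' (fun z => (g' z + (1 * g' z + z * g'' z))%C)); try assumption.
    - exact disk_open.
    - intros z Hz. symmetry. apply EC, Hz.
    - reflexivity. }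
  assert (Hg2 : exists g'', holo disk g' g'') by (exists g''; exact Hg').
  destruct (integral_means_bounded g g' c Hg G0 Gn Hc HRe Hlog Hg2 q Hq Hqc) as [M1 HM1].
  destruct (log_derivative_means_bounded g g' Hg Gn HRe Hg2 s Hs) as [M2 HM2].
  set (W := fun z => (RtoC 2 + z * g' z / g z)%C) in *.
  exists (Rmax (M1 + M2) (2 * PI)). intros r Hr.
  assert (Hd : forall t, disk (polar r t)) by (intros t; apply disk_polar; lra).
  destruct (Req_dec r 0) as [->|Hr0].
  - unfold integral_mean. rewrite (RInt_ext _ (fun _ => 1)).
    + rewrite RInt_const. unfold scal; simpl; unfold mult; simpl.
      eapply Rle_trans; [|apply Rmax_r]. lra.
    + intros t _. rewrite polar_0, (EC _ disk_0). unfold f'. rewrite G0.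
      replace (1 + 0 * g' 0)%C with (RtoC 1) by ring. rewrite Cmod_1, nneg_power_pos by lra.
      rewrite ln_1, Rmult_0_r. apply exp_0.
  - eapply Rle_trans; [|apply Rmax_l].
    rewrite integral_mean_eq by (intros t; rewrite EC by apply Hd; apply Fn, Hd).
    destruct (HM2 r ltac:(lra)) as [X2 L2]. specialize (HM1 r Hr).
    assert (X1 : ex_RInt (fun t => exp (q * ln (Cmod (g (polar r t))))) 0 (2 * PI)).
    { apply ex_RInt_pow_circle. intros t. split; [|apply Gn, Hd].
      apply (holo_cts disk _ _ _ Hg), Hd. }
    apply Rle_trans with (RInt (fun t => exp (q * ln (Cmod (g (polar r t))))
       + exp (s * ln (Cmod (W (polar r t))))) 0 (2 * PI)).
    + apply RInt_le; [lra| | |].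
      * apply (ex_RInt_ext (fun t => exp (p * ln (Cmod (f' (polar r t)))))).
        { intros t _. now rewrite EC by apply Hd. }
        apply ex_RInt_pow_circle. intros t. split; [|apply Fn, Hd].
        apply (holo_cts disk _ _ _ Hf2), Hd.
      * apply (ex_RInt_plus (V := R_NormedModule)); assumption.
      * intros t _. rewrite EC by apply Hd. set (z := polar r t). assert (Hz : disk z) by apply Hd.
        assert (P1 := proj1 (Cmod_gt_0 _) (Gn z Hz)).
        assert (P2 := proj1 (Cmod_gt_0 _) (Fn z Hz)).
        assert (Ew : Cmod (g z) * Cmod (W z) = Cmod (f' z + g z)).
        { rewrite <- Cmod_mult. f_equal. unfold W, f'.
          replace (RtoC 2) with (1 + 1)%C by (rewrite C_two; reflexivity).
          field. apply Gn, Hz. }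
        assert (Lw : Cmod (f' z) <= Cmod (g z) * Cmod (W z)).
        { rewrite Ew. apply Cmod_le_sqr. rewrite (Cmod_add_sqr (f' z) (g z)).
          assert (H := HRe z Hz). fold (f' z) in H. assert (H0 := Cmod_ge_0 (g z)). nra. }
        assert (PW : 0 < Cmod (W z)) by (assert (H := Cmod_ge_0 (W z)); nra).
        assert (LL : ln (Cmod (f' z)) <= ln (Cmod (g z)) + ln (Cmod (W z))).
        { rewrite <- ln_mult by assumption. apply ln_le; assumption. }
        set (x := ln (Cmod (g z))) in *. set (y := ln (Cmod (W z))) in *.
        assert (Hmax : p * ln (Cmod (f' z)) <= Rmax (q * x) (s * y)).
        { apply Rle_trans with (p * (x + y)); [apply Rmult_le_compat_l; lra|].
          replace (p * (x + y)) with (p * / q * (q * x) + p * / s * (s * y)) by (field; lra).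
          assert (A1 : 0 < p * / q) by (apply Rmult_lt_0_compat; [lra | apply Rinv_0_lt_compat; lra]).
          assert (A3 : 0 < p * / s) by (apply Rmult_lt_0_compat; [lra | apply Rinv_0_lt_compat; lra]).
          assert (B1 := Rmax_l (q * x) (s * y)). assert (B2 := Rmax_r (q * x) (s * y)).
          set (m := Rmax (q * x) (s * y)) in *.
          replace m with (p * / q * m + p * / s * m)
            by (rewrite <- Rmult_plus_distr_r, <- Rmult_plus_distr_l, Hpqs; ring).
          apply Rplus_le_compat; apply Rmult_le_compat_l; lra. }
        apply exp_le_mono in Hmax.
        assert (Q1 := exp_pos (q * x)). assert (Q2 := exp_pos (s * y)).
        unfold Rmax in Hmax. destruct (Rle_dec (q * x) (s * y)); lra.
    + assert (E := RInt_plus (V := R_CompleteNormedModule) _ _ _ _ X1 X2).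
      change (RInt (fun t => exp (q * ln (Cmod (g (polar r t))))
        + exp (s * ln (Cmod (W (polar r t))))) 0 (2 * PI)
        = RInt (fun t => exp (q * ln (Cmod (g (polar r t))))) 0 (2 * PI)
        + RInt (fun t => exp (s * ln (Cmod (W (polar r t))))) 0 (2 * PI)) in E.
      change (RInt (fun t => exp (s * ln (Cmod (W (polar r t))))) 0 (2 * PI) <= M2) in L2.
      rewrite E. lra.
Qed.

(** * A sufficient condition for starlikeness *)

Lemma Cexp_opp (z : C) : Cexp z = 1%C -> Cexp (- z) = 1%C.
Proof.
  intros H. assert (E := Cexp_plus z (- z)). rewrite H in E.
  rewrite Cplus_opp_r, Cexp_0, Cmult_1_l in E. now symmetry.
Qed.

Lemma Cexp_surj (z : C) : z <> 0%C -> exists w, Cexp w = z.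
Proof.
  intros Hz. destruct (polar_surj z) as [t [_ E]]. exists (ln (Cmod z), t).
  unfold Cexp. simpl. rewrite exp_ln by (apply Cmod_gt_0, Hz). now symmetry.
Qed.

Lemma Re_of_Cexp (w : C) : Re w = ln (Cmod (Cexp w)).
Proof. now rewrite Cmod_Cexp, ln_exp. Qed.

Section Criterion.
Variables L L' : C -> C.
Hypothesis HL : holo disk L L'.
Hypothesis HP : forall z, disk z -> 0 < Re (1 + z * L' z)%C.

Let f (z : C) : C := (z * Cexp (L z))%C.
Let h (w : C) : C := (w + L (Cexp w))%C.

Lemma disk_Cexp (w : C) : Re w < 0 -> disk (Cexp w).
Proof. intros H. unfold disk. rewrite Cmod_Cexp, <- exp_0. apply exp_increasing, H. Qed.

(** [h] is a logarithm of [f] in the variable [w = ln z], with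
    [h' w = 1 + z * L' z] at [z = Cexp w]. *)
Lemma Cexp_log_f (w : C) : Cexp (h w) = f (Cexp w).
Proof. unfold h, f. apply Cexp_plus. Qed.

(** [Re h' > 0] on the left half-plane, which is convex. *)
Lemma log_f_monotone (w1 w2 : C) : Re w1 < 0 -> Re w2 < 0 -> w1 <> w2 ->
  0 < Re (Cconj (w1 - w2) * (h w1 - h w2))%C.
Proof.
  intros H1 H2 Hne.
  set (d := (w1 - w2)%C). assert (Hd : 0 < Cmod d) by (apply Cmod_gt_0, Csub_neq, Hne).
  set (c := fun s : R => (w2 + RtoC s * d)%C).
  set (F := fun s => Re (Cconj d * h (c s))%C).
  assert (Hc : forall s, 0 <= s <= 1 -> Re (c s) < 0).
  { intros s Hs. replace (Re (c s)) with (s * Re w1 + (1 - s) * Re w2)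
      by (unfold c, d, Re; simpl; ring). nra. }
  assert (D : forall s, 0 <= s <= 1 ->
    is_derive F s (Cmod d * Cmod d * Re (1 + Cexp (c s) * L' (Cexp (c s)))%C)).
  { intros s Hs. assert (Hds := disk_Cexp _ (Hc s Hs)).
    assert (Dh : cderiv h (c s) (1 + L' (Cexp (c s)) * Cexp (c s))%C).
    { apply cderiv_plus; [apply cderiv_id|].
      apply cderiv_comp; [apply HL, Hds | apply cderiv_Cexp]. }
    assert (Dm := cderiv_mult _ _ _ _ _ (cderiv_const (Cconj d) (c s)) Dh). cbv beta in Dm.
    assert (D1 : is_derive (fun x => Re (c x)) s (Re d)).
    { unfold c, d, Re; simpl. auto_derive; [trivial|ring]. }
    assert (D2 : is_derive (fun x => Im (c x)) s (Im d)).
    { unfold c, d, Im; simpl. auto_derive; [trivial|ring]. }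
    destruct (cderiv_along _ c s _ d Dm D1 D2) as [E _].
    assert (Eq : Re ((0 * h (c s) + Cconj d * (1 + L' (Cexp (c s)) * Cexp (c s))) * d)%C
      = Cmod d * Cmod d * Re (1 + Cexp (c s) * L' (Cexp (c s)))%C).
    { rewrite Cmod_sqr. set (e := Cexp (c s)). set (l := L' e). set (k := h (c s)).
      clearbody d e l k. destruct d, e, l, k; unfold Re, Im; simpl; ring. }
    rewrite <- Eq. exact E. }
  destruct (MVT_gen F 0 1 (fun s => Cmod d * Cmod d * Re (1 + Cexp (c s) * L' (Cexp (c s)))%C))
    as [s [Hs E]].
  - rewrite Rmin_left, Rmax_right by lra. intros s Hs. apply D. lra.
  - rewrite Rmin_left, Rmax_right by lra. intros s Hs.
    apply continuity_pt_filterlim. eapply is_derive_rcts. apply D. lra.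
  - rewrite Rmin_left, Rmax_right in Hs by lra.
    assert (P := HP _ (disk_Cexp _ (Hc s Hs))).
    assert (E2 : F 1 - F 0 = Re (Cconj d * (h w1 - h w2))%C).
    { unfold F. replace (c 1) with w1 by (unfold c, d; ring).
      replace (c 0) with w2 by (unfold c, d; ring).
      set (x := h w1). set (y := h w2). clearbody d x y.
      destruct d, x, y; unfold Re; simpl; ring. }
    rewrite <- E2, E. apply Rmult_lt_0_compat; [|lra]. apply Rmult_lt_0_compat; nra.
Qed.

(** [h w1 - h w2] is real for suitable logarithms, so by monotonicity it has the sign
    of [Re (w1 - w2)].  The logarithms can be chosen so that the difference is [ln t]
    exactly: an ambiguity [w] with [Cexp w = 1] is absorbed in the first one. *)
Lemma radial_monotone (z1 z2 : C) (t : R) :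
  disk z1 -> disk z2 -> z1 <> 0%C -> z2 <> 0%C -> 0 < t -> z1 <> z2 ->
  f z1 = (RtoC t * f z2)%C -> 0 < (ln (Cmod z1) - ln (Cmod z2)) * ln t.
Proof.
  intros D1 D2 N1 N2 Ht Hne E.
  destruct (Cexp_surj z1 N1) as [w1 E1]. destruct (Cexp_surj z2 N2) as [w2 E2].
  set (w := (h w1 - h w2 - RtoC (ln t))%C).
  assert (Et : Cexp (RtoC (ln t)) = RtoC t).
  { unfold Cexp, polar; simpl. rewrite exp_ln, cos_0, sin_0 by exact Ht.
    apply injective_projections; simpl; ring. }
  assert (Ew : Cexp w = 1%C).
  { assert (A : (Cexp w * (Cexp (RtoC (ln t)) * Cexp (h w2)))%C = Cexp (h w1)).
    { rewrite <- !Cexp_plus. f_equal. unfold w. ring. }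
    rewrite !Cexp_log_f, E1, E2, Et, E in A.
    assert (Hn : (RtoC t * f z2)%C <> 0%C).
    { apply Cmult_neq_0; [intros X; apply RtoC_inj in X; lra|].
      unfold f. apply Cmult_neq_0; [exact N2 | apply Cexp_neq_0]. }
    replace (Cexp w) with (Cexp w * (RtoC t * f z2) / (RtoC t * f z2))%C by (field; split;
      [|intros X; apply RtoC_inj in X; lra]; intros X; apply Hn; rewrite X; ring).
    rewrite A. field. split; [|intros X; apply RtoC_inj in X; lra].
    intros X; apply Hn; rewrite X; ring. }
  set (w1' := (w1 - w)%C).
  assert (E1' : Cexp w1' = z1).
  { unfold w1', Cminus. rewrite Cexp_plus, (Cexp_opp w Ew), E1. ring. }
  assert (Hh : (h w1' - h w2)%C = RtoC (ln t)).
  { unfold h at 1. rewrite E1'. unfold w1', w. unfold h at 1. rewrite E1. ring. }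
  assert (R1 : Re w1' = ln (Cmod z1)) by (rewrite <- E1'; apply Re_of_Cexp).
  assert (R2 : Re w2 = ln (Cmod z2)) by (rewrite <- E2; apply Re_of_Cexp).
  assert (Hneg : forall z, disk z -> z <> 0%C -> ln (Cmod z) < 0).
  { intros z Hz Hn. rewrite <- ln_1. apply ln_increasing; [apply Cmod_gt_0, Hn | exact Hz]. }
  assert (M := log_f_monotone w1' w2).
  rewrite R1, R2, Hh in M. specialize (M (Hneg _ D1 N1) (Hneg _ D2 N2)).
  assert (Hw : w1' <> w2) by (intros X; apply Hne; rewrite <- E1', <- E2, X; reflexivity).
  specialize (M Hw).
  replace (Re (Cconj (w1' - w2) * RtoC (ln t))%C) with ((Re w1' - Re w2) * ln t) in M
    by (unfold Re; simpl; ring).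
  rewrite R1, R2 in M. exact M.
Qed.

Lemma f_neq_0 (z : C) : z <> 0%C -> f z <> 0%C.
Proof. intros H. apply Cmult_neq_0; [exact H | apply Cexp_neq_0]. Qed.

Lemma f_0 : f 0%C = 0%C.
Proof. unfold f. ring. Qed.

Lemma criterion_injective : injective_disk f.
Proof.
  intros z w Hz Hw E.
  destruct (Ceq_dec z 0%C) as [->|Nz]; destruct (Ceq_dec w 0%C) as [->|Nw].
  - reflexivity.
  - exfalso. apply (f_neq_0 w Nw). rewrite <- E. apply f_0.
  - exfalso. apply (f_neq_0 z Nz). rewrite E. apply f_0.
  - destruct (Ceq_dec z w) as [Hzw|Hne]; [exact Hzw|exfalso].
    assert (M := radial_monotone z w 1 Hz Hw Nz Nw Rlt_0_1 Hne).
    rewrite ln_1, Rmult_0_r in M. apply (Rlt_irrefl 0), M. rewrite E. ring.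
Qed.

Lemma holo_criterion : holo disk f (fun z => (Cexp (L z) * (1 + z * L' z))%C).
Proof.
  assert (H := holo_mult _ _ _ _ _ (holo_id disk)
    (holo_comp disk (fun _ => True) _ _ _ _ holo_Cexp HL (fun _ _ => Logic.I))).
  eapply holo_ext; [| |exact H]; intros z; unfold f; ring.
Qed.

(** Continuity method: [f z = s f z0] has a solution in the disk [|z| < |z0|] for
    [s = 0], and none on its boundary for [0 <= s < 1]; by the minimum principle the
    solution persists when [s] increases by a fixed small step. *)
Lemma criterion_starlike : starlike_at_0 (disk_image f).
Proof.
  intros w t [z0 [Hz0 <-]] Ht.
  destruct (Ceq_dec z0 0%C) as [->|N0].
  { exists 0%C. split; [exact disk_0|]. rewrite f_0. ring. }
  destruct (Req_dec t 1) as [->|Ht1].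
  { exists z0. split; [exact Hz0|]. ring. }
  set (rho := Cmod z0). assert (Hr : 0 < rho) by (apply Cmod_gt_0, N0).
  assert (Hr1 : rho < 1) by exact Hz0.
  assert (Cf : forall z, Cmod z <= rho -> cts (T := C_UniformSpace) f z).
  { intros z Hz. apply (holo_cts disk _ _ _ holo_criterion). unfold disk. lra. }
  assert (Hpol : forall y, Cmod (polar rho y) = rho).
  { intros y. rewrite Cmod_polar. apply Rabs_pos_eq. lra. }
  destruct (positive_lower_bound (fun s y => Cmod (f (polar rho y) - RtoC s * f z0)%C) 0 t 0 (2 * PI))
    as [m [Hm Hmin]].
  { intros s y Hs Hy. split.
    - apply (rcts_Cmod (T := RR)), (cts_minus (T := RR)).
      + apply (cts_comp (T := RR) f (fun p => polar rho (snd p))).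
        * apply Cf. simpl. rewrite Hpol. lra.
        * apply (cts_polar (T := RR)); [apply continuous_const | apply rcts_snd].
      + apply (cts_mult (T := RR)); [|apply cts_const].
        apply (cts_RtoC (T := RR)), rcts_fst.
    - apply Cmod_gt_0, Csub_neq. intros E.
      assert (Np : polar rho y <> 0%C) by (apply Cmod_gt_0; rewrite Hpol; exact Hr).
      destruct (Req_dec s 0) as [->|Hs0].
      + apply (f_neq_0 _ Np). rewrite E. ring.
      + destruct (Ceq_dec (polar rho y) z0) as [Ez|Nz].
        * rewrite Ez in E. assert (E2 : ((1 - RtoC s) * f z0)%C = 0%C).
          { replace ((1 - RtoC s) * f z0)%C with (f z0 - RtoC s * f z0)%C by ring.
            rewrite <- E. ring. }
          revert E2. apply Cmult_neq_0; [|apply f_neq_0, N0].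
          rewrite <- RtoC_minus. intros X; apply RtoC_inj in X; lra.
        * assert (M := radial_monotone (polar rho y) z0 s).
          rewrite Hpol in M. unfold rho in M at 2.
          rewrite Rminus_diag, Rmult_0_l in M. apply (Rlt_irrefl 0), M; try assumption; try lra.
          unfold disk. rewrite Hpol. exact Hr1. }
  destruct (INR_unbounded (t * Cmod (f z0) / m)) as [N HN].
  assert (T0 : 0 <= t * Cmod (f z0) / m).
  { apply Rdiv_le_0_compat; [|exact Hm]. apply Rmult_le_pos; [lra | apply Cmod_ge_0]. }
  assert (HN0 : 0 < INR N) by lra.
  assert (Step : forall n, (n <= N)%nat -> exists z, Cmod z < rho /\
     (f z - RtoC (t * (INR n / INR N)) * f z0)%C = 0%C).
  { induction n as [|n IH]; intros Hn.
    - exists 0%C. rewrite Cmod_0, f_0. split; [exact Hr|].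
      replace (t * (INR 0 / INR N)) with 0 by (simpl; field; lra). ring.
    - destruct IH as [z [Hz Ez]]; [lia|].
      assert (HnN : INR (S n) <= INR N) by (apply le_INR, Hn).
      assert (Hq : 0 <= INR (S n) / INR N <= 1).
      { split; [apply Rdiv_le_0_compat; [apply pos_INR | exact HN0]|].
        apply Rmult_le_reg_r with (INR N); [exact HN0|].
        unfold Rdiv. rewrite Rmult_assoc, Rinv_l; lra. }
      set (s := t * (INR (S n) / INR N)).
      assert (Hs : 0 <= s <= t) by (unfold s; nra).
      apply (min_modulus_zero (fun z => (f z - RtoC s * f z0)%C)
        (fun z => (Cexp (L z) * (1 + z * L' z) - 0)%C) rho m z Hr Hz).
      + intros v Hv. apply (cts_minus (T := C_UniformSpace)); [apply Cf, Hv | apply cts_const].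
      + apply holo_minus; [|apply holo_const].
        apply (holo_mono disk); [|exact holo_criterion]. intros v Hv. unfold disk. lra.
      + intros v Hv. destruct (polar_surj v) as [y [Hy Ey]]. rewrite Hv in Ey. rewrite Ey.
        apply Hmin; assumption.
      + replace (f z - RtoC s * f z0)%C with (- (RtoC (t / INR N) * f z0))%C.
        * rewrite Cmod_opp, Cmod_mult, Cmod_R, Rabs_pos_eq by (apply Rdiv_le_0_compat; lra).
          apply Rmult_lt_reg_r with (INR N / m); [apply Rdiv_lt_0_compat; assumption|].
          replace (t / INR N * Cmod (f z0) * (INR N / m)) with (t * Cmod (f z0) / m) by (field; lra).
          replace (m * (INR N / m)) with (INR N) by (field; lra). exact HN.
        * replace (RtoC s) with (RtoC (t * (INR n / INR N)) + RtoC (t / INR N))%C.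
          -- replace (f z - (RtoC (t * (INR n / INR N)) + RtoC (t / INR N)) * f z0)%C
               with (f z - RtoC (t * (INR n / INR N)) * f z0 - RtoC (t / INR N) * f z0)%C by ring.
             rewrite Ez. ring.
          -- rewrite <- RtoC_plus. f_equal. unfold s. rewrite S_INR. field. lra. }
  destruct (Step N (Nat.le_refl N)) as [z [Hz Ez]].
  exists z. split; [unfold disk; lra|].
  replace (t * (INR N / INR N)) with t in Ez by (field; lra).
  replace (f z) with (f z - RtoC t * f z0 + RtoC t * f z0)%C by ring. rewrite Ez. ring.
Qed.
End Criterion.

(** * The extremal functions *)

Lemma csum_mul_z (a : nat -> C) (z l : C) :
  csum a z l -> csum (fun n => match n with O => RtoC 0 | S m => a m end) z (z * l)%C.
Proof.
  intros H. apply csum_iff. apply csum_iff in H.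
  apply is_series_decr_1.
  apply (is_series_ext (fun n => scal (z : C_AbsRing) ((a n * z ^ n)%C : C_NormedModule))).
  - intros n. change ((z * (a n * z ^ n))%C = (a n * z ^ S n)%C). simpl. ring.
  - refine (eq_ind (z * l)%C (fun l => is_series _ l) _ _ _).
    + apply (is_series_scal (V := C_NormedModule)). exact H.
    + change ((z * l)%C = (z * l + - (0 * z ^ 0))%C). simpl. ring.
Qed.

Lemma csum_plus (a b : nat -> C) (z k l : C) :
  csum a z k -> csum b z l -> csum (fun n => (a n + b n)%C) z (k + l)%C.
Proof.
  rewrite !csum_iff. intros H1 H2.
  apply (is_series_ext (fun n => plus ((a n * z ^ n)%C : C_NormedModule) (b n * z ^ n)%C)).
  - intros n. change ((a n * z ^ n + b n * z ^ n)%C = ((a n + b n) * z ^ n)%C). ring.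
  - apply (is_series_plus (V := C_NormedModule)); assumption.
Qed.

Lemma csum_scal (c : C) (a : nat -> C) (z l : C) :
  csum a z l -> csum (fun n => (c * a n)%C) z (c * l)%C.
Proof.
  rewrite !csum_iff. intros H.
  apply (is_series_ext (fun n => scal (c : C_AbsRing) ((a n * z ^ n)%C : C_NormedModule))).
  - intros n. change ((c * (a n * z ^ n))%C = (c * a n * z ^ n)%C). ring.
  - apply (is_series_scal (V := C_NormedModule)). exact H.
Qed.

Lemma holo_zero_const (f : C -> C) : holo disk f (fun _ => 0%C) ->
  forall z, disk z -> f z = f 0%C.
Proof.
  intros H z Hz.
  assert (Hs : forall s, 0 <= s <= 1 -> disk (RtoC s * z)).
  { intros s Hs. unfold disk in *. rewrite Cmod_mult, Cmod_R, Rabs_pos_eq by lra.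
    assert (P := Cmod_ge_0 z). nra. }
  assert (D : forall s, 0 <= s <= 1 ->
    is_derive (fun x => Re (f (RtoC x * z)%C)) s 0 /\ is_derive (fun x => Im (f (RtoC x * z)%C)) s 0).
  { intros s S. assert (D1 : is_derive (fun x => Re (RtoC x * z)%C) s (Re z)).
    { unfold Re; simpl. auto_derive; [trivial|ring]. }
    assert (D2 : is_derive (fun x => Im (RtoC x * z)%C) s (Im z)).
    { unfold Im; simpl. auto_derive; [trivial|ring]. }
    destruct (cderiv_along f (fun x => (RtoC x * z)%C) s _ z (proj1 (H _ (Hs s S))) D1 D2) as [E1 E2].
    replace (Re (0 * z)%C) with 0 in E1 by (unfold Re; simpl; ring).
    replace (Im (0 * z)%C) with 0 in E2 by (unfold Im; simpl; ring). now split. }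
  assert (E1 : Re (f (RtoC 0 * z)%C) = Re (f (RtoC 1 * z)%C)).
  { apply (eq_is_derive (V := R_NormedModule) (fun x => Re (f (RtoC x * z)%C))); [|lra].
    intros s S. apply D, S. }
  assert (E2 : Im (f (RtoC 0 * z)%C) = Im (f (RtoC 1 * z)%C)).
  { apply (eq_is_derive (V := R_NormedModule) (fun x => Im (f (RtoC x * z)%C))); [|lra].
    intros s S. apply D, S. }
  rewrite Cmult_0_l, Cmult_1_l in E1, E2.
  symmetry. apply injective_projections; assumption.
Qed.

(** Divergence at the rate of [ln (1 / (1 - r))], from [|1 - r e^(i t)| <= 1 - r + t]. *)
Lemma unbounded_integral_means (h : C -> C) (p c : R) :
  0 < c -> (forall z, / 2 <= Cmod z < 1 -> cts (T := C_UniformSpace) h z /\ h z <> 0%C) ->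
  (forall r t, / 2 <= r < 1 -> 0 <= t <= / 2 ->
     c / Cmod (1 - polar r t) <= exp (p * ln (Cmod (h (polar r t))))) ->
  ~ exists M, forall r, 0 <= r < 1 -> integral_mean p h r <= M.
Proof.
  intros Hc Hh Hlow [M HM]. assert (HPI := PI2_1).
  set (d := Rmin (/ 2) (exp (ln (/ 2) - M / c - 1))).
  assert (Hd : 0 < d) by (apply Rmin_pos; [lra | apply exp_pos]).
  assert (Hd1 : d <= / 2) by apply Rmin_l.
  assert (Hd2 : ln d <= ln (/ 2) - M / c - 1).
  { rewrite <- (ln_exp (ln (/ 2) - M / c - 1)). apply ln_le; [exact Hd | apply Rmin_r]. }
  set (r := 1 - d). assert (Hr : / 2 <= r < 1) by (unfold r; lra).
  specialize (HM r ltac:(lra)).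
  assert (Hcirc : forall t, cts (T := C_UniformSpace) h (polar r t) /\ h (polar r t) <> 0%C).
  { intros t. apply Hh. rewrite Cmod_polar, Rabs_pos_eq; lra. }
  rewrite integral_mean_eq in HM by apply Hcirc.
  set (u := fun t => exp (p * ln (Cmod (h (polar r t))))) in *.
  assert (Xu : forall a b, ex_RInt u a b).
  { intros a b. apply ex_RInt_rcts. intros t.
    apply (rcts_slice (fun r t => exp (p * ln (Cmod (h (polar r t)))))).
    apply (rcts_pow_ray h); apply Hcirc. }
  assert (Ch : RInt u 0 (/ 2) + RInt u (/ 2) (2 * PI) = RInt u 0 (2 * PI))
    by (apply (RInt_Chasles (V := R_CompleteNormedModule)); apply Xu).
  assert (P2 : 0 <= RInt u (/ 2) (2 * PI)).
  { apply RInt_ge_0; [lra | apply Xu |]. intros t _. left. apply exp_pos. }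
  assert (J : is_RInt (fun t => c / (d + t)) 0 (/ 2) (c * ln (d + / 2) - c * ln (d + 0))).
  { apply (is_RInt_derive (V := R_CompleteNormedModule) (fun t => c * ln (d + t))).
    - rewrite Rmin_left, Rmax_right by lra. intros t Ht. auto_derive; [lra|]. field. lra.
    - rewrite Rmin_left, Rmax_right by lra. intros t Ht.
      apply (ex_derive_continuous (V := R_NormedModule)). auto_derive. lra. }
  assert (P1 : c * ln (d + / 2) - c * ln (d + 0) <= RInt u 0 (/ 2)).
  { apply (is_RInt_le (fun t => c / (d + t)) u 0 (/ 2)) with (2 := J); [lra| |].
    - apply (RInt_correct (V := R_CompleteNormedModule)), Xu.
    - intros t Ht. eapply Rle_trans; [|apply (Hlow r t Hr); lra].
      assert (Hle : Cmod (1 - polar r t) <= d + t).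
      { replace (1 - polar r t)%C with (RtoC d + RtoC r * (1 - polar 1 t))%C.
        2:{ rewrite (polar_scal r t). unfold r. rewrite RtoC_minus. ring. }
        eapply Rle_trans; [apply Cmod_triangle|].
        rewrite Cmod_mult, !Cmod_R, !Rabs_pos_eq by lra.
        assert (Hch : Cmod (1 - polar 1 t) <= t).
        { assert (Q := Cmod_sqr (1 - polar 1 t)). assert (Q0 := Cmod_ge_0 (1 - polar 1 t)).
          assert (S1 : sin (t / 2) <= t / 2) by (left; apply sin_lt_x; lra).
          assert (S0 : 0 <= sin (t / 2)) by (apply sin_ge_0; lra).
          assert (E : Re (1 - polar 1 t)%C * Re (1 - polar 1 t)%C
             + Im (1 - polar 1 t)%C * Im (1 - polar 1 t)%C = 2 * sin (t / 2) * (2 * sin (t / 2))).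
          { unfold polar, Re, Im; simpl.
            assert (T1 := cos_2a_sin (t / 2)). replace (2 * (t / 2)) with t in T1 by field.
            assert (T2 := sin2_cos2 t). unfold Rsqr in T2. nra. }
          rewrite E in Q. nra. }
        assert (H0 := Cmod_ge_0 (1 - polar 1 t)). nra. }
      assert (Hpos : 0 < Cmod (1 - polar r t)).
      { apply Cmod_gt_0, Csub_neq. intros E. assert (E2 := Cmod_polar r t).
        rewrite <- E, Cmod_1, Rabs_pos_eq in E2; lra. }
      apply Rmult_le_compat_l; [lra|]. apply Rinv_le_contravar; assumption. }
  rewrite Rplus_0_r in P1.
  assert (L1 : ln (/ 2) <= ln (d + / 2)) by (apply ln_le; lra).
  assert (L2 : c * (M / c + 1) <= c * ln (d + / 2) - c * ln d) by nra.
  replace (c * (M / c + 1)) with (M + c) in L2 by (field; lra). lra.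
Qed.

Section Extremal.
Variable alpha : R.
Hypothesis Ha : 0 <= alpha <= 2.

Let beta : R := 1 + alpha / 2.
Let gamma : R := 1 - alpha / 2.

Definition extremal_log (z : C) : C :=
  (- (RtoC beta * Clog (1 - z) + RtoC gamma * Clog (1 + z)))%C.
Definition extremal_log' (z : C) : C := ((RtoC alpha + RtoC 2 * z) / ((1 - z) * (1 + z)))%C.
Definition extremal_fun (z : C) : C := (z * Cexp (extremal_log z))%C.

(** The coefficients of [(1 - z)^(-beta) (1 + z)^(-gamma)], by the recursion that its
    differential equation [(1 - z^2) G' = (alpha + 2 z) G] imposes. *)
Fixpoint extremal_pair (n : nat) : R * R :=
  match n with
  | O => (1, alpha)
  | S m => let (x, y) := extremal_pair m in (y, alpha / INR (m + 2) * y + x)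
  end.
Definition extremal_coef (n : nat) : R := fst (extremal_pair n).
Definition extremal_series (n : nat) : C :=
  match n with O => RtoC 0 | S m => RtoC (extremal_coef m) end.

Lemma extremal_coef_rec (n : nat) :
  extremal_coef (n + 2) = alpha / INR (n + 2) * extremal_coef (n + 1) + extremal_coef n.
Proof.
  unfold extremal_coef. replace (n + 2)%nat with (S (S n)) at 1 by lia.
  replace (n + 1)%nat with (S n) by lia. simpl.
  destruct (extremal_pair n) as [x y]. reflexivity.
Qed.

Lemma extremal_coef_bound (n : nat) : 0 <= extremal_coef n <= INR (S n).
Proof.
  assert (H : 0 <= extremal_coef n <= INR (S n) /\ 0 <= extremal_coef (S n) <= INR (S (S n))).
  { induction n as [|n [H1 H2]].
    - unfold extremal_coef; simpl. lra.
    - split; [exact H2|]. replace (S (S n)) with (n + 2)%nat by lia.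
      rewrite extremal_coef_rec. replace (n + 1)%nat with (S n) by lia.
      replace (n + 2)%nat with (S (S n)) by lia.
      rewrite !S_INR in *. assert (Q := pos_INR n). set (m := INR n) in *.
      assert (Hd : 0 < / (m + 1 + 1)) by (apply Rinv_0_lt_compat; lra).
      assert (E : / (m + 1 + 1) * (m + 1 + 1) = 1) by (apply Rinv_l; lra).
      assert (0 <= alpha / (m + 1 + 1)) by (unfold Rdiv; apply Rmult_le_pos; lra).
      assert (T : alpha / (m + 1 + 1) * extremal_coef (S n) <= alpha / (m + 1 + 1) * (m + 1 + 1))
        by (apply Rmult_le_compat_l; lra).
      replace (alpha / (m + 1 + 1) * (m + 1 + 1)) with alpha in T by (field; lra).
      assert (0 <= alpha / (m + 1 + 1) * extremal_coef (S n)) by (apply Rmult_le_pos; lra). lra. }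
  apply H.
Qed.

Lemma disk_one_minus (z : C) : disk z -> right_half_plane (1 - z)%C.
Proof.
  intros Hz. unfold right_half_plane, disk in *. assert (H := Re_le_Cmod z).
  replace (Re (1 - z)%C) with (1 - Re z) by (unfold Re; simpl; ring). lra.
Qed.

Lemma disk_one_plus (z : C) : disk z -> right_half_plane (1 + z)%C.
Proof.
  intros Hz. replace (1 + z)%C with (1 - (- z))%C by ring. apply disk_one_minus.
  unfold disk in *. now rewrite Cmod_opp.
Qed.

Lemma right_half_plane_neq_0 (z : C) : right_half_plane z -> z <> 0%C.
Proof. intros H ->. unfold right_half_plane in H. simpl in H. lra. Qed.

Lemma holo_extremal_log : holo disk extremal_log extremal_log'.
Proof.
  assert (A1 := holo_minus disk _ _ _ _ (holo_const _ 1%C) (holo_id _)).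
  assert (A2 := holo_plus disk _ _ _ _ (holo_const _ 1%C) (holo_id _)).
  assert (B1 := holo_comp disk right_half_plane _ _ _ _ holo_Clog A1 disk_one_minus).
  assert (B2 := holo_comp disk right_half_plane _ _ _ _ holo_Clog A2 disk_one_plus).
  assert (D := holo_opp _ _ _ (holo_plus _ _ _ _ _ (holo_scal _ (RtoC beta) _ _ B1)
    (holo_scal _ (RtoC gamma) _ _ B2))).
  eapply holo_ext_on; [exact disk_open | | | exact D].
  - intros z Hz. reflexivity.
  - intros z Hz. cbv beta. unfold extremal_log'.
    assert (N1 := right_half_plane_neq_0 _ (disk_one_minus z Hz)).
    assert (N2 := right_half_plane_neq_0 _ (disk_one_plus z Hz)).
    replace (RtoC beta) with (1 + RtoC alpha / RtoC 2)%C
      by (unfold beta; rewrite RtoC_plus, RtoC_div; [reflexivity|lra]).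
    replace (RtoC gamma) with (1 - RtoC alpha / RtoC 2)%C
      by (unfold gamma; rewrite RtoC_minus, RtoC_div; [reflexivity|lra]).
    rewrite C_two. field. repeat split; try assumption.
Qed.

Lemma extremal_log_0 : extremal_log 0%C = 0%C.
Proof.
  assert (E : Clog 1%C = 0%C).
  { unfold Clog. rewrite Cmod_1, ln_1. unfold Re, Im; simpl.
    replace (0 / 1) with 0 by field. now rewrite atan_0. }
  unfold extremal_log. replace (1 - 0)%C with (RtoC 1) by ring. replace (1 + 0)%C with (RtoC 1) by ring.
  rewrite E. ring.
Qed.

Lemma extremal_log'_Re (z : C) : disk z -> 0 < Re (1 + z * extremal_log' z)%C.
Proof.
  intros Hz.
  assert (N1 := right_half_plane_neq_0 _ (disk_one_minus z Hz)).
  assert (N2 := right_half_plane_neq_0 _ (disk_one_plus z Hz)).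
  assert (C2 : RtoC 2 <> 0%C) by (intros E; apply RtoC_inj in E; lra).
  assert (E : (1 + z * extremal_log' z)%C
    = (RtoC (beta / 2) * ((1 + z) / (1 - z)) + RtoC (gamma / 2) * ((1 - z) / (1 + z)))%C).
  { unfold extremal_log', beta, gamma. rewrite !RtoC_div by lra.
    rewrite RtoC_plus, RtoC_minus, !RtoC_div by lra. rewrite C_two in *.
    field. repeat split; assumption. }
  assert (Z2 : Re z * Re z + Im z * Im z < 1).
  { rewrite <- Cmod_sqr. unfold disk in Hz. assert (H := Cmod_ge_0 z). nra. }
  assert (R1 : 0 < Re ((1 + z) / (1 - z))%C).
  { destruct z as [x y]. unfold Re, Im in *; simpl in *.
    assert (0 < (1 + - x) * (1 + - x) + (0 + - y) * (0 + - y)) by nra.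
    match goal with |- 0 < ?e => replace e with ((1 - (x * x + y * y)) /
      ((1 + - x) * (1 + - x) + (0 + - y) * (0 + - y))) by (field; lra) end.
    apply Rdiv_lt_0_compat; lra. }
  assert (R2 : 0 < Re ((1 - z) / (1 + z))%C).
  { destruct z as [x y]. unfold Re, Im in *; simpl in *.
    assert (0 < (1 + x) * (1 + x) + (0 + y) * (0 + y)) by nra.
    match goal with |- 0 < ?e => replace e with ((1 - (x * x + y * y)) /
      ((1 + x) * (1 + x) + (0 + y) * (0 + y))) by (field; lra) end.
    apply Rdiv_lt_0_compat; lra. }
  rewrite E.
  replace (Re (RtoC (beta / 2) * ((1 + z) / (1 - z)) + RtoC (gamma / 2) * ((1 - z) / (1 + z)))%C)
    with (beta / 2 * Re ((1 + z) / (1 - z))%C + gamma / 2 * Re ((1 - z) / (1 + z))%C).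
  - unfold beta, gamma. assert (H1 : 0 < (1 + alpha / 2) / 2) by lra.
    assert (H2 : 0 <= (1 - alpha / 2) / 2) by lra.
    assert (T := Rmult_lt_0_compat _ _ H1 R1).
    assert (T2 := Rmult_le_pos _ _ H2 (Rlt_le _ _ R2)). lra.
  - set (a := ((1 + z) / (1 - z))%C). set (b := ((1 - z) / (1 + z))%C). clearbody a b.
    unfold Re; simpl. ring.
Qed.

Lemma extremal_radius : radius_one (fun n => RtoC (extremal_coef n)).
Proof.
  assert (H1 : radius_one (fun _ => RtoC 1)).
  { intros r Hr. exists 1. intros n. rewrite Cmod_1, Rmult_1_l.
    rewrite <- (pow1 n). apply pow_incr. lra. }
  assert (H2 := radius_one_shift _ (radius_one_scal_INR _ H1)). cbv beta in H2.
  intros r Hr. destruct (H2 r Hr) as [M HM]. exists M. intros n.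
  eapply Rle_trans; [|apply (HM n)].
  apply Rmult_le_compat_r; [apply pow_le; lra|].
  assert (B := extremal_coef_bound n).
  rewrite Cmod_mult, Cmod_1, Rmult_1_r, !Cmod_R, !Rabs_pos_eq by lra. apply B.
Qed.

(** The sum of the series and [Cexp extremal_log] solve the same first order linear
    equation with the same initial value. *)
Lemma extremal_csum (z : C) : disk z -> csum extremal_series z (extremal_fun z).
Proof.
  destruct (radius_one_sum _ extremal_radius) as [G SG].
  destruct (csum_holo _ G SG) as [G' [HG SG']].
  assert (ODE : forall v, disk v -> (G' v - v * (v * G' v))%C = (RtoC alpha * G v + RtoC 2 * (v * G v))%C).
  { intros v Hv.
    assert (S1 := csum_plus _ _ _ _ _ (SG' v Hv)
      (csum_scal (- (1))%C _ _ _ (csum_mul_z _ _ _ (csum_mul_z _ _ _ (SG' v Hv))))).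
    assert (S2 := csum_plus _ _ _ _ _ (csum_scal (RtoC alpha) _ _ _ (SG v Hv))
      (csum_scal (RtoC 2) _ _ _ (csum_mul_z _ _ _ (SG v Hv)))).
    replace (G' v - v * (v * G' v))%C with (G' v + - (1) * (v * (v * G' v)))%C by ring.
    refine (csum_unique _ v _ _ S1 _). clear S1.
    apply csum_iff. apply csum_iff in S2. revert S2. apply is_series_ext. intros n.
    f_equal. destruct n as [|[|n]].
    - rewrite Cmult_0_r, !Cplus_0_r. unfold extremal_coef; simpl. ring.
    - assert (E := extremal_coef_rec 0).
      change (0 + 2)%nat with 2%nat in E. change (0 + 1)%nat with 1%nat in E. rewrite E.
      rewrite Cmult_0_r, Cplus_0_r, <- !RtoC_mult, <- !RtoC_plus. f_equal.
      simpl. field.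
    - assert (E := extremal_coef_rec (S n)).
      replace (S n + 2)%nat with (S (S (S n))) in E by lia.
      replace (S n + 1)%nat with (S (S n)) in E by lia. rewrite E.
      assert (Q := pos_INR n).
      rewrite <- !RtoC_mult, <- !RtoC_opp, <- !RtoC_mult, <- !RtoC_plus. f_equal.
      rewrite !S_INR. field. lra. }
  assert (LG := holo_mult _ _ _ _ _ HG
    (holo_comp disk (fun _ => True) _ _ _ _ holo_Cexp (holo_opp _ _ _ holo_extremal_log)
       (fun _ _ => Logic.I))).
  assert (LG0 : holo disk (fun w => (G w * Cexp (- extremal_log w))%C) (fun _ => 0%C)).
  { eapply holo_ext_on; [exact disk_open | | | exact LG].
    - reflexivity.
    - intros v Hv. cbv beta.
      assert (N1 := right_half_plane_neq_0 _ (disk_one_minus v Hv)).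
      assert (N2 := right_half_plane_neq_0 _ (disk_one_plus v Hv)).
      assert (O : G' v = (extremal_log' v * G v)%C).
      { assert (O := ODE v Hv). unfold extremal_log'.
        replace ((RtoC alpha + RtoC 2 * v) / ((1 - v) * (1 + v)) * G v)%C
          with ((RtoC alpha * G v + RtoC 2 * (v * G v)) / ((1 - v) * (1 + v)))%C
          by (field; split; assumption).
        rewrite <- O. field. split; assumption. }
      rewrite O. ring. }
  intros Hz.
  assert (E := holo_zero_const _ LG0 z Hz). cbv beta in E.
  rewrite extremal_log_0 in E.
  assert (G00 : G 0%C = 1%C) by (rewrite (csum_0 _ _ (SG _ disk_0)); reflexivity).
  rewrite G00 in E. replace (- 0)%C with (RtoC 0) in E by ring. rewrite Cexp_0 in E.
  assert (E2 : G z = Cexp (extremal_log z)).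
  { assert (I := Cexp_plus (- extremal_log z) (extremal_log z)).
    replace (- extremal_log z + extremal_log z)%C with (RtoC 0) in I by ring. rewrite Cexp_0 in I.
    replace (G z) with (G z * (Cexp (- extremal_log z) * Cexp (extremal_log z)))%C by (rewrite <- I; ring).
    rewrite Cmult_assoc, E. ring. }
  unfold extremal_fun. rewrite <- E2. apply (csum_mul_z (fun n => RtoC (extremal_coef n))). apply SG, Hz.
Qed.

Lemma extremal_holo : holo disk extremal_fun (fun z => (Cexp (extremal_log z) * (1 + z * extremal_log' z))%C).
Proof. exact (holo_criterion _ _ holo_extremal_log). Qed.

Lemma extremal_class_S_star : class_S_star extremal_fun extremal_series.
Proof.
  split; [split; [|split; [|split; [|split]]]|].
  - exact (holo_holomorphic _ _ extremal_holo).
  - exact (criterion_injective _ _ holo_extremal_log extremal_log'_Re).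
  - reflexivity.
  - reflexivity.
  - exact extremal_csum.
  - exact (criterion_starlike _ _ holo_extremal_log extremal_log'_Re).
Qed.

Lemma extremal_a2 : Cmod (extremal_series 2%nat) = alpha.
Proof. simpl. unfold extremal_coef; simpl. rewrite Cmod_R. apply Rabs_pos_eq. lra. Qed.

Lemma Re_extremal_log (z : C) :
  Re (extremal_log z) = - (beta * ln (Cmod (1 - z)) + gamma * ln (Cmod (1 + z))).
Proof. unfold extremal_log, Clog, Re; simpl. ring. Qed.

Lemma ln_one_plus (z : C) : disk z -> ln (Cmod (1 + z)) <= ln 2.
Proof.
  intros Hz. apply ln_le.
  - apply Cmod_gt_0, right_half_plane_neq_0, disk_one_plus, Hz.
  - eapply Rle_trans; [apply Cmod_triangle|]. rewrite Cmod_1. unfold disk in Hz. lra.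
Qed.

Lemma extremal_not_Hardy : ~ Hardy (2 / (2 + alpha)) extremal_fun.
Proof.
  intros [_ HM]. revert HM.
  set (q := 2 / (2 + alpha)). assert (Hq : 0 < q) by (apply Rdiv_lt_0_compat; lra).
  assert (Hqb : q * beta = 1) by (unfold q, beta; field; lra).
  apply (unbounded_integral_means extremal_fun q (exp (q * (ln (/ 2) - gamma * ln 2)))).
  - apply exp_pos.
  - intros z Hz. assert (Dz : disk z) by (unfold disk; lra). split.
    + exact (holo_cts _ _ _ _ extremal_holo Dz).
    + apply Cmult_neq_0; [apply Cmod_gt_0; lra | apply Cexp_neq_0].
  - intros r t Hr Ht. assert (Dz := disk_polar r t ltac:(lra)).
    assert (P1 : 0 < Cmod (1 - polar r t)) by (apply Cmod_gt_0, right_half_plane_neq_0, disk_one_minus, Dz).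
    rewrite <- (exp_ln _ P1) at 1. unfold Rdiv. rewrite <- exp_Ropp, <- exp_plus.
    apply exp_le_mono. unfold extremal_fun.
    rewrite Cmod_mult, Cmod_Cexp, Cmod_polar, Rabs_pos_eq by lra.
    rewrite ln_mult, ln_exp, Re_extremal_log by (lra || apply exp_pos).
    assert (L1 : ln (/ 2) <= ln r) by (apply ln_le; lra).
    assert (L2 := ln_one_plus _ Dz).
    assert (L3 : gamma * ln (Cmod (1 + polar r t)) <= gamma * ln 2)
      by (apply Rmult_le_compat_l; [unfold gamma; lra | exact L2]).
    set (u := ln (Cmod (1 - polar r t))) in *. set (v := gamma * ln (Cmod (1 + polar r t))) in *.
    replace (q * (ln r + - (beta * u + v))) with (q * (ln r - v) + - (q * beta * u)) by ring.
    rewrite Hqb, Rmult_1_l. apply Rplus_le_compat_r. apply Rmult_le_compat_l; lra.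
Qed.

Lemma extremal_derivative_not_Hardy : ~ Hardy (2 / (4 + alpha)) (C_derive extremal_fun).
Proof.
  set (f' := fun z => (Cexp (extremal_log z) * (1 + z * extremal_log' z))%C).
  set (p := 2 / (4 + alpha)). assert (Hp : 0 < p) by (apply Rdiv_lt_0_compat; lra).
  intros [_ [M HM]].
  assert (HM' : exists M, forall r, 0 <= r < 1 -> integral_mean p f' r <= M).
  { exists M. intros r Hr. eapply Rle_trans; [right | apply (HM r Hr)].
    apply RInt_ext. intros t _. now rewrite (C_derive_holo _ _ _ extremal_holo) by (apply disk_polar; lra). }
  revert HM'.
  assert (Hpb : p * (beta + 1) = 1) by (unfold p, beta; field; lra).
  assert (A1 := holo_comp disk (fun _ => True) _ _ _ _ holo_Cexp holo_extremal_log (fun _ _ => Logic.I)).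
  apply (unbounded_integral_means f' p (exp (p * - ((gamma + 1) * ln 2)))).
  - apply exp_pos.
  - intros z Hz. assert (Dz : disk z) by (unfold disk; lra). split.
    + apply (cts_mult (T := C_UniformSpace)); [exact (holo_cts _ _ _ _ A1 Dz)|].
      apply (cts_plus (T := C_UniformSpace)); [apply cts_const|].
      apply (cts_mult (T := C_UniformSpace)); [apply cts_id | apply holo_extremal_log, Dz].
    + apply Cmult_neq_0; [apply Cexp_neq_0|]. apply right_half_plane_neq_0, extremal_log'_Re, Dz.
  - intros r t Hr Ht. assert (Dz := disk_polar r t ltac:(lra)). set (z := polar r t) in *.
    assert (N1 := right_half_plane_neq_0 _ (disk_one_minus z Dz)).
    assert (N2 := right_half_plane_neq_0 _ (disk_one_plus z Dz)).
    assert (P1 := proj1 (Cmod_gt_0 _) N1). assert (P2 := proj1 (Cmod_gt_0 _) N2).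
    rewrite <- (exp_ln _ P1) at 1. unfold Rdiv. rewrite <- exp_Ropp, <- exp_plus.
    apply exp_le_mono.
    set (N := (1 + RtoC alpha * z + z * z)%C).
    (* for [|t| <= 1/2] both [z] and [z^2] lie in the right half-plane *)
    assert (HN : 1 <= Cmod N).
    { eapply Rle_trans; [|apply Re_le_Cmod].
      assert (HPI := PI2_1).
      assert (C1 : 0 <= cos t) by (apply cos_ge_0; lra).
      assert (C2 : 0 <= cos (2 * t)) by (apply cos_ge_0; lra).
      rewrite cos_2a in C2.
      replace (Re N) with (1 + alpha * (r * cos t) + r * r * (cos t * cos t - sin t * sin t))
        by (unfold N, z, polar, Re; simpl; ring).
      assert (0 <= alpha * (r * cos t)) by (apply Rmult_le_pos; [lra | apply Rmult_le_pos; lra]).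
      assert (0 <= r * r * (cos t * cos t - sin t * sin t)) by (apply Rmult_le_pos; nra). lra. }
    assert (E : f' z = (Cexp (extremal_log z) * (N / ((1 - z) * (1 + z))))%C).
    { unfold f', extremal_log', N. rewrite C_two. f_equal. field. split; assumption. }
    rewrite E, Cmod_mult, Cmod_Cexp, Cmod_div, Cmod_mult by (apply Cmult_neq_0; assumption).
    assert (PD : 0 < Cmod (1 - z) * Cmod (1 + z)) by (apply Rmult_lt_0_compat; assumption).
    unfold Rdiv.
    rewrite ln_mult, ln_exp, ln_mult, ln_Rinv, ln_mult, Re_extremal_log
      by (try apply exp_pos; try apply Rmult_lt_0_compat; try apply Rinv_0_lt_compat; lra).
    assert (L0 : 0 <= ln (Cmod N)) by (rewrite <- ln_1; apply ln_le; lra).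
    assert (L2 := ln_one_plus _ Dz).
    assert (L3 : (gamma + 1) * ln (Cmod (1 + z)) <= (gamma + 1) * ln 2)
      by (apply Rmult_le_compat_l; [unfold gamma; lra | exact L2]).
    set (u := ln (Cmod (1 - z))) in *. set (v := ln (Cmod (1 + z))) in *.
    replace (p * (- (beta * u + gamma * v) + (ln (Cmod N) + - (u + v))))
      with (p * (ln (Cmod N) - (gamma + 1) * v) + - (p * (beta + 1) * u)) by ring.
    rewrite Hpb, Rmult_1_l. apply Rplus_le_compat_r. apply Rmult_le_compat_l; lra.
Qed.
End Extremal.

Theorem theorem7 :
  (forall (f : C -> C) (a : nat -> C), class_S_star f a ->
     (forall p : R, 0 < p < 2 / (4 + Cmod (a 2%nat)) -> Hardy p (C_derive f)) /\
     (forall q : R, 0 < q < 2 / (2 + Cmod (a 2%nat)) -> Hardy q f)) /\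
  (forall alpha : R, 0 <= alpha <= 2 ->
     (exists (f : C -> C) (a : nat -> C),
        class_S_star f a /\ Cmod (a 2%nat) = alpha /\
        ~ Hardy (2 / (4 + alpha)) (C_derive f)) /\
     (exists (f : C -> C) (a : nat -> C),
        class_S_star f a /\ Cmod (a 2%nat) = alpha /\
        ~ Hardy (2 / (2 + alpha)) f)).
Proof.
  split.
  - intros f a Hf. split.
    + intros p Hp. exact (starlike_derivative_Hardy f a p Hf Hp).
    + intros q Hq. exact (starlike_Hardy f a q Hf Hq).
  - intros alpha Ha. split; exists (extremal_fun alpha), (extremal_series alpha).
    + split; [exact (extremal_class_S_star alpha Ha)|]. split; [exact (extremal_a2 alpha Ha)|].
      exact (extremal_derivative_not_Hardy alpha Ha).
    + split; [exact (extremal_class_S_star alpha Ha)|]. split; [exact (extremal_a2 alpha Ha)|].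
      exact (extremal_not_Hardy alpha Ha).
Qed.
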